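(* Let $\mathcal{P}$ be an admissible probabilistic loop, $x \in \mathrm{Vars}(\mathcal{P})$ a program variable, $p \in \mathrm{Params}(\mathcal{P})$ a symbolic parameter, and $k \in \mathbb{N}$. Then the sensitivity $\partial_p \mathbb{E}(x_n^k)$ has an exponential polynomial closed-form (as a function of the loop counter $n$) that is computable.
   Context: **Probabilistic loops.** A probabilistic loop (or program) $\mathcal{P}$ consists of an initialization part (a sequence of statements) followed by a single non-nested unbounded loop ''while true: body'', where the body is a sequence of variable assignments and (possibly nested) if-statements. If-conditions are Boolean combinations of polynomial (in)equalities between program variables and constants. The right-hand side of every assignment is either (i) a draw from a probability distribution with existing moments (e.g. Normal, Uniform, Bernoulli) with constant parameters, or (ii) a probabilistic choice of polynomials in program variables $x = \mathit{poly}_1\{p_1\}\dots \mathit{poly}_k\{p_k\}$, meaning that $x$ is assigned $\mathit{poly}_i$ with probability $p_i$ (constant). Constants may be numbers, symbolic constants (parameters) representing arbitrary real numbers, or arithmetic expressions in these. $\mathrm{Vars}(\mathcal{P})$ is the set of program variables and $\mathrm{Params}(\mathcal{P})$ the set of symbolic parameters. Operationally $\mathcal{P}$ is a Markov chain on program states; for an arithmetic expression $\mathit{Expr}$ in program variables, $\mathit{Expr}_n$ denotes the random variable obtained by evaluating $\mathit{Expr}$ after the $n$th loop iteration. Expected values $\mathbb{E}(\cdot)$ are functions of $n$ and of the symbolic parameters. **Dependencies.** For $x,y \in \mathrm{Vars}(\mathcal{P})$, $x$ depends directly on $y$, written $x \to y$, if $y$ appears in an assignment of $x$, or an assignment of $x$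 occurs in an if-statement where $y$ appears in the if-condition. The direct dependency is non-linear, written $x \to^{N} y$, if $y$ appears non-linearly in an assignment of $x$. $\twoheadrightarrow$ is the transitive closure of $\to$, and $x \twoheadrightarrow^{N} y$ means that there is a chain of direct dependencies from $x$ to $y$ at least one of which is non-linear. **Admissible loop.** A loop is admissible if (1) all variables in branching conditions only assume values in a finite set, and (2) no variable $x$ is non-linearly self-dependent, i.e. $x \not\twoheadrightarrow^{N} x$ for all variables $x$. **Sensitivity.** $\partial_p \mathbb{E}(x_n^k)$ is the partial derivative of $\mathbb{E}(x_n^k)$ with respect to $p$, parameterized by the loop counter $n$. **Exponential polynomial.** A function of $n$ of the form $\sum_{j=0}^r P_j(n)\lambda_j^n$, where $P_j \in \overline{\mathbb{Q}}[n]$ and $\lambda_j \in \overline{\mathbb{Q}}$ ($\overline{\mathbb{Q}}$ the algebraic numbers), and where the $\lambda_j$ and the coefficients of the $P_j$ may contain symbolic parameters.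
   Formalization: The closed form may list finitely many initial n separately; parameter values where a branch condition flips are excluded; moments of the distributions must be computable arithmetic expressions in their parameters; the finite value sets, of parameter-independent size, are given with the loop. *)

(* Defs.v *)
From HB Require Import structures.
From mathcomp Require Import all_boot all_order all_algebra.
From mathcomp Require Import all_classical all_reals all_analysis.
From mathcomp Require Import measurable_realfun complex.

Set Implicit Arguments.
Unset Strict Implicit.
Unset Printing Implicit Defensive.

Import Order.TTheory GRing.Theory Num.Theory.
Import numFieldNormedType.Exports.

Local Open Scope classical_set_scope.
Local Open Scope ring_scope.

(** * A model of computation

    First-order pure LISP: data are binary trees, a program is a list of
    one-argument function bodies, [LCall f e] calls the [f]-th one, and [LArg] is
    the argument of the body being evaluated.  The entry point is function 0. *)

Inductive tree := Leaf | Node of tree & tree.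

Inductive lexpr :=
  | LArg
  | LNil
  | LCons of lexpr & lexpr
  | LHd of lexpr
  | LTl of lexpr
  | LCond of lexpr & lexpr & lexpr
  | LCall of nat & lexpr.

Definition lprog := seq lexpr.

Inductive leval (A : lprog) (a : tree) : lexpr -> tree -> Prop :=
  | leval_Arg : leval A a LArg a
  | leval_Nil : leval A a LNil Leaf
  | leval_Cons e1 e2 t1 t2 :
      leval A a e1 t1 -> leval A a e2 t2 -> leval A a (LCons e1 e2) (Node t1 t2)
  | leval_Hd e t1 t2 : leval A a e (Node t1 t2) -> leval A a (LHd e) t1
  | leval_HdLeaf e : leval A a e Leaf -> leval A a (LHd e) Leaf
  | leval_Tl e t1 t2 : leval A a e (Node t1 t2) -> leval A a (LTl e) t2
  | leval_TlLeaf e : leval A a e Leaf -> leval A a (LTl e) Leaf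
  | leval_CondT e e1 e2 t1 t2 t :
      leval A a e (Node t1 t2) -> leval A a e1 t -> leval A a (LCond e e1 e2) t
  | leval_CondF e e1 e2 t :
      leval A a e Leaf -> leval A a e2 t -> leval A a (LCond e e1 e2) t
  | leval_Call f e b t :
      leval A a e b -> leval A b (nth LNil A f) t -> leval A a (LCall f e) t.

Definition computes (A : lprog) (input output : tree) : Prop :=
  leval A input (LCall 0 LArg) output.

Fixpoint enc_nat (n : nat) : tree :=
  if n is n'.+1 then Node Leaf (enc_nat n') else Leaf.

Fixpoint enc_list (ts : seq tree) : tree :=
  if ts is t :: ts' then Node t (enc_list ts') else Leaf.

Definition enc_tag (tag : nat) (args : seq tree) : tree :=
  Node (enc_nat tag) (enc_list args).

Definition enc_int (z : int) : tree :=
  match z with Posz n => enc_tag 0 [:: enc_nat n]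
             | Negz n => enc_tag 1 [:: enc_nat n] end.

Definition enc_rat (q : rat) : tree :=
  Node (enc_int (numq q)) (enc_int (denq q)).

(** * Constants: arithmetic expressions in numbers and symbols from [V] *)

Inductive const (V : Type) :=
  | KNum of rat
  | KSym of V
  | KAdd of const V & const V
  | KOpp of const V
  | KMul of const V & const V
  | KInv of const V.
Arguments KNum {V}.

Section ConstSem.
Context {R : realType} {V : Type}.
Implicit Types (theta : V -> R) (c : const V).

Fixpoint const_eval theta c : R :=
  match c with
  | KNum q => ratr q
  | KSym v => theta v
  | KAdd c1 c2 => const_eval theta c1 + const_eval theta c2
  | KOpp c1 => - const_eval theta c1
  | KMul c1 c2 => const_eval theta c1 * const_eval theta c2
  | KInv c1 => (const_eval theta c1)^-1
  end.

(* No division by zero. *)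
Fixpoint const_defined theta c : bool :=
  match c with
  | KNum _ | KSym _ => true
  | KAdd c1 c2 | KMul c1 c2 => const_defined theta c1 && const_defined theta c2
  | KOpp c1 => const_defined theta c1
  | KInv c1 => const_defined theta c1 && (const_eval theta c1 != 0)
  end.

End ConstSem.

Fixpoint enc_const V (f : V -> nat) (c : const V) : tree :=
  match c with
  | KNum q => enc_tag 0 [:: enc_rat q]
  | KSym v => enc_tag 1 [:: enc_nat (f v)]
  | KAdd c1 c2 => enc_tag 2 [:: enc_const f c1; enc_const f c2]
  | KOpp c1 => enc_tag 3 [:: enc_const f c1]
  | KMul c1 c2 => enc_tag 4 [:: enc_const f c1; enc_const f c2]
  | KInv c1 => enc_tag 5 [:: enc_const f c1]
  end.

(** * Distributions

    The parametric families available to draws, indexed by [nat] (Bernoulli,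
    uniform, normal, exponential, ...).  [dist_law d a] is the law of family [d]
    with parameter list [a], meaningful when [dist_dom d a].  All moments must
    exist, and the [k]-th one must be given by an arithmetic expression
    [dist_moment d k] in the parameters ([KSym i] is the [i]-th parameter) which
    can be computed from [d] and [k]. *)

Record distributions (R : realType) := Distributions {
  dist_dom : nat -> set (seq R);
  dist_law : nat -> seq R -> probability (measurableTypeR R) R;
  dist_moment : nat -> nat -> const nat;
  dist_moment_computable : exists A : lprog, forall d k : nat,
    computes A (Node (enc_nat d) (enc_nat k)) (enc_const id (dist_moment d k));
  dist_momentP : forall (d : nat) (a : seq R) (k : nat), dist_dom d a ->
    [/\ (dist_law d a).-integrable setT (fun v : measurableTypeR R => (v ^+ k)%:E),
        const_defined (nth 0 a) (dist_moment d k)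
      & \int[dist_law d a]_v (v ^+ k) = const_eval (nth 0 a) (dist_moment d k)]
}.

(** * Syntax of loops with variables ['I_m] and parameters ['I_l] *)

Section Syntax.
Variables m l : nat.

(* A polynomial is a sum of monomials; a monomial is a coefficient and the list
   of its variables, repeated according to their multiplicities. *)
Definition monomial : Type := const 'I_l * seq 'I_m.
Definition polynomial : Type := seq monomial.

Inductive cond :=
  | CTrue
  | CEq of polynomial & polynomial
  | CLe of polynomial & polynomial
  | CLt of polynomial & polynomial
  | CNot of cond
  | CAnd of cond & cond
  | COr of cond & cond.

Inductive rhs :=
  | RDraw of nat & seq (const 'I_l)
  | RChoice of seq (polynomial * const 'I_l).

Inductive stmt :=
  | SSkip
  | SAssign of 'I_m & rhs
  | SSeq of stmt & stmt
  | SIf of cond & stmt & stmt.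

Record loop := Loop { loop_init : stmt; loop_body : stmt }.

Definition poly_vars (q : polynomial) : seq 'I_m :=
  flatten [seq a.2 | a <- q].

(* The variables occurring in a monomial of total degree at least 2.  This
   includes those of exponent 1: with [z := z + 1; x := x * z], the variable [x]
   takes the values [n`!], so [x] must count as non-linearly self-dependent. *)
Definition poly_nonlinear_vars (q : polynomial) : seq 'I_m :=
  flatten [seq a.2 | a <- q & (1 < size a.2)%N].

Fixpoint cond_vars (b : cond) : seq 'I_m :=
  match b with
  | CTrue => [::]
  | CEq q r | CLe q r | CLt q r => poly_vars q ++ poly_vars r
  | CNot b1 => cond_vars b1
  | CAnd b1 b2 | COr b1 b2 => cond_vars b1 ++ cond_vars b2
  end.

Definition rhs_polys (e : rhs) : seq polynomial :=
  if e is RChoice alts then [seq a.1 | a <- alts] else [::].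

Fixpoint stmt_conds (s : stmt) : seq cond :=
  match s with
  | SSkip | SAssign _ _ => [::]
  | SSeq s1 s2 => stmt_conds s1 ++ stmt_conds s2
  | SIf b s1 s2 => b :: stmt_conds s1 ++ stmt_conds s2
  end.

Definition loop_conds (P : loop) : seq cond :=
  stmt_conds (loop_init P) ++ stmt_conds (loop_body P).

(* The assignments of [s], each with the variables of the conditions of all the
   enclosing if-statements; [g] collects them on the way down. *)
Fixpoint stmt_assigns (g : seq 'I_m) (s : stmt) : seq ('I_m * rhs * seq 'I_m) :=
  match s with
  | SSkip => [::]
  | SAssign x e => [:: (x, e, g)]
  | SSeq s1 s2 => stmt_assigns g s1 ++ stmt_assigns g s2
  | SIf b s1 s2 =>
      stmt_assigns (g ++ cond_vars b) s1 ++ stmt_assigns (g ++ cond_vars b) s2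
  end.

Definition loop_assigns (P : loop) : seq ('I_m * rhs * seq 'I_m) :=
  stmt_assigns [::] (loop_init P) ++ stmt_assigns [::] (loop_body P).

Definition depends (P : loop) : rel 'I_m := fun x y =>
  has (fun a => (a.1.1 == x) &&
         (has (fun q => y \in poly_vars q) (rhs_polys a.1.2) || (y \in a.2)))
      (loop_assigns P).

Definition depends_nonlinear (P : loop) : rel 'I_m := fun x y =>
  has (fun a => (a.1.1 == x) &&
         has (fun q => y \in poly_nonlinear_vars q) (rhs_polys a.1.2))
      (loop_assigns P).

(* A chain of direct dependencies from [x] to [y] through a non-linear one. *)
Definition depends_nonlinear_trans (P : loop) (x y : 'I_m) : Prop :=
  exists u v : 'I_m, [/\ connect (depends P) x u,
    depends_nonlinear P u v & connect (depends P) v y].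

End Syntax.

Arguments CTrue {m l}.
Arguments SSkip {m l}.

(** * Probability kernels from which the semantics is assembled *)

Section KernelSeq.
Context d (T : measurableType d) (R : realType) (k1 k2 : R.-pker T ~> T).

Definition kseq : T -> {measure set T -> \bar R} := mkcomp_noparam k1 k2.

Let measurable_kseq U : measurable U -> measurable_fun [set: T] (kseq ^~ U).
Proof. exact: (measurable_kernel (mkcomp_noparam k1 k2)). Qed.

HB.instance Definition _ := isKernel.Build _ _ _ _ _ kseq measurable_kseq.

Let kseq_prob s : kseq s [set: T] = 1%E.
Proof.
rewrite /kseq /mkcomp_noparam /= /kcomp_noparam (eq_integral (cst 1%E)); last first.
  by move=> y _; rewrite prob_kernel.
by rewrite integral_cst// mul1e prob_kernel.
Qed.

HB.instance Definition _ := Kernel_isProbability.Build _ _ _ _ _ kseq kseq_prob.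

End KernelSeq.

Section KernelIf.
Context d (T : measurableType d) (R : realType) (k1 k2 : R.-pker T ~> T).
Variable b : T -> bool.

Definition kif of measurable_fun [set: T] b : T -> {measure set T -> \bar R} :=
  fun s => if b s then k1 s else k2 s.

Hypothesis mb : measurable_fun [set: T] b.

Let measurable_kif U : measurable U -> measurable_fun [set: T] (kif mb ^~ U).
Proof.
move=> mU; rewrite (_ : (fun s => _) = fun s => if b s then k1 s U else k2 s U).
  by apply: measurable_fun_ifT => //; exact: measurable_kernel.
by apply/funext => s; rewrite /kif; case: ifP.
Qed.

HB.instance Definition _ := isKernel.Build _ _ _ _ _ (kif mb) measurable_kif.

Let kif_prob s : kif mb s [set: T] = 1%E.
Proof. by rewrite /kif; case: ifP => _; rewrite prob_kernel. Qed.

HB.instance Definition _ := Kernel_isProbability.Build _ _ _ _ _ (kif mb) kif_prob.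

End KernelIf.

Section KernelDraw.
Context d d' (T : measurableType d) (V : measurableType d') (R : realType).
Variables (mu : probability V R) (f : T * V -> T).

Definition draw_measure of measurable_fun [set: T * V] f := fun s (U : set T) =>
  mu [set v | U (f (s, v))].

Hypothesis mf : measurable_fun [set: T * V] f.

Let measurable_section s U : measurable U -> measurable [set v | U (f (s, v))].
Proof.
move=> mU.
have mfs : measurable_fun [set: V] (fun v => f (s, v)).
  by apply: (measurableT_comp mf); exact: pair1_measurable.
by rewrite -[X in measurable X]setTI; exact: mfs.
Qed.

Let draw0 s : draw_measure mf s set0 = 0%E.
Proof. by rewrite /draw_measure measure0. Qed.

Let draw_ge0 s U : (0 <= draw_measure mf s U)%E.
Proof. exact: measure_ge0. Qed.

Let draw_sigma_additive s : semi_sigma_additive (draw_measure mf s).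
Proof.
move=> F mF tF mUF; rewrite /draw_measure.
rewrite [X in mu X](_ : _ = \bigcup_n [set v | F n (f (s, v))]); last by [].
apply: measure_semi_sigma_additive.
- by move=> n; exact: measurable_section.
- apply/trivIsetP => /= i j _ _ ij; move/trivIsetP : tF => /(_ i j I I ij) Fij.
  by apply/seteqP; split => // v [Fi Fj]; have : (F i `&` F j) (f (s, v)) by []; rewrite Fij.
- exact: (measurable_section s mUF).
Qed.

HB.instance Definition _ s := isMeasure.Build _ _ _ (draw_measure mf s)
  (draw0 s) (draw_ge0 s) (@draw_sigma_additive s).

Definition kdraw : T -> {measure set T -> \bar R} := draw_measure mf.

Let measurable_kdraw U : measurable U -> measurable_fun [set: T] (kdraw ^~ U).
Proof.
move=> mU.
have mfU : measurable (f @^-1` U) by rewrite -[X in measurable X]setTI; exact: mf.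
rewrite (_ : (fun s => _) = mu \o xsection (f @^-1` U)).
  exact: measurable_fun_xsection.
by apply/funext => s; rewrite /kdraw /= /draw_measure xsectionE.
Qed.

HB.instance Definition _ := isKernel.Build _ _ _ _ _ kdraw measurable_kdraw.

Let kdraw_prob s : kdraw s [set: T] = 1%E.
Proof. exact: probability_setT. Qed.

HB.instance Definition _ := Kernel_isProbability.Build _ _ _ _ _ kdraw kdraw_prob.

End KernelDraw.

Section KernelChoice.
Context d (T : measurableType d) (R : realType).
Variables (ps : seq R) (g : nat -> T -> T).

Definition is_distr : bool := all (fun r => 0 <= r) ps && (\sum_(r <- ps) r == 1).

(* If [ps] is not a probability distribution, alternative 0 is always taken. *)
Definition choice_weight (i : nat) : R :=
  if is_distr then nth 0 ps i else (i == 0)%:R.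

Lemma choice_weight_ge0 i : 0 <= choice_weight i.
Proof.
rewrite /choice_weight; case: ifPn => [/andP[/allP ps0 _]|_]; last by rewrite ler0n.
by have [/(mem_nth 0)/ps0//|ips] := ltnP i (size ps); rewrite nth_default.
Qed.

Definition choice_measure (s : T) : {measure set T -> \bar R} :=
  msum (fun i => mscale (NngNum (choice_weight_ge0 i)) (dirac (g i s)))
       (size ps).+1.

Definition kchoice of (forall i, measurable_fun [set: T] (g i)) :=
  choice_measure.

Hypothesis mg : forall i, measurable_fun [set: T] (g i).

Let measurable_kchoice U : measurable U -> measurable_fun [set: T] (kchoice mg ^~ U).
Proof.
move=> mU; apply: emeasurable_sum => i.
apply: measurable_funeM.
apply: (measurableT_comp (f := fun t : T => \d_t U)) => //.
exact: measurable_fun_dirac.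
Qed.

HB.instance Definition _ := isKernel.Build _ _ _ _ _ (kchoice mg) measurable_kchoice.

Let kchoice_prob s : kchoice mg s [set: T] = 1%E.
Proof.
rewrite /kchoice /choice_measure /= /msum /=.
rewrite (eq_bigr (fun i : 'I__ => (choice_weight i)%:E)); last first.
  by move=> i _; rewrite /mscale /= diracT mule1.
rewrite sumEFin; congr EFin; rewrite /choice_weight; have [ps1d|ps1d] := boolP is_distr.
  have /andP[_ /eqP ps1] := ps1d.
  by rewrite big_ord_recr /= nth_default// addr0 -ps1 (big_nth 0) big_mkord.
by rewrite big_ord_recl /= big1 ?addr0.
Qed.

HB.instance Definition _ :=
  Kernel_isProbability.Build _ _ _ _ _ (kchoice mg) kchoice_prob.

End KernelChoice.

(** * Semantics *)

Section Semantics.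
Context {R : realType} (D : distributions R) {m l : nat}.
Implicit Types (theta : 'I_l -> R) (P : loop m l).

Definition state : Type := m.-tuple (measurableTypeR R).

Definition update (s : state) (x : 'I_m) (v : R) : state :=
  [tuple if y == x then v else tnth s y | y < m].

Definition poly_eval theta (q : polynomial m l) (s : state) : R :=
  \sum_(a <- q) const_eval theta a.1 * \prod_(y <- a.2) tnth s y.

Fixpoint cond_holds theta (b : cond m l) (s : state) : bool :=
  match b with
  | CTrue => true
  | CEq q r => poly_eval theta q s == poly_eval theta r s
  | CLe q r => poly_eval theta q s <= poly_eval theta r s
  | CLt q r => poly_eval theta q s < poly_eval theta r s
  | CNot b1 => ~~ cond_holds theta b1 s
  | CAnd b1 b2 => cond_holds theta b1 s && cond_holds theta b2 s
  | COr b1 b2 => cond_holds theta b1 s || cond_holds theta b2 s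
  end.

Lemma measurable_update x : measurable_fun [set: state * measurableTypeR R]
  (fun sv => update sv.1 x sv.2).
Proof.
apply/measurable_fun_tnthP => y.
rewrite (_ : _ \o _ = fun sv => if y == x then sv.2 else tnth sv.1 y); last first.
  by apply/funext => sv /=; rewrite tnth_mktuple.
case: (y == x); first exact: measurable_snd.
apply: (measurableT_comp (f := fun s : state => tnth s y)) => //.
exact: measurable_tnth.
Qed.

Lemma measurable_poly_eval theta q :
  measurable_fun [set: state] (poly_eval theta q : state -> measurableTypeR R).
Proof.
apply: measurable_sum => a; apply: measurable_funM; first exact: measurable_cst.
by apply: measurable_prod => y _; exact: measurable_tnth.
Qed.

Lemma measurable_cond_holds theta b : measurable_fun [set: state] (cond_holds theta b).
Proof.
elim: b => /= [|q r|q r|q r|b IH|b1 IH1 b2 IH2|b1 IH1 b2 IH2].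
- exact: measurable_cst.
- by apply: measurable_fun_eqr; exact: measurable_poly_eval.
- by apply: measurable_fun_ler; exact: measurable_poly_eval.
- by apply: measurable_fun_ltr; exact: measurable_poly_eval.
- exact: measurable_neg.
- exact: measurable_and.
- exact: measurable_or.
Qed.

Definition alternative theta x (alts : seq (polynomial m l * const 'I_l)) (i : nat)
    (s : state) : state :=
  update s x (poly_eval theta (nth [::] (map fst alts) i) s).

Lemma measurable_alternative theta x alts i :
  measurable_fun [set: state] (alternative theta x alts i).
Proof.
have mq := measurable_poly_eval theta (nth [::] (map fst alts) i).
have mp : measurable_fun [set: state]
    (fun s => (s, poly_eval theta (nth [::] (map fst alts) i) s) : state * measurableTypeR R).
  by apply: measurable_fun_pair => //; exact: measurable_id.
exact: (measurableT_comp (measurable_update x) mp).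
Qed.

Fixpoint exec theta (c : stmt m l) : R.-pker state ~> state :=
  match c with
  | SSkip => kdirac (@measurable_id _ state setT)
  | SAssign x (RDraw d args) =>
      kdraw (dist_law D d (map (const_eval theta) args)) (measurable_update x)
  | SAssign x (RChoice alts) =>
      kchoice [seq const_eval theta a.2 | a <- alts]
              (measurable_alternative theta x alts)
  | SSeq c1 c2 => kseq (exec theta c1) (exec theta c2)
  | SIf b c1 c2 => kif (exec theta c1) (exec theta c2) (measurable_cond_holds theta b)
  end.

(* Variables are 0 before the initialization part is run. *)
Definition initial_state : state := [tuple 0 | y < m].

Fixpoint run theta P (n : nat) : R.-pker state ~> state :=
  if n is n'.+1 then kseq (run theta P n') (exec theta (loop_body P))
  else exec theta (loop_init P).

(* The law of the state of the Markov chain after [n] loop iterations. *)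
Definition state_law theta P n : {measure set state -> \bar R} :=
  run theta P n initial_state.

Definition moment P (x : 'I_m) (k n : nat) theta : R :=
  \int[state_law theta P n]_s (tnth s x ^+ k).

(** ** Parameter values for which the loop is meaningful *)

Definition poly_defined theta (q : polynomial m l) : bool :=
  all (fun a => const_defined theta a.1) q.

Definition rhs_valid theta (e : rhs m l) : Prop :=
  match e with
  | RDraw d args => all (const_defined theta) args /\
      dist_dom D d (map (const_eval theta) args)
  | RChoice alts =>
      all (fun a => poly_defined theta a.1 && const_defined theta a.2) alts /\
      is_distr [seq const_eval theta a.2 | a <- alts]
  end.

Fixpoint cond_defined theta (b : cond m l) : bool :=
  match b with
  | CTrue => true
  | CEq q r | CLe q r | CLt q r => poly_defined theta q && poly_defined theta r
  | CNot b1 => cond_defined theta b1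
  | CAnd b1 b2 | COr b1 b2 => cond_defined theta b1 && cond_defined theta b2
  end.

Fixpoint stmt_valid theta (c : stmt m l) : Prop :=
  match c with
  | SSkip => True
  | SAssign _ e => rhs_valid theta e
  | SSeq c1 c2 => stmt_valid theta c1 /\ stmt_valid theta c2
  | SIf b c1 c2 => [/\ cond_defined theta b, stmt_valid theta c1 & stmt_valid theta c2]
  end.

Definition loop_valid theta P : Prop :=
  stmt_valid theta (loop_init P) /\ stmt_valid theta (loop_body P).

(** ** Admissibility

    [F] gives the finite sets of values of the variables of branching conditions
    (its entries for other variables are irrelevant).  These sets are data of the
    loop: their elements may involve parameters, and the number of elements does
    not depend on the parameter values. *)

Definition in_range (F : m.-tuple (seq (const 'I_l))) theta (y : 'I_m) (v : R) : bool :=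
  v \in [seq const_eval theta e | e <- tnth F y].

(* Almost surely, all conditions evaluated when running [c] from [s] are
   evaluated in states where their variables take values in [F]. *)
Fixpoint branches_in_range F theta (c : stmt m l) (s : state) : Prop :=
  match c with
  | SSkip | SAssign _ _ => True
  | SSeq c1 c2 => branches_in_range F theta c1 s /\
      {ae (exec theta c1 s : {measure set state -> \bar R}),
        forall s', branches_in_range F theta c2 s'}
  | SIf b c1 c2 => (forall y, y \in cond_vars b -> in_range F theta y (tnth s y)) /\
      (if cond_holds theta b s then branches_in_range F theta c1 s
       else branches_in_range F theta c2 s)
  end.

Definition finite_branching F P : Prop :=
  forall theta, loop_valid theta P ->
  [/\ forall y : 'I_m, all (const_defined theta) (tnth F y),
      branches_in_range F theta (loop_init P) initial_state
    & forall n, {ae state_law theta P n,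
        forall s, branches_in_range F theta (loop_body P) s}].

Definition admissible F P : Prop :=
  finite_branching F P /\ forall x : 'I_m, ~ depends_nonlinear_trans P x x.

(** ** Parameter values at which the sensitivity is considered *)

Definition set_param theta (p : 'I_l) (t : R) : 'I_l -> R :=
  fun q => if q == p then t else theta q.

(* A state in which each variable [y] takes the [idx y]-th value of its range. *)
Definition range_state (F : m.-tuple (seq (const 'I_l))) theta (idx : 'I_m -> nat) : state :=
  [tuple nth 0 [seq const_eval theta e | e <- tnth F y] (idx y) | y < m].

Definition same_branching F P theta theta' : Prop :=
  forall (i : nat) (idx : 'I_m -> nat), let b := nth CTrue (loop_conds P) i in
  (forall y, y \in cond_vars b -> (idx y < size (tnth F y))%N) ->
  cond_holds theta' b (range_state F theta' idx) =
  cond_holds theta b (range_state F theta idx).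

(* When [p] varies around its value in [theta], the loop remains meaningful and
   no branching condition changes its outcome.  The second requirement matters
   only if a condition involves parameters: for the loop which sets [x] to 1 if
   [p < 0] and to 0 otherwise, the expected value is not differentiable in [p] at
   [p = 0]. *)
Definition regular F P (p : 'I_l) theta : Prop :=
  \forall t \near theta p, loop_valid (set_param theta p t) P /\
    same_branching F P theta (set_param theta p t).

End Semantics.
Arguments state R m : clear implicits.

(** * Closed forms *)

(* Algebraic expressions in the parameters: [ARoot cs i] is the [i]-th root of
   the polynomial with coefficients [cs], constant coefficient first, and
   [AIf a b c d] is [c] if [a <= b], and [d] otherwise.  Case distinctions
   are needed for a closed form to cover all parameter values: the sequence
   [(p ^+ n - q ^+ n) / (p - q)] becomes [n%:R * p ^+ n.-1] at [p = q]. *)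
Inductive aexp (l : nat) :=
  | ANum of rat
  | APar of 'I_l
  | AAdd of aexp l & aexp l
  | AOpp of aexp l
  | AMul of aexp l & aexp l
  | AInv of aexp l
  | ARoot of seq (aexp l) & nat
  | AIf of aexp l & aexp l & aexp l & aexp l.
Arguments ANum {l}.

(* [cf_terms] lists the pairs of the coefficients of [P_j] and of [lambda_j];
   [cf_first] lists the values for the first few [n], as a delay caused by an
   eigenvalue 0 is not expressible by terms [P_j n * lambda_j ^ n]. *)
Record closed_form (l : nat) := ClosedForm {
  cf_first : seq (aexp l);
  cf_terms : seq (seq (aexp l) * aexp l)
}.

Section ClosedFormSem.
Context {R : realType} {l : nat} (theta : 'I_l -> R).

Definition lex_le (z w : R[i]) : bool :=
  (complex.Re z < complex.Re w) ||
  ((complex.Re z == complex.Re w) && (complex.Im z <= complex.Im w)).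

(* The roots with multiplicities, ordered by real part, then imaginary part. *)
Definition sorted_roots (q : {poly R[i]}) : seq R[i] :=
  sort lex_le (sval (closed_field_poly_normal q)).

Fixpoint aexp_eval (a : aexp l) : R[i] :=
  match a with
  | ANum q => ratr q
  | APar p => (theta p)%:C%C
  | AAdd a1 a2 => aexp_eval a1 + aexp_eval a2
  | AOpp a1 => - aexp_eval a1
  | AMul a1 a2 => aexp_eval a1 * aexp_eval a2
  | AInv a1 => (aexp_eval a1)^-1
  | ARoot cs i => nth 0 (sorted_roots (Poly (map aexp_eval cs))) i
  | AIf a1 a2 a3 a4 =>
      if aexp_eval a1 <= aexp_eval a2 then aexp_eval a3 else aexp_eval a4
  end.

Definition cf_eval (c : closed_form l) (n : nat) : R[i] :=
  if (n < size (cf_first c))%N then nth 0 (map aexp_eval (cf_first c)) n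
  else \sum_(t <- cf_terms c)
         (Poly (map aexp_eval t.1)).[n%:R] * aexp_eval t.2 ^+ n.

End ClosedFormSem.

(** * Input and output of the algorithm *)

Section Encoding.
Variables m l : nat.
Implicit Types (q : polynomial m l).

Definition enc_ord n (i : 'I_n) : tree := enc_nat i.

Definition enc_k (c : const 'I_l) : tree := enc_const (@nat_of_ord l) c.

Definition enc_poly q : tree :=
  enc_list [seq Node (enc_k a.1) (enc_list (map (@enc_ord m) a.2)) | a <- q].

Fixpoint enc_cond (b : cond m l) : tree :=
  match b with
  | CTrue => enc_tag 0 [::]
  | CEq q r => enc_tag 1 [:: enc_poly q; enc_poly r]
  | CLe q r => enc_tag 2 [:: enc_poly q; enc_poly r]
  | CLt q r => enc_tag 3 [:: enc_poly q; enc_poly r]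
  | CNot b1 => enc_tag 4 [:: enc_cond b1]
  | CAnd b1 b2 => enc_tag 5 [:: enc_cond b1; enc_cond b2]
  | COr b1 b2 => enc_tag 6 [:: enc_cond b1; enc_cond b2]
  end.

Definition enc_rhs (e : rhs m l) : tree :=
  match e with
  | RDraw d args => enc_tag 0 [:: enc_nat d; enc_list (map enc_k args)]
  | RChoice alts =>
      enc_tag 1 [:: enc_list [seq Node (enc_poly a.1) (enc_k a.2) | a <- alts]]
  end.

Fixpoint enc_stmt (c : stmt m l) : tree :=
  match c with
  | SSkip => enc_tag 0 [::]
  | SAssign x e => enc_tag 1 [:: enc_ord x; enc_rhs e]
  | SSeq c1 c2 => enc_tag 2 [:: enc_stmt c1; enc_stmt c2]
  | SIf b c1 c2 => enc_tag 3 [:: enc_cond b; enc_stmt c1; enc_stmt c2]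
  end.

Definition enc_input (P : loop m l) (F : m.-tuple (seq (const 'I_l)))
    (x : 'I_m) (p : 'I_l) (k : nat) : tree :=
  enc_list [:: enc_nat m; enc_nat l; enc_stmt (loop_init P); enc_stmt (loop_body P);
    enc_list [seq enc_list (map enc_k es) | es <- F];
    enc_ord x; enc_ord p; enc_nat k].

Fixpoint enc_aexp (a : aexp l) : tree :=
  match a with
  | ANum q => enc_tag 0 [:: enc_rat q]
  | APar p => enc_tag 1 [:: enc_ord p]
  | AAdd a1 a2 => enc_tag 2 [:: enc_aexp a1; enc_aexp a2]
  | AOpp a1 => enc_tag 3 [:: enc_aexp a1]
  | AMul a1 a2 => enc_tag 4 [:: enc_aexp a1; enc_aexp a2]
  | AInv a1 => enc_tag 5 [:: enc_aexp a1]
  | ARoot cs i => enc_tag 6 [:: enc_list (map enc_aexp cs); enc_nat i]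
  | AIf a1 a2 a3 a4 =>
      enc_tag 7 [:: enc_aexp a1; enc_aexp a2; enc_aexp a3; enc_aexp a4]
  end.

Definition enc_closed_form (c : closed_form l) : tree :=
  Node (enc_list (map enc_aexp (cf_first c)))
       (enc_list [seq Node (enc_list (map enc_aexp t.1)) (enc_aexp t.2)
                 | t <- cf_terms c]).

End Encoding.

(* Main.v *)
Require Import Defs.
From HB Require Import structures.
From mathcomp Require Import all_boot all_order all_algebra.
From mathcomp Require Import all_classical all_reals all_analysis.
From mathcomp Require Import measurable_realfun complex.
From mathcomp Require Import zify ring lra.

(** The moment after [n] iterations is the value at the initial state of a
    polynomial: push [x ^ k] backwards through the program, replacing a draw by
    its moments and a branching by a Lagrange polynomial in the branching
    variables, whose ranges are finite.  Computing with dual numbers gives the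
    derivative along with the value.

    Give each variable the weight [s ^ r], [r] being the number of variables which
    it can reach and which depend non-linearly on something.  As non-linear
    dependencies decrease [r], assignments do not increase weights.  On an event on
    which every low-weight polynomial with few values is almost surely constant,
    branchings are decided, so all the polynomials above agree with polynomials of
    bounded weight.  The state space splits into boundedly many such events, hence
    the moments satisfy a linear recurrence whose order is bounded in terms of the
    size of the input.  The recurrence depends on the parameters without any
    continuity, but by compactness the difference quotients lead to a recurrence of
    twice the order for the derivative.

    It remains to find the closed form from an initial segment of the sequence: a
    characteristic polynomial solves a Hankel system, and the coefficients of
    [n ^ d * lambda ^ n] solve another linear system. *)

Set Implicit Arguments.
Unset Strict Implicit.
Unset Printing Implicit Defensive.

Import Order.TTheory GRing.Theory Num.Theory.
Import numFieldNormedType.Exports.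

Local Open Scope classical_set_scope.
Local Open Scope ring_scope.

(** * Computable functions *)

(** The parameters are reals on which the program can test nothing. Case distinctions are therefore
    left inside the output as [AIf], and the order of the recurrence, which fixes the size of the
    linear systems, has to be bounded in terms of the input alone.

    Weakest preconditions do not stay in a finite-dimensional space: Lagrange polynomials raise the
    degree with each iteration, and branching variables have finitely many values only where a
    condition is evaluated. Almost sure equality on a cell brings the degree down, but gives no
    control on how the low-degree representative depends on parameters or drawn values. Draws are
    averaged all the same because a linear subspace that contains almost all vectors of powers
    contains their mean; parameters are treated one value at a time, and only normalized recurrences
    are passed to the limit.

    The algorithm is read in two ways: over formulas it is the program, over functions of [p] it has
    a meaning. Inverses follow the convention 1/0 = 0; in the second reading the test for zero is
    made at the base point, which keeps every function differentiable there. *)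

(* Families indexed by the numbers of variables and of parameters; one program
   has to work for the whole family. *)
Definition idx : Type := nat * nat.

Class Enc (T : Type) := enc : T -> tree.
#[global] Instance Enc_tree : Enc tree := id.
#[global] Instance Enc_nat : Enc nat := enc_nat.
#[global] Instance Enc_unit : Enc unit := fun=> Leaf.
#[global] Instance Enc_bool : Enc bool := fun b => if b then Node Leaf Leaf else Leaf.
#[global] Instance Enc_seq T {e : Enc T} : Enc (seq T) := fun s => enc_list (map enc s).
#[global] Instance Enc_pair S T {e : Enc S} {e' : Enc T} : Enc (S * T) :=
  fun p => Node (enc p.1) (enc p.2).
#[global] Instance Enc_ord n : Enc 'I_n := @enc_ord n.
#[global] Instance Enc_rat : Enc rat := enc_rat.
#[global] Instance Enc_kord l : Enc (const 'I_l) := @enc_k l.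
#[global] Instance Enc_knat : Enc (const nat) := enc_const id.

(* The code is position independent: it can be put at any place [n] of a program. *)
Definition cmp {X Y : idx -> Type} {eX : forall i, Enc (X i)} {eY : forall i, Enc (Y i)}
    (f : forall i, X i -> Y i) : Prop :=
  forall n, exists (ext : lprog) (e : lexpr), forall pre suf, size pre = n ->
    forall i x, leval (pre ++ ext ++ suf) (enc x) e (enc (f i x)).

Lemma nth_fun (pre suf : lprog) e ext n k : size pre = n -> k = n ->
  nth LNil (pre ++ (e :: ext) ++ suf) k = e.
Proof. by move=> <- ->; rewrite nth_cat ltnn subnn. Qed.

Lemma nth_fun2 (pre suf : lprog) e e2 ext n k : size pre = n -> k = n.+1 ->
  nth LNil (pre ++ (e :: e2 :: ext) ++ suf) k = e2.
Proof. by move=> <- ->; rewrite nth_cat ltnNge leqnSn/= subSnn. Qed.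

Lemma leval_callP (A : lprog) a f e b body t : leval A a e b ->
  nth LNil A f = body -> leval A b body t -> leval A a (LCall f e) t.
Proof. by move=> h <- h2; apply: leval_Call h h2. Qed.

Lemma enc_consE T (e : Enc T) (a : T) s : enc (a :: s) = Node (enc a) (enc s).
Proof. by []. Qed.

Section Rules.
Context {E A B C : idx -> Type} {eE : forall i, Enc (E i)} {eA : forall i, Enc (A i)}
  {eB : forall i, Enc (B i)} {eC : forall i, Enc (C i)}.

Lemma c_ext (f g : forall i, E i -> A i) : (forall i x, f i x = g i x) -> cmp f -> cmp g.
Proof.
by move=> fg cf n; have [ext [e h]] := cf n; exists ext, e => pre suf s i x; rewrite -fg; exact: h.
Qed.

Lemma c_id : cmp (fun i (x : E i) => x).
Proof. by move=> n; exists [::], LArg => pre suf s i x; constructor. Qed.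

Fixpoint quote (t : tree) : lexpr :=
  if t is Node a b then LCons (quote a) (quote b) else LNil.

Lemma quoteP (P : lprog) a t : leval P a (quote t) t.
Proof. by elim: t => [|t1 h1 t2 h2] /=; constructor. Qed.

Lemma c_quote (t : tree) (f : forall i, E i -> A i) :
  (forall i x, enc (f i x) = t) -> cmp f.
Proof. by move=> h n; exists [::], (quote t) => pre suf s i x; rewrite h; exact: quoteP. Qed.

Lemma c_map1 (w : lexpr -> lexpr) (f : forall i, E i -> A i) (g : forall i, A i -> B i) :
  (forall P a e i (x : A i), leval P a e (enc x) -> leval P a (w e) (enc (g i x))) ->
  cmp f -> cmp (fun i x => g i (f i x)).
Proof.
move=> hw cf n; have [ext [e h]] := cf n.
by exists ext, (w e) => pre suf s i x; apply: hw; exact: h.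
Qed.

(** The code of [g] is requested for the position just behind that of [f]; this chaining is the
    reason why [cmp] quantifies over the position [n]. *)
Lemma c_map2 (w : lexpr -> lexpr -> lexpr) (f : forall i, E i -> A i)
    (g : forall i, E i -> B i) (h : forall i, A i -> B i -> C i) :
  (forall P a e e' i (x : A i) (y : B i), leval P a e (enc x) -> leval P a e' (enc y) ->
    leval P a (w e e') (enc (h i x y))) ->
  cmp f -> cmp g -> cmp (fun i x => h i (f i x) (g i x)).
Proof.
move=> hw cf cg n; have [ext [e h1]] := cf n.
have [ext' [e' h2]] := cg (n + size ext)%N.
exists (ext ++ ext'), (w e e') => pre suf s i x; apply: hw.
  by rewrite -catA; exact: h1.
by rewrite !catA -(catA _ ext'); apply: h2; rewrite size_cat s.
Qed.

End Rules.

Section Rules1.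
Context {E A B C : idx -> Type} {eE : forall i, Enc (E i)} {eA : forall i, Enc (A i)}
  {eB : forall i, Enc (B i)} {eC : forall i, Enc (C i)}.

Lemma c_pair (f : forall i, E i -> A i) (g : forall i, E i -> B i) :
  cmp f -> cmp g -> cmp (fun i x => (f i x, g i x)).
Proof. by apply: (c_map2 (C := fun i => (A i * B i)%type) (w := LCons) (h := fun i a b => (a, b))) => *; constructor. Qed.

Lemma c_fst (f : forall i, E i -> (A i * B i)%type) : cmp f -> cmp (fun i x => (f i x).1).
Proof.
by apply: (c_map1 (A := fun i => (A i * B i)%type) (w := LHd) (g := fun i p => p.1)) => P a e i x h; apply: leval_Hd h.
Qed.

Lemma c_snd (f : forall i, E i -> (A i * B i)%type) : cmp f -> cmp (fun i x => (f i x).2).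
Proof.
by apply: (c_map1 (A := fun i => (A i * B i)%type) (w := LTl) (g := fun i p => p.2)) => P a e i x h; apply: leval_Tl h.
Qed.

Lemma c_cons (f : forall i, E i -> A i) (g : forall i, E i -> seq (A i)) :
  cmp f -> cmp g -> cmp (fun i x => f i x :: g i x).
Proof. by apply: (c_map2 (B := fun i => seq (A i)) (C := fun i => seq (A i)) (w := LCons) (h := fun i a b => a :: b)) => *; constructor. Qed.

Lemma c_behead (f : forall i, E i -> seq (A i)) : cmp f -> cmp (fun i x => behead (f i x)).
Proof.
apply: (c_map1 (A := fun i => seq (A i)) (w := LTl) (g := fun i s => behead s)) => P a e i [|x s] h; first exact: leval_TlLeaf.
exact: leval_Tl h.
Qed.

(** An expression sees only its own argument, so composition needs a call: slot [n] holds the body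
    of [h], whose [LArg] becomes the value of [f]. *)
Lemma c_app (h : forall i, A i -> B i) (f : forall i, E i -> A i) :
  cmp h -> cmp f -> cmp (fun i x => h i (f i x)).
Proof.
move=> ch cf n; have [ext [e h1]] := cf n.+1.
have [ext' [e' h2]] := ch (n.+1 + size ext)%N.
exists (e' :: ext ++ ext'), (LCall n e) => pre suf s i x.
set P := pre ++ _ ++ _.
have eP : P = rcons pre e' ++ ext ++ (ext' ++ suf) by rewrite /P -cats1 -!catA/= -!catA.
have eP2 : P = (rcons pre e' ++ ext) ++ ext' ++ suf by rewrite eP catA.
apply: (@leval_callP _ _ _ _ (enc (f i x)) e').
- by rewrite eP; apply: h1; rewrite size_rcons s.
- by rewrite /P; exact: nth_fun s _.
- by rewrite eP2; apply: h2; rewrite size_cat size_rcons s.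
Qed.

End Rules1.

Lemma c_nil {E A : idx -> Type} {eE : forall i, Enc (E i)} {eA : forall i, Enc (A i)} :
  @cmp E (fun i => seq (A i)) _ _ (fun i _ => [::]).
Proof. by apply: (c_quote (t := Leaf)). Qed.

Lemma c_nat {E : idx -> Type} {eE : forall i, Enc (E i)} n :
  @cmp E (fun=> nat) _ _ (fun i _ => n).
Proof. by apply: (c_quote (t := enc n)). Qed.

Lemma c_rat {E : idx -> Type} {eE : forall i, Enc (E i)} (q : rat) :
  @cmp E (fun=> rat) _ _ (fun i _ => q).
Proof. by apply: (c_quote (t := enc q)). Qed.

Ltac cvar := lazymatch goal with
  | |- cmp (fun i x => x) => exact: c_id
  | |- cmp (fun i x => (_, _)) => apply: c_pair; cvar
  | |- cmp (fun i x => fst _) => apply: c_fst; cvar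
  | |- cmp (fun i x => snd _) => apply: c_snd; cvar
  end.

Section Rules2.
Context {E A B : idx -> Type} {eE : forall i, Enc (E i)} {eA : forall i, Enc (A i)}
  {eB : forall i, Enc (B i)}.

(** The two results are computed as a pair and one is projected out. Evaluating both is harmless, as
    compiled functions are total. *)
Lemma c_if (b : forall i, E i -> bool) (f g : forall i, E i -> A i) :
  cmp b -> cmp f -> cmp g -> cmp (fun i x => if b i x then f i x else g i x).
Proof.
move=> cb cf cg.
have c2 := c_pair cf cg; move=> n.
have [ext [e h1]] := cb n; have [ext' [e' h2]] := c2 (n + size ext)%N.
exists (ext ++ ext'), (LCond e (LHd e') (LTl e')) => pre suf s i x.
set P := pre ++ _ ++ _.
have {}h1 : leval P (enc x) e (enc (b i x)) by rewrite /P -catA; exact: h1.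
have {}h2 : leval P (enc x) e' (enc (f i x, g i x)).
  have -> : P = (pre ++ ext) ++ ext' ++ suf by rewrite /P -!catA.
  by apply: h2; rewrite size_cat s.
case: (b i x) h1 => h1.
- by apply: leval_CondT h1 _; apply: leval_Hd h2.
- by apply: leval_CondF h1 _; apply: leval_Tl h2.
Qed.

Lemma c_isnil (f : forall i, E i -> seq (A i)) : cmp f -> cmp (fun i x => nilp (f i x)).
Proof.
apply: (c_map1 (A := fun i => seq (A i)) (w := fun e => LCond e LNil (LCons LNil LNil))
  (g := fun i s => nilp s)) => P a e i [|x s] h.
  by apply: leval_CondF h _; repeat constructor.
by apply: leval_CondT h _; repeat constructor.
Qed.

Lemma c_head (f : forall i, E i -> seq (A i)) (d : forall i, E i -> A i) :
  cmp d -> cmp f -> cmp (fun i x => head (d i x) (f i x)).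
Proof.
apply: (c_map2 (B := fun i => seq (A i)) (h := fun i d s => head d s) (w := fun d e => LCond e (LHd e) d)) => P a e e' i x [|y s] hd h.
  by apply: leval_CondF h _.
by apply: leval_CondT; [exact: h|apply: leval_Hd h].
Qed.

(** There are no closures, so the recursive function carries the environment and the start value
    along with the remaining list. Slot [n] holds the loop, slot [n.+1] the step. *)
Lemma c_foldr (step : forall i, E i -> A i -> B i -> B i) (z : forall i, E i -> B i)
    (l : forall i, E i -> seq (A i)) :
  cmp (X := fun i => (E i * (A i * B i))%type) (fun i x => step i x.1 x.2.1 x.2.2) ->
  cmp z -> cmp l -> cmp (fun i x => foldr (step i x) (z i x) (l i x)).
Proof.
move=> cs cz cl.
have c3 := c_pair (c_pair c_id cz) cl.
move=> n; have [ext [e h1]] := c3 n.+2.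
have [ext' [e' h2]] := cs (n.+2 + size ext)%N.
pose body := LCond (LTl LArg) (LCall n.+1 (LCons (LHd (LHd LArg))
  (LCons (LHd (LTl LArg)) (LCall n (LCons (LHd LArg) (LTl (LTl LArg)))))))
  (LTl (LHd LArg)).
exists (body :: e' :: ext ++ ext'), (LCall n e) => pre suf s i x.
have eP : pre ++ (body :: e' :: ext ++ ext') ++ suf =
  (pre ++ [:: body; e']) ++ ext ++ (ext' ++ suf) by rewrite -!catA/= -!catA.
have eP2 : pre ++ (body :: e' :: ext ++ ext') ++ suf =
  (pre ++ [:: body; e'] ++ ext) ++ ext' ++ suf by rewrite -!catA/= -!catA.
set P := pre ++ _ ++ _.
have nb : nth LNil P n = body by exact: nth_fun s _.
have ns : nth LNil P n.+1 = e' by exact: nth_fun2 s _.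
have {}h1 : leval P (enc x) e (enc ((x, z i x), l i x)).
  by rewrite /P eP; apply: h1; rewrite size_cat s addn2.
have {}h2 y : leval P (enc y) e' (enc (step i y.1 y.2.1 y.2.2)).
  by rewrite /P eP2; apply: (h2 _ _ _ i y); rewrite !size_cat s/= addnA addn2.
apply: (leval_callP h1 nb).
elim: (l i x) => [|a t IH].
  apply: leval_CondF; first by apply: leval_Tl; constructor.
  by apply: leval_Tl; apply: leval_Hd; constructor.
apply: leval_CondT; first by apply: leval_Tl; constructor.
apply: (leval_callP _ ns); last exact: (h2 (x, (a, foldr (step i x) (z i x) t))).
constructor; first by apply: leval_Hd; apply: leval_Hd; constructor.
constructor; first by apply: leval_Hd; apply: leval_Tl; constructor.
apply: (leval_callP _ nb IH); constructor; first by apply: leval_Hd; constructor.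
by apply: leval_Tl; apply: leval_Tl; constructor.
Qed.

End Rules2.

(** Numbers are encoded in unary, hence like lists of units; this reduces iteration to [c_foldr]. *)
Lemma enc_nseq n : enc (nseq n tt) = enc n.
Proof. by elim: n => //= n IH; rewrite enc_consE IH. Qed.

Section Rules3.
Context {E A B C : idx -> Type} {eE : forall i, Enc (E i)} {eA : forall i, Enc (A i)}
  {eB : forall i, Enc (B i)} {eC : forall i, Enc (C i)}.

Lemma c_nseqtt (f : forall i, E i -> nat) : cmp f -> cmp (fun i x => nseq (f i x) tt).
Proof. by apply: (c_map1 (w := id) (g := fun i n => nseq n tt)) => P a e i x; rewrite enc_nseq. Qed.

Lemma c_iter (f : forall i, E i -> B i -> B i) (z : forall i, E i -> B i)
    (n : forall i, E i -> nat) :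
  cmp (X := fun i => (E i * B i)%type) (fun i x => f i x.1 x.2) ->
  cmp z -> cmp n -> cmp (fun i x => iter (n i x) (f i x) (z i x)).
Proof.
move=> cf cz cn.
apply: (c_ext (f := fun i x => foldr (fun _ b => f i x b) (z i x) (nseq (n i x) tt))).
  by move=> i x; elim: (n i x) => //= k ->.
apply: c_foldr => //; last exact: c_nseqtt.
apply: (c_app cf (f := fun i (x : E i * (unit * B i)) => (x.1, x.2.2))).
by cvar.
Qed.

Lemma c_succ (f : forall i, E i -> nat) : cmp f -> cmp (fun i x => (f i x).+1).
Proof. by apply: (c_map1 (w := LCons LNil) (g := fun i => succn)) => P a e i x h; constructor => //; constructor. Qed.

Lemma c_pred (f : forall i, E i -> nat) : cmp f -> cmp (fun i x => (f i x).-1).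
Proof.
apply: (c_map1 (w := LTl) (g := fun i => predn)) => P a e i [|x] h; first exact: leval_TlLeaf.
exact: leval_Tl h.
Qed.

Lemma c_isz (f : forall i, E i -> nat) : cmp f -> cmp (fun i x => f i x == 0%N).
Proof.
apply: (c_map1 (w := fun e => LCond e LNil (LCons LNil LNil)) (g := fun i n => n == 0%N)) => P a e i [|x] h.
  by apply: leval_CondF h _; repeat constructor.
by apply: leval_CondT h _; repeat constructor.
Qed.

End Rules3.

Section Rules3'.
Context {E A B C : idx -> Type} {eE : forall i, Enc (E i)} {eA : forall i, Enc (A i)}
  {eB : forall i, Enc (B i)} {eC : forall i, Enc (C i)}.

Lemma c_map (f : forall i, E i -> A i -> B i) (l : forall i, E i -> seq (A i)) :
  cmp (X := fun i => (E i * A i)%type) (fun i x => f i x.1 x.2) -> cmp l ->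
  cmp (fun i x => map (f i x) (l i x)).
Proof.
move=> cf cl; apply: (c_ext (f := fun i x => foldr (fun a s => f i x a :: s) [::] (l i x))).
  by move=> i x; elim: (l i x) => //= a s ->.
apply: c_foldr => //; last exact: c_nil.
apply: c_cons; last by cvar.
apply: (c_app cf (f := fun i (x : E i * (A i * _)) => (x.1, x.2.1))).
by cvar.
Qed.

Lemma c_filter (f : forall i, E i -> A i -> bool) (l : forall i, E i -> seq (A i)) :
  cmp (X := fun i => (E i * A i)%type) (fun i x => f i x.1 x.2) -> cmp l ->
  cmp (fun i x => [seq y <- l i x | f i x y]).
Proof.
move=> cf cl.
apply: (c_ext (f := fun i x => foldr (fun a s => if f i x a then a :: s else s) [::] (l i x))).
  by move=> i x; elim: (l i x) => //= a s ->.
apply: c_foldr => //; last exact: c_nil.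
apply: c_if; last 2 first.
- by apply: c_cons; cvar.
- by cvar.
apply: (c_app cf (f := fun i (x : E i * (A i * _)) => (x.1, x.2.1))).
by cvar.
Qed.

End Rules3'.

Section Rules4.
Context {E A B C : idx -> Type} {eE : forall i, Enc (E i)} {eA : forall i, Enc (A i)}
  {eB : forall i, Enc (B i)} {eC : forall i, Enc (C i)}.

Lemma c_cat (f g : forall i, E i -> seq (A i)) : cmp f -> cmp g ->
  cmp (fun i x => f i x ++ g i x).
Proof.
move=> cf cg; apply: (c_ext (f := fun i x => foldr (fun a s => a :: s) (g i x) (f i x))).
  by move=> i x; elim: (f i x) => //= a s ->.
by apply: c_foldr => //; apply: c_cons; cvar.
Qed.

End Rules4.

Section Rules5.
Context {E A B C : idx -> Type} {eE : forall i, Enc (E i)} {eA : forall i, Enc (A i)}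
  {eB : forall i, Enc (B i)} {eC : forall i, Enc (C i)}.

Lemma c_flatten (f : forall i, E i -> seq (seq (A i))) : cmp f -> cmp (fun i x => flatten (f i x)).
Proof.
move=> cf; rewrite /flatten; apply: c_foldr => //; last exact: c_nil.
by apply: c_cat; cvar.
Qed.

Lemma c_size (f : forall i, E i -> seq (A i)) : cmp f -> cmp (fun i x => size (f i x)).
Proof.
move=> cf; apply: (c_ext (f := fun i x => foldr (fun a s => s.+1) 0%N (f i x))).
  by move=> i x; elim: (f i x) => //= a s ->.
apply: c_foldr => //; last exact: c_nat.
by apply: c_succ; cvar.
Qed.

Lemma c_add (f g : forall i, E i -> nat) : cmp f -> cmp g -> cmp (fun i x => (f i x + g i x)%N).
Proof.
move=> cf cg; apply: (c_ext (f := fun i x => iter (f i x) succn (g i x))).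
  by move=> i x; rewrite iter_succn addnC.
by apply: c_iter => //; apply: c_succ; cvar.
Qed.

Lemma c_sub (f g : forall i, E i -> nat) : cmp f -> cmp g -> cmp (fun i x => (f i x - g i x)%N).
Proof.
move=> cf cg; apply: (c_ext (f := fun i x => iter (g i x) predn (f i x))).
  by move=> i x; rewrite iter_predn.
by apply: c_iter => //; apply: c_pred; cvar.
Qed.

End Rules5.

Section Rules7.
Context {E A B C : idx -> Type} {eE : forall i, Enc (E i)} {eA : forall i, Enc (A i)}
  {eB : forall i, Enc (B i)} {eC : forall i, Enc (C i)}.

Lemma c_mul (f g : forall i, E i -> nat) : cmp f -> cmp g -> cmp (fun i x => (f i x * g i x)%N).
Proof.
move=> cf cg; apply: (c_ext (f := fun i x => iter (f i x) (addn (g i x)) 0%N)).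
  by move=> i x; rewrite iter_addn addn0 mulnC.
apply: c_iter => //; last exact: c_nat.
apply: c_add; last by cvar.
by apply: (c_app cg (f := fun i (x : E i * nat) => x.1)); cvar.
Qed.

End Rules7.

Section Rules8.
Context {E A B C : idx -> Type} {eE : forall i, Enc (E i)} {eA : forall i, Enc (A i)}
  {eB : forall i, Enc (B i)} {eC : forall i, Enc (C i)}.

Lemma c_exp (f g : forall i, E i -> nat) : cmp f -> cmp g -> cmp (fun i x => (f i x ^ g i x)%N).
Proof.
move=> cf cg; apply: (c_ext (f := fun i x => iter (g i x) (muln (f i x)) 1%N)).
  by move=> i x; rewrite iter_muln muln1.
apply: c_iter => //; last exact: c_nat.
apply: c_mul; last by cvar.
by apply: (c_app cf (f := fun i (x : E i * nat) => x.1)); cvar.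
Qed.

Lemma c_eqn (f g : forall i, E i -> nat) : cmp f -> cmp g -> cmp (fun i x => f i x == g i x).
Proof.
move=> cf cg; apply: (c_ext (f := fun i x => (f i x - g i x) + (g i x - f i x) == 0)%N).
  by move=> i x; rewrite addn_eq0 !subn_eq0 -eqn_leq.
by apply: c_isz; apply: c_add; exact: c_sub.
Qed.

Lemma c_nth (d : forall i, E i -> A i) (f : forall i, E i -> seq (A i)) (n : forall i, E i -> nat) :
  cmp d -> cmp f -> cmp n -> cmp (fun i x => nth (d i x) (f i x) (n i x)).
Proof.
move=> cd cf cn; apply: (c_ext (f := fun i x => head (d i x) (iter (n i x) behead (f i x)))).
  move=> i x; elim: (n i x) (f i x) => [|k IH] [|a s]//; last by rewrite iterSr/= IH.
  by rewrite iterSr/= IH nth_nil.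
by apply: c_head => //; apply: c_iter => //; apply: c_behead; cvar.
Qed.

End Rules8.

Section Rules6.
Context {E A B C : idx -> Type} {eE : forall i, Enc (E i)} {eA : forall i, Enc (A i)}
  {eB : forall i, Enc (B i)} {eC : forall i, Enc (C i)}.

Lemma c_iota (n : forall i, E i -> nat) : cmp n -> cmp (fun i x => iota 0 (n i x)).
Proof.
move=> cn; apply: (c_ext (f := fun i x => iter (n i x) (fun s => s ++ [:: size s]) [::])).
  by move=> i x; elim: (n i x) => // k IH; rewrite iterS IH size_iota -addn1 iotaD.
apply: c_iter => //; last exact: c_nil.
apply: c_cat; first by cvar.
by apply: c_cons; [apply: c_size; cvar|exact: c_nil].
Qed.

(** Ordinals share the encoding of their values; the algorithm compares variables in [nat], so that
    [c_eqn] applies to them. *)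
Lemma c_ordnat n0 (f : forall i : idx, E i -> 'I_(n0 i)) :
  cmp f -> cmp (fun i x => nat_of_ord (f i x)).
Proof. by apply: (c_map1 (w := id) (g := fun i => @nat_of_ord (n0 i))). Qed.

Lemma c_allpairs (f : forall i, E i -> A i -> B i -> C i)
    (s : forall i, E i -> seq (A i)) (t : forall i, E i -> seq (B i)) :
  cmp (X := fun i => (E i * A i * B i)%type) (fun i x => f i x.1.1 x.1.2 x.2) ->
  cmp s -> cmp t -> cmp (fun i x => [seq f i x a b | a <- s i x, b <- t i x]).
Proof.
move=> cf cs ct; apply: c_flatten; apply: c_map => //; apply: c_map.
  exact: cf.
by apply: (c_app ct (f := fun i (x : E i * A i) => x.1)); cvar.
Qed.

End Rules6.

(** Relocates a foreign program. A call beyond its [sz] functions evaluates [LNil] in isolation, but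
    could hit other code once embedded; [minn] redirects it to an extra [LNil] stored behind the
    program. *)
Fixpoint shift (n sz : nat) (e : lexpr) : lexpr :=
  match e with
  | LArg => LArg
  | LNil => LNil
  | LCons a b => LCons (shift n sz a) (shift n sz b)
  | LHd a => LHd (shift n sz a)
  | LTl a => LTl (shift n sz a)
  | LCond a b c => LCond (shift n sz a) (shift n sz b) (shift n sz c)
  | LCall f a => LCall (n + minn f sz) (shift n sz a)
  end.

Lemma leval_shift (A pre suf : lprog) a e t : leval A a e t ->
  leval (pre ++ (map (shift (size pre) (size A)) A ++ [:: LNil]) ++ suf) a
    (shift (size pre) (size A) e) t.
Proof.
elim; try by move=> *; econstructor; eauto.
move=> b f e' c t' _ IH1 h2 IH2 /=; apply: (leval_callP IH1 _ IH2).
rewrite nth_cat ltnNge leq_addr/= addKn nth_cat size_cat size_map/= addn1 ltnS geq_minr.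
rewrite nth_cat size_map; case: (leqP (size A) f) => fA; last first.
  by rewrite fA (nth_map LNil).
by rewrite ltnn subnn (nth_default _ fA).
Qed.

Lemma c_prog {E B : idx -> Type} {eE : forall i, Enc (E i)} {eB : forall i, Enc (B i)}
  (A : lprog) (f : forall i, E i -> B i) :
  (forall i x, computes A (enc x) (enc (f i x))) -> cmp f.
Proof.
move=> h n.
exists (map (shift n (size A)) A ++ [:: LNil]), (LCall (n + minn 0 (size A)) LArg) => pre suf <- i x.
exact: leval_shift (h i x).
Qed.

(* The main function has to be the first one of the program. *)
Lemma cmp_prog {E B : idx -> Type} {eE : forall i, Enc (E i)} {eB : forall i, Enc (B i)}
  (f : forall i, E i -> B i) : cmp f ->
  exists A, forall i x, computes A (enc x) (enc (f i x)).
Proof.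
move=> cf; have [ext [e h]] := cf 1%N; exists (e :: ext) => i x.
apply: leval_callP; [by constructor|by []|].
by have := h [:: e] [::] erefl i x; rewrite cats0.
Qed.

(** * Recursion over syntax *)

#[global] Instance Enc_cond m l : Enc (cond m l) := @enc_cond m l.
#[global] Instance Enc_rhs m l : Enc (rhs m l) := @enc_rhs m l.
#[global] Instance Enc_stmt m l : Enc (stmt m l) := @enc_stmt m l.
#[global] Instance Enc_poly m l : Enc (Defs.polynomial m l) := @enc_poly m l.
#[global] Instance Enc_aexp l : Enc (aexp l) := @enc_aexp l.
#[global] Instance Enc_cf l : Enc (closed_form l) := @enc_closed_form l.

Definition fun_at {X Y : idx -> Type} {eX : forall i, Enc (X i)} {eY : forall i, Enc (Y i)}
    (f : forall i, X i -> Y i) (P : lprog) (j : nat) : Prop :=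
  forall i x, leval P (enc x) (nth LNil P j) (enc (f i x)).

(** Recursive bodies call their helpers by function index, so helpers are provided as slots of the
    program and not as expressions, as in [cmp]. *)
Definition placeable (H : lprog -> nat -> Prop) : Prop := forall n, exists (blk : lprog) (j : nat),
  forall pre suf, size pre = n -> H (pre ++ blk ++ suf) j.

Lemma cmp_placeable {X Y : idx -> Type} {eX : forall i, Enc (X i)} {eY : forall i, Enc (Y i)}
  (f : forall i, X i -> Y i) : cmp f -> placeable (fun_at f).
Proof.
move=> cf n; have [ext [e h]] := cf n.+1.
exists (e :: ext), n => pre suf s i x.
rewrite (nth_fun _ _ _ s erefl).
have -> : pre ++ (e :: ext) ++ suf = (pre ++ [:: e]) ++ ext ++ suf by rewrite -catA.
by apply: h; rewrite size_cat s addn1.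
Qed.

Fixpoint all_at (Hs : seq (lprog -> nat -> Prop)) (js : seq nat) (P : lprog) : Prop :=
  if Hs is H :: Hs' then H P (head 0%N js) /\ all_at Hs' (behead js) P else True.

Fixpoint all_placeable (Hs : seq (lprog -> nat -> Prop)) : Prop :=
  if Hs is H :: Hs' then placeable H /\ all_placeable Hs' else True.

Lemma placeable_all Hs : all_placeable Hs -> forall n, exists blk js,
  forall pre suf, size pre = n -> all_at Hs js (pre ++ blk ++ suf).
Proof.
elim: Hs => [|H Hs IH] /=; first by move=> _ n; exists [::], [::].
move=> [pH /IH pHs] n; have [blk [j h]] := pH n.
have [blk' [js h']] := pHs (n + size blk)%N.
exists (blk ++ blk'), (j :: js) => pre suf s; split => /=.
  by rewrite -catA; exact: h.
have -> : pre ++ (blk ++ blk') ++ suf = (pre ++ blk) ++ blk' ++ suf by rewrite -!catA.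
by apply: h'; rewrite size_cat s.
Qed.

(* A recursive function: its body may use the functions [Hs] and itself. *)
Lemma cmp_rec {X Y : idx -> Type} {eX : forall i, Enc (X i)} {eY : forall i, Enc (Y i)}
    (f : forall i, X i -> Y i) (Hs : seq (lprog -> nat -> Prop))
    (body : seq nat -> nat -> lexpr) : all_placeable Hs ->
  (forall js n P, all_at Hs js P -> nth LNil P n = body js n ->
    forall i x, leval P (enc x) (body js n) (enc (f i x))) ->
  cmp f.
Proof.
move=> /placeable_all pH hb n; have [blk [js h]] := pH n.+1.
exists (body js n :: blk), (LCall n LArg) => pre suf s i x.
have nb := nth_fun suf (body js n) blk s erefl.
apply: leval_callP nb _; first by constructor.
apply: hb => //; last exact: (nth_fun _ _ _ s erefl).
have -> : pre ++ (body js n :: blk) ++ suf = (pre ++ [:: body js n]) ++ blk ++ suf.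
  by rewrite -catA.
by apply: h; rewrite size_cat s addn1.
Qed.

(** The argument is a pair of an environment and a syntax node, the latter being its tag followed by
    the list of its components. *)
Definition a_env := LHd LArg.
Definition a_tag := LHd (LTl LArg).
Definition a_arg k := LHd (iter k LTl (LTl (LTl LArg))).

Fixpoint tag_case (tag : lexpr) (bs : seq lexpr) : lexpr :=
  if bs is b :: bs' then LCond tag (tag_case (LTl tag) bs') b else LNil.

Lemma tag_caseP P a tag bs k t : leval P a tag (enc_nat k) -> (k < size bs)%N ->
  leval P a (nth LNil bs k) t -> leval P a (tag_case tag bs) t.
Proof.
elim: bs k tag => //= b bs IH [|k] tag h.
  by move=> _ hb; apply: leval_CondF h hb.
move=> kb hn; apply: leval_CondT (h) _.
by apply: (IH k) => //; apply: leval_Tl h.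
Qed.

Arguments tag_case : simpl never.

Definition hnd (js : seq nat) k := head 0%N (iter k behead js).

Ltac lev := lazymatch goal with
  | |- leval _ _ LArg _ => exact: leval_Arg
  | |- leval _ _ LNil _ => exact: leval_Nil
  | |- leval _ _ (LHd _) _ => apply: leval_Hd; lev
  | |- leval _ _ (LTl _) _ => apply: leval_Tl; lev
  | |- leval _ _ (LCons _ _) _ => apply: leval_Cons; lev
  | |- leval _ _ a_env _ => apply: leval_Hd; lev
  | |- leval _ _ a_tag _ => apply: leval_Hd; apply: leval_Tl; lev
  | |- leval _ _ (a_arg _) _ => rewrite /a_arg /=; lev
  end.

Section FoldConst.
Variables (K V : Type) (num : rat -> K) (sym : V -> K) (add : K -> K -> K)
  (opp : K -> K) (mul : K -> K -> K) (inv : K -> K).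

(** Functions on syntax are written as folds so that the recursion through each syntactic class is
    compiled only once. *)
Fixpoint const_fold (c : const V) : K :=
  match c with
  | KNum q => num q
  | KSym v => sym v
  | KAdd c1 c2 => add (const_fold c1) (const_fold c2)
  | KOpp c1 => opp (const_fold c1)
  | KMul c1 c2 => mul (const_fold c1) (const_fold c2)
  | KInv c1 => inv (const_fold c1)
  end.
End FoldConst.

Section FoldCond.
Variables (m l : nat) (K : Type) (ctrue : K) (ceq cle clt : Defs.polynomial m l -> Defs.polynomial m l -> K)
  (cnot : K -> K) (cand cor : K -> K -> K).

Fixpoint cond_fold (b : cond m l) : K :=
  match b with
  | CTrue => ctrue
  | CEq q r => ceq q r
  | CLe q r => cle q r
  | CLt q r => clt q r
  | CNot b1 => cnot (cond_fold b1)
  | CAnd b1 b2 => cand (cond_fold b1) (cond_fold b2)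
  | COr b1 b2 => cor (cond_fold b1) (cond_fold b2)
  end.
End FoldCond.

Section FoldStmt.
Variables (m l : nat) (Q : Type) (asg : 'I_m -> rhs m l -> Q -> Q)
  (ite : cond m l -> Q -> Q -> Q).

Fixpoint stmt_fold (c : stmt m l) (q : Q) : Q :=
  match c with
  | SSkip => q
  | SAssign x e => asg x e q
  | SSeq c1 c2 => stmt_fold c1 (stmt_fold c2 q)
  | SIf b c1 c2 => ite b (stmt_fold c1 q) (stmt_fold c2 q)
  end.
End FoldStmt.

Section ConstRule.
Context {E K V : idx -> Type} {eE : forall i, Enc (E i)} {eK : forall i, Enc (K i)}.
Variable (fV : forall i, V i -> nat).
Let eV i : Enc (V i) := fun v => enc_nat (fV v).
Let eC i : Enc (const (V i)) := enc_const (@fV i).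
#[local] Existing Instance eV.
#[local] Existing Instance eC.
Variables (num : forall i, E i -> rat -> K i) (sym : forall i, E i -> V i -> K i)
  (add : forall i, E i -> K i -> K i -> K i) (opp : forall i, E i -> K i -> K i)
  (mul : forall i, E i -> K i -> K i -> K i) (inv : forall i, E i -> K i -> K i).

Lemma c_const_fold_gen :
  cmp (fun i (x : E i * rat) => num x.1 x.2) ->
  cmp (fun i (x : E i * V i) => sym x.1 x.2) ->
  cmp (fun i (x : E i * (K i * K i)) => add x.1 x.2.1 x.2.2) ->
  cmp (fun i (x : E i * K i) => opp x.1 x.2) ->
  cmp (fun i (x : E i * (K i * K i)) => mul x.1 x.2.1 x.2.2) ->
  cmp (fun i (x : E i * K i) => inv x.1 x.2) ->
  cmp (fun i (x : E i * const (V i)) =>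
    const_fold (num x.1) (sym x.1) (add x.1) (opp x.1) (mul x.1) (inv x.1) x.2).
Proof.
move=> /cmp_placeable h0 /cmp_placeable h1 /cmp_placeable h2 /cmp_placeable h3
  /cmp_placeable h4 /cmp_placeable h5.
pose self n k := LCall n (LCons a_env (a_arg k)).
pose c1 j n := LCall j (LCons a_env (self n 0)).
pose c2 j n := LCall j (LCons a_env (LCons (self n 0) (self n 1))).
apply: (cmp_rec (Hs := [:: _; _; _; _; _; _]) (body := fun js n => tag_case a_tag
  [:: LCall (hnd js 0) (LCons a_env (a_arg 0)); LCall (hnd js 1) (LCons a_env (a_arg 0));
      c2 (hnd js 2) n; c1 (hnd js 3) n; c2 (hnd js 4) n; c1 (hnd js 5) n]%N)).
  by split; first exact: h0; split; first exact: h1; split; first exact: h2;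
     split; first exact: h3; split; first exact: h4; split; first exact: h5.
move=> js n P [H0 [H1 [H2 [H3 [H4 [H5 _]]]]]] nP i [e c].
have sf k c' a : leval P a a_env (enc e) -> leval P a (a_arg k) (enc c') ->
  leval P (enc (e, c')) (nth LNil P n) (enc (const_fold (num e) (sym e) (add e) (opp e) (mul e) (inv e) c')) ->
  leval P a (self n k) (enc (const_fold (num e) (sym e) (add e) (opp e) (mul e) (inv e) c')).
  by move=> he hk hc; apply: leval_callP _ erefl hc; apply: leval_Cons.
rewrite -nP.
elim: c => [q|v|a IHa b IHb|a IHa|a IHa b IHb|a IHa]; rewrite {1}nP.
- apply: (tag_caseP (k := 0)) => //=; first by lev.
  by apply: leval_callP _ erefl (H0 i (e, q)); lev.
- apply: (tag_caseP (k := 1)) => //=; first by lev.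
  by apply: leval_callP _ erefl (H1 i (e, v)); lev.
- apply: (tag_caseP (k := 2)) => //=; first by lev.
  apply: leval_callP _ erefl (H2 i (e, (_, _))); apply: leval_Cons; first by lev.
  by apply: leval_Cons; (apply: sf; [lev|lev|]).
- apply: (tag_caseP (k := 3)) => //=; first by lev.
  apply: leval_callP _ erefl (H3 i (e, _)); apply: leval_Cons; first by lev.
  by apply: sf; [lev|lev|].
- apply: (tag_caseP (k := 4)) => //=; first by lev.
  apply: leval_callP _ erefl (H4 i (e, (_, _))); apply: leval_Cons; first by lev.
  by apply: leval_Cons; (apply: sf; [lev|lev|]).
- apply: (tag_caseP (k := 5)) => //=; first by lev.
  apply: leval_callP _ erefl (H5 i (e, _)); apply: leval_Cons; first by lev.
  by apply: sf; [lev|lev|].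
Qed.

End ConstRule.

Notation ordm := (fun i : idx => 'I_i.1).
Notation ordl := (fun i : idx => 'I_i.2).
Notation Poly_ := (fun i : idx => Defs.polynomial i.1 i.2).
Notation Cond_ := (fun i : idx => cond i.1 i.2).
Notation Rhs_ := (fun i : idx => rhs i.1 i.2).
Notation Stmt_ := (fun i : idx => stmt i.1 i.2).

Section CondRule.
Context {E K : idx -> Type} {eE : forall i, Enc (E i)} {eK : forall i, Enc (K i)}.
Variables (ctrue : forall i, E i -> K i)
  (ceq cle clt : forall i, E i -> Defs.polynomial i.1 i.2 -> Defs.polynomial i.1 i.2 -> K i)
  (cnot : forall i, E i -> K i -> K i) (cand cor : forall i, E i -> K i -> K i -> K i).

Lemma c_cond_fold_gen :
  cmp (fun i (x : E i) => ctrue x) ->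
  cmp (fun i (x : E i * (Poly_ i * Poly_ i)) => ceq x.1 x.2.1 x.2.2) ->
  cmp (fun i (x : E i * (Poly_ i * Poly_ i)) => cle x.1 x.2.1 x.2.2) ->
  cmp (fun i (x : E i * (Poly_ i * Poly_ i)) => clt x.1 x.2.1 x.2.2) ->
  cmp (fun i (x : E i * K i) => cnot x.1 x.2) ->
  cmp (fun i (x : E i * (K i * K i)) => cand x.1 x.2.1 x.2.2) ->
  cmp (fun i (x : E i * (K i * K i)) => cor x.1 x.2.1 x.2.2) ->
  cmp (fun i (x : E i * cond i.1 i.2) =>
    cond_fold (ctrue x.1) (ceq x.1) (cle x.1) (clt x.1) (cnot x.1) (cand x.1) (cor x.1) x.2).
Proof.
move=> /cmp_placeable h0 /cmp_placeable h1 /cmp_placeable h2 /cmp_placeable h3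
  /cmp_placeable h4 /cmp_placeable h5 /cmp_placeable h6.
pose self n k := LCall n (LCons a_env (a_arg k)).
pose p2 j := LCall j (LCons a_env (LCons (a_arg 0) (a_arg 1))).
pose c1 j n := LCall j (LCons a_env (self n 0)).
pose c2 j n := LCall j (LCons a_env (LCons (self n 0) (self n 1))).
apply: (cmp_rec (Hs := [:: _; _; _; _; _; _; _]) (body := fun js n => tag_case a_tag
  [:: LCall (hnd js 0) a_env; p2 (hnd js 1); p2 (hnd js 2); p2 (hnd js 3);
      c1 (hnd js 4) n; c2 (hnd js 5) n; c2 (hnd js 6) n])).
  by split; first exact: h0; split; first exact: h1; split; first exact: h2;
     split; first exact: h3; split; first exact: h4; split; first exact: h5;
     split; first exact: h6.
move=> js n P [H0 [H1 [H2 [H3 [H4 [H5 [H6 _]]]]]]] nP i [e c].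
have sf k c' a : leval P a a_env (enc e) -> leval P a (a_arg k) (enc c') ->
  leval P (enc (e, c')) (nth LNil P n) (enc (cond_fold (ctrue e) (ceq e) (cle e) (clt e) (cnot e) (cand e) (cor e) c')) ->
  leval P a (self n k) (enc (cond_fold (ctrue e) (ceq e) (cle e) (clt e) (cnot e) (cand e) (cor e) c')).
  by move=> he hk hc; apply: leval_callP _ erefl hc; apply: leval_Cons.
rewrite -nP.
elim: c => [|q r|q r|q r|a IHa|a IHa b IHb|a IHa b IHb]; rewrite {1}nP.
- apply: (tag_caseP (k := 0)) => //=; first by lev.
  by apply: leval_callP _ erefl (H0 i e); lev.
- apply: (tag_caseP (k := 1)) => //=; first by lev.
  by apply: leval_callP _ erefl (H1 i (e, (q, r))); lev.
- apply: (tag_caseP (k := 2)) => //=; first by lev.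
  by apply: leval_callP _ erefl (H2 i (e, (q, r))); lev.
- apply: (tag_caseP (k := 3)) => //=; first by lev.
  by apply: leval_callP _ erefl (H3 i (e, (q, r))); lev.
- apply: (tag_caseP (k := 4)) => //=; first by lev.
  apply: leval_callP _ erefl (H4 i (e, _)); apply: leval_Cons; first by lev.
  by apply: sf; [lev|lev|].
- apply: (tag_caseP (k := 5)) => //=; first by lev.
  apply: leval_callP _ erefl (H5 i (e, (_, _))); apply: leval_Cons; first by lev.
  by apply: leval_Cons; (apply: sf; [lev|lev|]).
- apply: (tag_caseP (k := 6)) => //=; first by lev.
  apply: leval_callP _ erefl (H6 i (e, (_, _))); apply: leval_Cons; first by lev.
  by apply: leval_Cons; (apply: sf; [lev|lev|]).
Qed.

End CondRule.

Section StmtRule.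
Context {E K : idx -> Type} {eE : forall i, Enc (E i)} {eK : forall i, Enc (K i)}.
Variables (asg : forall i : idx, E i -> 'I_i.1 -> rhs i.1 i.2 -> K i -> K i)
  (ite : forall i : idx, E i -> cond i.1 i.2 -> K i -> K i -> K i).

Lemma c_stmt_fold_gen :
  cmp (fun i (x : E i * (ordm i * Rhs_ i * K i)) => asg x.1 x.2.1.1 x.2.1.2 x.2.2) ->
  cmp (fun i (x : E i * (Cond_ i * K i * K i)) => ite x.1 x.2.1.1 x.2.1.2 x.2.2) ->
  cmp (fun i (x : E i * K i * stmt i.1 i.2) =>
    stmt_fold (asg x.1.1) (ite x.1.1) x.2 x.1.2).
Proof.
move=> /cmp_placeable h0 /cmp_placeable h1.
pose rc n k q := LCall n (LCons (LCons (LHd a_env) q) (a_arg k)).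
apply: (cmp_rec (Hs := [:: _; _]) (body := fun js n => tag_case a_tag
  [:: LTl a_env;
   LCall (hnd js 0) (LCons (LHd a_env) (LCons (LCons (a_arg 0) (a_arg 1)) (LTl a_env)));
   rc n 0%N (rc n 1%N (LTl a_env));
   LCall (hnd js 1) (LCons (LHd a_env) (LCons (LCons (a_arg 0) (rc n 1%N (LTl a_env)))
     (rc n 2%N (LTl a_env))))])).
  by split; first exact: h0; split; first exact: h1.
move=> js n P [H0 [H1 _]] nP i [[e q] c].
have sf k q' c' a qe : leval P a (LHd a_env) (enc e) -> leval P a qe (enc q') ->
  leval P a (a_arg k) (enc c') ->
  leval P (enc (e, q', c')) (nth LNil P n) (enc (stmt_fold (asg e) (ite e) c' q')) ->
  leval P a (rc n k qe) (enc (stmt_fold (asg e) (ite e) c' q')).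
  by move=> he hq hk hc; apply: leval_callP _ erefl hc; do 2?apply: leval_Cons.
rewrite -nP.
elim: c q => [|x r|a IHa b IHb|b a1 IH1 a2 IH2] q; rewrite {1}nP.
- by apply: (tag_caseP (k := 0)) => //=; lev.
- apply: (tag_caseP (k := 1)) => //=; first by lev.
  by apply: leval_callP _ erefl (H0 i (e, (x, r, q))); lev.
- apply: (tag_caseP (k := 2)) => //=; first by lev.
  apply: (sf); [by lev| |by lev|exact: IHa].
  by apply: sf; [lev|lev|lev|exact: IHb].
- apply: (tag_caseP (k := 3)) => //=; first by lev.
  apply: leval_callP _ erefl (H1 i (e, (b, _, _))); apply: leval_Cons; first by lev.
  apply: leval_Cons; [apply: leval_Cons; first by lev|].
    by apply: sf; [lev|lev|lev|exact: IH1].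
  by apply: sf; [lev|lev|lev|exact: IH2].
Qed.

End StmtRule.

Definition rhs_case m l Q (dr : nat -> seq (const 'I_l) -> Q)
    (ch : seq (Defs.polynomial m l * const 'I_l) -> Q) (e : rhs m l) : Q :=
  match e with RDraw d args => dr d args | RChoice alts => ch alts end.

Section RhsRule.
Context {E K : idx -> Type} {eE : forall i, Enc (E i)} {eK : forall i, Enc (K i)}.
Variables (dr : forall i : idx, E i -> nat -> seq (const 'I_i.2) -> K i)
  (ch : forall i : idx, E i -> seq (Defs.polynomial i.1 i.2 * const 'I_i.2) -> K i).

Lemma c_rhs_case_gen :
  cmp (fun i (x : E i * (nat * seq (const 'I_i.2))) => dr x.1 x.2.1 x.2.2) ->
  cmp (fun i (x : E i * seq (Poly_ i * const 'I_i.2)) => ch x.1 x.2) ->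
  cmp (fun i (x : E i * rhs i.1 i.2) => rhs_case (dr x.1) (ch x.1) x.2).
Proof.
move=> /cmp_placeable h0 /cmp_placeable h1.
apply: (cmp_rec (Hs := [:: _; _]) (body := fun js n => tag_case a_tag
  [:: LCall (hnd js 0) (LCons a_env (LCons (a_arg 0) (a_arg 1)));
   LCall (hnd js 1) (LCons a_env (a_arg 0))])).
  by split; first exact: h0; split; first exact: h1.
move=> js n P [H0 [H1 _]] nP i [e [d args|alts]].
- apply: (tag_caseP (k := 0)) => //=; first by lev.
  by apply: leval_callP _ erefl (H0 i (e, (d, args))); lev.
- apply: (tag_caseP (k := 1)) => //=; first by lev.
  by apply: leval_callP _ erefl (H1 i (e, alts)); lev.
Qed.

End RhsRule.

Fixpoint tree_size (t : tree) : nat :=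
  if t is Node a b then (tree_size a + tree_size b).+1 else 0.

Lemma c_tree_size {E : idx -> Type} {eE : forall i, Enc (E i)} :
  cmp (fun i (x : E i) => tree_size (enc x)).
Proof.
have ca : placeable (fun_at (fun (i : idx) (x : nat * nat) => (x.1 + x.2).+1)).
  by apply: cmp_placeable; apply: c_succ; apply: c_add; cvar.
have ct : cmp (fun (i : idx) (t : tree) => tree_size t).
  apply: (cmp_rec (Hs := [:: _]) (body := fun js n => LCond LArg
    (LCall (hnd js 0) (LCons (LCall n (LHd LArg)) (LCall n (LTl LArg)))) LNil)).
    by split; first exact: ca.
  move=> js n P [H0 _] nP i t; rewrite -nP.
  elim: t => [|a IHa b IHb]; rewrite {1}nP.
    by apply: leval_CondF; lev.
  apply: leval_CondT; first by lev.
  apply: leval_callP _ erefl (H0 i (tree_size a, tree_size b)).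
  by apply: leval_Cons; [apply: leval_callP _ erefl IHa|apply: leval_callP _ erefl IHb]; lev.
(* Code does not see types: the program for trees applies to the encoding of any [E]. *)
move=> n; have [ext [e h]] := ct n; exists ext, e => pre suf s i x.
exact: (h pre suf s i (enc x)).
Qed.

Section AexpRules.
Context {E : idx -> Type} {eE : forall i, Enc (E i)}.
Notation Ax := (fun i : idx => aexp i.2).

Lemma c_tag1 tag {A : idx -> Type} {eA : forall i, Enc (A i)} (g : forall i, A i -> aexp i.2)
    (f : forall i, E i -> A i) :
  (forall i a, enc (g i a) = enc_tag tag [:: enc a]) -> cmp f -> cmp (Y := Ax) (fun i x => g i (f i x)).
Proof.
move=> hg; apply: (c_map1 (B := Ax) (w := fun e => LCons (quote (enc_nat tag)) (LCons e LNil))) => P a e i x h.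
by rewrite hg; apply: leval_Cons; [exact: quoteP|apply: leval_Cons; [exact: h|lev]].
Qed.

Lemma c_tag2 tag {A B : idx -> Type} {eA : forall i, Enc (A i)} {eB : forall i, Enc (B i)}
    (h : forall i, A i -> B i -> aexp i.2) (f : forall i, E i -> A i) (g : forall i, E i -> B i) :
  (forall i a b, enc (h i a b) = enc_tag tag [:: enc a; enc b]) -> cmp f -> cmp g ->
  cmp (Y := Ax) (fun i x => h i (f i x) (g i x)).
Proof.
move=> hg; apply: (c_map2 (C := Ax)
  (w := fun e e' => LCons (quote (enc_nat tag)) (LCons e (LCons e' LNil)))) => P a e e' i x y h1 h2.
rewrite hg; apply: leval_Cons; [exact: quoteP|apply: leval_Cons; [exact: h1|]].
by apply: leval_Cons; [exact: h2|lev].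
Qed.

Lemma c_ANum (f : forall i, E i -> rat) : cmp f -> cmp (Y := Ax) (fun i x => ANum (f i x)).
Proof. exact: (c_tag1 (tag := 0) (g := fun i => ANum)). Qed.

Lemma c_APar (f : forall i, E i -> 'I_i.2) : cmp (Y := ordl) f -> cmp (Y := Ax) (fun i x => APar (f i x)).
Proof. exact: (c_tag1 (tag := 1) (A := ordl) (g := fun i => @APar i.2)). Qed.

Lemma c_AOpp (f : forall i, E i -> aexp i.2) : cmp (Y := Ax) f -> cmp (Y := Ax) (fun i x => AOpp (f i x)).
Proof. exact: (c_tag1 (tag := 3) (A := Ax) (g := fun i => @AOpp i.2)). Qed.

Lemma c_AInv (f : forall i, E i -> aexp i.2) : cmp (Y := Ax) f -> cmp (Y := Ax) (fun i x => AInv (f i x)).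
Proof. exact: (c_tag1 (tag := 5) (A := Ax) (g := fun i => @AInv i.2)). Qed.

Lemma c_AAdd (f g : forall i, E i -> aexp i.2) : cmp (Y := Ax) f -> cmp (Y := Ax) g ->
  cmp (Y := Ax) (fun i x => AAdd (f i x) (g i x)).
Proof. exact: (c_tag2 (tag := 2) (A := Ax) (B := Ax) (h := fun i => @AAdd i.2)). Qed.

Lemma c_AMul (f g : forall i, E i -> aexp i.2) : cmp (Y := Ax) f -> cmp (Y := Ax) g ->
  cmp (Y := Ax) (fun i x => AMul (f i x) (g i x)).
Proof. exact: (c_tag2 (tag := 4) (A := Ax) (B := Ax) (h := fun i => @AMul i.2)). Qed.

Lemma c_ARoot (f : forall i, E i -> seq (aexp i.2)) (g : forall i, E i -> nat) :
  cmp (Y := fun i => seq (aexp i.2)) f -> cmp g ->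
  cmp (Y := Ax) (fun i x => ARoot (f i x) (g i x)).
Proof.
exact: (c_tag2 (tag := 6) (A := fun i => seq (aexp i.2)) (B := fun=> nat) (h := fun i => @ARoot i.2)).
Qed.

Lemma c_AIf (f1 f2 f3 f4 : forall i, E i -> aexp i.2) : cmp (Y := Ax) f1 ->
  cmp (Y := Ax) f2 -> cmp (Y := Ax) f3 -> cmp (Y := Ax) f4 ->
  cmp (Y := Ax) (fun i x => AIf (f1 i x) (f2 i x) (f3 i x) (f4 i x)).
Proof.
move=> h1 h2 h3 h4.
have := c_pair (A := fun i => (aexp i.2 * aexp i.2)%type) (B := fun i => (aexp i.2 * aexp i.2)%type)
  (c_pair h1 h2) (c_pair h3 h4).
apply: (c_map1 (B := Ax) (w := fun e => LCons (quote (enc_nat 7)) (LCons (LHd (LHd e))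
  (LCons (LTl (LHd e)) (LCons (LHd (LTl e)) (LCons (LTl (LTl e)) LNil)))))
  (g := fun i p => AIf p.1.1 p.1.2 p.2.1 p.2.2)) => P a e i x h.
apply: leval_Cons; first exact: quoteP.
apply: leval_Cons; first by do 2 apply: leval_Hd; exact: h.
apply: leval_Cons; first by apply: leval_Tl; apply: leval_Hd; exact: h.
apply: leval_Cons; first by apply: leval_Hd; apply: leval_Tl; exact: h.
apply: leval_Cons; last by lev.
by do 2 apply: leval_Tl; exact: h.
Qed.

Lemma c_ClosedForm (f : forall i, E i -> seq (aexp i.2))
    (g : forall i, E i -> seq (seq (aexp i.2) * aexp i.2)) :
  cmp (Y := fun i => seq (aexp i.2)) f ->
  cmp (Y := fun i => seq (seq (aexp i.2) * aexp i.2)) g ->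
  cmp (Y := fun i => closed_form i.2) (fun i x => ClosedForm (f i x) (g i x)).
Proof.
apply: (c_map2 (A := fun i => seq (aexp i.2)) (B := fun i => seq (seq (aexp i.2) * aexp i.2))
  (C := fun i => closed_form i.2) (w := LCons)
  (h := fun i a b => ClosedForm a b)) => P a e e' i x y h h'.
by apply: leval_Cons.
Qed.

End AexpRules.

(** * The algorithm *)

(** Abstract coefficients allow two instances: [dual_ops], on which the algorithm runs, and
    [fun_ops], in which its results are interpreted as functions of the parameter. *)
Record ops (K : Type) := Ops {
  onum : rat -> K; oadd : K -> K -> K; omul : K -> K -> K; oinv : K -> K }.

Section LoopAlg.
Variables (K : Type) (O : ops K).
Local Notation oopp := (omul O (onum O (-1))).

Definition const_val V (sym : V -> K) : const V -> K :=
  const_fold (onum O) sym (oadd O) oopp (omul O) (oinv O).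

Variables m l : nat.

Definition lpoly : Type := seq (K * seq 'I_m).
Implicit Types q r : lpoly.

Definition pscale (c : K) q : lpoly := [seq (omul O c a.1, a.2) | a <- q].
Definition pmul q r : lpoly := [seq (omul O a.1 b.1, a.2 ++ b.2) | a <- q, b <- r].
Definition pcst (c : K) : lpoly := [:: (c, [::])].
Definition pone : lpoly := pcst (onum O 1).
Definition pvar (y : 'I_m) : lpoly := [:: (onum O 1, [:: y])].
Definition pcompl q : lpoly := pone ++ pscale (onum O (-1)) q.
Definition pprod (qs : seq lpoly) : lpoly := foldr pmul pone qs.

Definition psubst (x : 'I_m) r q : lpoly :=
  flatten [seq pscale a.1 (pprod [seq (if y == x :> nat then r else pvar y) | y : 'I_m <- a.2]) | a <- q].

Definition pdraw (x : 'I_m) (mu : nat -> K) q : lpoly :=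
  [seq (omul O a.1 (mu (size [seq y : 'I_m <- a.2 | y == x :> nat])),
        [seq y : 'I_m <- a.2 | if y == x :> nat then false else true]) | a <- q].

Variables (sym : 'I_l -> K) (mom : nat -> nat -> const nat).

Definition kpoly (q : Defs.polynomial m l) : lpoly := [seq (const_val sym a.1, a.2) | a <- q].

Definition draw_moment (d : nat) (args : seq (const 'I_l)) (j : nat) : K :=
  const_val (fun i : nat => nth (onum O 0) [seq const_val sym c | c <- args] i) (mom d j).

(* [tr b tb] is the truth value of [b] in the state with the values [tb];
   [G] lists the possible values of all variables. *)
Variables (tr : cond m l -> seq K -> K) (G : seq (seq K)).

Definition grid : seq (seq K) :=
  foldr (fun vs acc => [seq c :: tb | c <- vs, tb <- acc]) [:: [::]] G.

(* The Lagrange factor [(y - c') / (c - c')], which is 1 if [c = c'] since then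
   the inverse is 0. *)
Definition lagrange (y : 'I_m) (c c' : K) : lpoly :=
  [:: (oinv O (oadd O c (oopp c')), [:: y]);
      (oadd O (onum O 1) (oopp (omul O c (oinv O (oadd O c (oopp c'))))), [::])].

Definition cell_indicator (vars : seq 'I_m) (t : K) (tb : seq K) : lpoly :=
  pmul (pcst t)
    (pprod [seq pprod [seq lagrange y (nth (onum O 0) tb y) c | c <- nth [::] G y] | y <- vars]).

(** A disjunction and not a sum of cells: listed values may coincide for some parameters, and tables
    may differ only outside [cond_vars b], so a state can lie in several cells. *)
Definition indicator (b : cond m l) : lpoly :=
  pcompl (pprod [seq pcompl (cell_indicator (cond_vars b) (tr b tb) tb) | tb <- grid]).

Definition wp_choice (x : 'I_m) (alts : seq (Defs.polynomial m l * const 'I_l)) q : lpoly :=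
  flatten [seq pscale (const_val sym a.2) (psubst x (kpoly a.1) q) | a <- alts].

Definition wp_assign (x : 'I_m) (e : rhs m l) q : lpoly :=
  rhs_case (fun d args => pdraw x (draw_moment d args) q)
           (fun alts => wp_choice x alts q) e.

Definition wp_if (b : cond m l) q r : lpoly :=
  pmul (indicator b) q ++ pmul (pcompl (indicator b)) r.

Definition wp : stmt m l -> lpoly -> lpoly := stmt_fold wp_assign wp_if.

(** All variables start at 0, so only monomials without variables contribute. *)
Definition ev0 q : K := foldr (oadd O) (onum O 0) [seq (if nilp a.2 then a.1 else onum O 0) | a <- q].

Definition wp_iter (body : stmt m l) (x : 'I_m) (k n : nat) : lpoly :=
  iter n (wp body) [:: (onum O 1, nseq k x)].

Definition wp_moment (init body : stmt m l) (x : 'I_m) (k n : nat) : K :=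
  ev0 (wp init (wp_iter body x k n)).

End LoopAlg.

(** The additional value 0 keeps every range, and thus the grid, nonempty, also for variables whose
    entry in [F] is empty. *)
Definition range_values K (O : ops K) l (sym : 'I_l -> K) (F : seq (seq (const 'I_l))) : seq (seq K) :=
  [seq onum O 0 :: [seq const_val O sym c | c <- es] | es <- F].

(* A value and its derivative. *)
Notation dual l := (aexp l * aexp l)%type.

Definition dual_ops l : ops (dual l) := {|
  onum q := (ANum q, ANum 0);
  oadd a b := (AAdd a.1 b.1, AAdd a.2 b.2);
  omul a b := (AMul a.1 b.1, AAdd (AMul a.2 b.1) (AMul a.1 b.2));
  oinv a := (AInv a.1, AOpp (AMul a.2 (AMul (AInv a.1) (AInv a.1)))) |}.

Definition dual_sym l (p q : 'I_l) : dual l := (APar q, if q == p :> nat then ANum 1 else ANum 0).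

Section Truth.
Variables m l : nat.
Variables (sym : 'I_l -> dual l) (tb : seq (dual l)).

Definition apoly (q : Defs.polynomial m l) : aexp l :=
  foldr (@AAdd l) (ANum 0)
    [seq AMul (const_val (dual_ops l) sym a.1).1
      (foldr (@AMul l) (ANum 1) [seq (nth (onum (dual_ops l) 0) tb y).1 | y : 'I_m <- a.2]) | a <- q].

Definition atruth : cond m l -> aexp l :=
  cond_fold (ANum 1)
    (fun q r => AIf (apoly q) (apoly r) (AIf (apoly r) (apoly q) (ANum 1) (ANum 0)) (ANum 0))
    (fun q r => AIf (apoly q) (apoly r) (ANum 1) (ANum 0))
    (fun q r => AIf (apoly r) (apoly q) (ANum 0) (ANum 1))
    (fun a => AAdd (ANum 1) (AOpp a)) (@AMul l)
    (fun a b => AAdd a (AMul (AAdd (ANum 1) (AOpp a)) b)).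

End Truth.

(** Derivative 0, since near a regular parameter value no condition changes its outcome on the
    listed values. *)
Definition dual_truth m l (sym : 'I_l -> dual l) (b : cond m l) (tb : seq (dual l)) : dual l :=
  (atruth sym tb b, ANum 0).

Definition sensitivity_term (mom : nat -> nat -> const nat) m l (F : seq (seq (const 'I_l)))
    (init body : stmt m l) (x : 'I_m) (p : 'I_l) (k n : nat) : aexp l :=
  (wp_moment (dual_ops l) (dual_sym p) mom (dual_truth (dual_sym p))
    (range_values (dual_ops l) (dual_sym p) F) init body x k n).2.

(* A row of a linear system lists the right-hand side and then the coefficients
   of the unknowns. *)
Section Solve.
Variable l : nat.
Implicit Types (r p : seq (aexp l)) (rows : seq (seq (aexp l))).
Local Notation "r `[ j ]" := (nth (ANum 0) r j) (at level 2, format "r `[ j ]").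

(** In the partial order of the complex numbers, [a <= 0] and [0 <= a] together mean that [a] is
    0. *)
Definition a_ifz (a b c : aexp l) : aexp l := AIf a (ANum 0) (AIf (ANum 0) a b c) c.

(** Which row can serve as pivot depends on the parameters, so the program cannot select one. The
    pivot row is a list of formulas that make the selection entry by entry. *)
Definition choose_row r p : seq (aexp l) :=
  [seq a_ifz (r`[1]) (p`[j]) (r`[j]) | j <- iota 0 (size r)].

Definition pivot rows : seq (aexp l) := foldr choose_row [::] rows.

(* Also right if all coefficients of the unknown vanish, as 1 / 0 = 0. *)
Definition eliminate p r : seq (aexp l) :=
  [seq (if j == 0 then AAdd (r`[0]) (AOpp (AMul (AMul (r`[1]) (AInv (p`[1]))) (p`[0])))
        else AAdd (r`[j.+1]) (AOpp (AMul (AMul (r`[1]) (AInv (p`[1]))) (p`[j.+1]))))%N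
  | j <- iota 0 (size r).-1].

(** It is not known which row serves as pivot; it therefore stays in the system, where elimination
    reduces it to zeros. *)
Definition eliminate_all rows : seq (seq (aexp l)) := [seq eliminate (pivot rows) r | r <- rows].

Definition a_sum (s : seq (aexp l)) : aexp l := foldr (@AAdd l) (ANum 0) s.

Definition back_subst p (xs : seq (aexp l)) : seq (aexp l) :=
  AMul (AInv (p`[1]))
    (AAdd (p`[0]) (AOpp (a_sum [seq AMul (p`[j.+2]) (xs`[j]) | j <- iota 0 (size xs)]))) :: xs.

Definition solve (n : nat) rows : seq (aexp l) :=
  foldr (fun k xs => back_subst (pivot (iter k eliminate_all rows)) xs) [::] (iota 0 n).

Definition hankel_rows (v : seq (aexp l)) (N : nat) : seq (seq (aexp l)) :=
  [seq v`[i + N] :: [seq v`[i + j] | j <- iota 0 N] | i <- iota 0 N].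

Definition char_poly_coefs (v : seq (aexp l)) (N : nat) : seq (aexp l) :=
  [seq AOpp a | a <- solve N (hankel_rows v N)] ++ [:: ANum 1].

Definition a_nat (n : nat) : aexp l := iter n (AAdd (ANum 1)) (ANum 0).
Definition a_pow (a : aexp l) (n : nat) : aexp l := iter n (AMul a) (ANum 1).

(** Unknown [i * N + d] is the coefficient of n^d lambda_i^n. A multiple root occurs several times
    with the same columns, so the solution is not unique, but any solution will do. The equations
    start at index [N], where contributions of the root 0 have died out. *)
Definition closed_rows (v : seq (aexp l)) (N : nat) (chi : seq (aexp l)) : seq (seq (aexp l)) :=
  [seq v`[N + n] :: [seq AMul (a_pow (a_nat (N + n)) d) (a_pow (ARoot chi i) (N + n))
                    | i <- iota 0 N, d <- iota 0 N] | n <- iota 0 (N * N)].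

Definition closed_form_of (v : seq (aexp l)) (N : nat) : closed_form l :=
  let chi := char_poly_coefs v N in
  let c := solve (N * N) (closed_rows v N chi) in
  ClosedForm [seq v`[n] | n <- iota 0 N]
    [seq ([seq c`[i * N + d] | d <- iota 0 N], ARoot chi i) | i <- iota 0 N].

End Solve.

(* [s] bounds the numbers of variables and of values, the degrees and [k]. *)
Definition weight_bound (s : nat) : nat := (s * s ^ s)%N.
(** Counts exponent vectors: as variables have positive weights, no exponent exceeds the weight of
    its monomial. *)
Definition dim_bound (s : nat) : nat := ((weight_bound s).+1 ^ s)%N.
(** Each splitting lowers a dimension, so there are at most [dim_bound s] rounds, each into at most
    [s] cells, and every final cell contributes [dim_bound s] functions. *)
Definition order_bound (s : nat) : nat := (s ^ dim_bound s * dim_bound s)%N.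

(** Passing to the derivative doubles the order. The Hankel system involves terms below [N + N], the
    system for the coefficients terms below [N + N * N]. *)
Definition main_alg (mom : nat -> nat -> const nat) m l (s : nat) (F : seq (seq (const 'I_l)))
    (init body : stmt m l) (x : 'I_m) (p : 'I_l) (k : nat) : closed_form l :=
  let N := (order_bound s + order_bound s)%N in
  closed_form_of [seq sensitivity_term mom F init body x p k n | n <- iota 0 (N + N * N + N)] N.


(** * The algorithm is computable *)

Notation Ax_ := (fun i : idx => aexp i.2).
Notation Dual_ := (fun i : idx => dual i.2).
Notation Const_ := (fun i : idx => const 'I_i.2).
Notation LPoly_ := (fun i : idx => lpoly (dual i.2) i.1).
Notation DMon_ := (fun i : idx => (dual i.2 * seq 'I_i.1)%type).
Notation KMon_ := (fun i : idx => (const 'I_i.2 * seq 'I_i.1)%type).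
Notation Tab_ := (fun i : idx => seq (dual i.2)).
Notation Grid_ := (fun i : idx => seq (seq (dual i.2))).
Notation Ranges_ := (fun i : idx => seq (seq (const 'I_i.2))).
Notation Row_ := (fun i : idx => seq (aexp i.2)).
Notation Mat_ := (fun i : idx => seq (seq (aexp i.2))).

#[global] Instance Enc_lpoly m l : Enc (lpoly (dual l) m) :=
  @Enc_seq (dual l * seq 'I_m) _.

Lemma c_bool {E : idx -> Type} {eE : forall i, Enc (E i)} b :
  @cmp E (fun=> bool) _ _ (fun i _ => b).
Proof. by apply: (c_quote (t := enc b)). Qed.

Ltac cstep := lazymatch goal with
  | |- cmp (fun i x => x) => exact: c_id
  | |- cmp (fun i x => (_, _)) => eapply c_pair
  | |- cmp (fun i x => fst _) => eapply c_fst
  | |- cmp (fun i x => snd _) => eapply c_snd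
  | |- cmp (fun i x => [::]) => exact: c_nil
  | |- cmp (fun i x => _ :: _) => eapply c_cons
  | |- cmp (fun i x => _ ++ _) => eapply c_cat
  | |- cmp (fun i x => flatten (allpairs_dep _ _ _)) => eapply c_flatten
  | |- cmp (fun i x => allpairs_dep _ _ _) => eapply c_allpairs
  | |- cmp (fun i x => seq.flatten _) => eapply c_flatten
  | |- cmp (fun i x => seq.map _ _) => eapply c_map
  | |- cmp (fun i x => seq.filter _ _) => eapply c_filter
  | |- cmp (fun i x => seq.foldr _ _ _) => eapply c_foldr
  | |- cmp (fun i x => iter _ _ _) => eapply c_iter
  | |- cmp (fun i x => iota 0 _) => eapply c_iota
  | |- cmp (fun i x => nth _ _ _) => eapply c_nth
  | |- cmp (fun i x => size _) => eapply c_size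
  | |- cmp (fun i x => nilp _) => eapply c_isnil
  | |- cmp (fun i x => if _ then _ else _) => eapply c_if
  | |- cmp (fun i x => nat_of_ord _ == _) => eapply c_eqn
  | |- cmp (fun i x => nat_of_ord _) => eapply c_ordnat
  | |- cmp (fun i x => (_ + _)%N) => eapply c_add
  | |- cmp (fun i x => (_ * _)%N) => eapply c_mul
  | |- cmp (fun i x => (_ ^ _)%N) => eapply c_exp
  | |- cmp (fun i x => _.+1) => eapply c_succ
  | |- cmp (fun i x => _.-1) => eapply c_pred
  | |- cmp (fun i x => ANum _) => eapply c_ANum
  | |- cmp (fun i x => APar _) => eapply c_APar
  | |- cmp (fun i x => AAdd _ _) => eapply c_AAdd
  | |- cmp (fun i x => AMul _ _) => eapply c_AMul
  | |- cmp (fun i x => AOpp _) => eapply c_AOpp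
  | |- cmp (fun i x => AInv _) => eapply c_AInv
  | |- cmp (fun i x => ARoot _ _) => eapply c_ARoot
  | |- cmp (fun i x => AIf _ _ _ _) => eapply c_AIf
  | |- @cmp _ (fun=> nat) _ _ (fun i x => ?n) => exact: c_nat
  | |- @cmp _ (fun=> rat) _ _ (fun i x => ?n) => exact: c_rat
  | |- cmp (fun i x => true) => exact: c_bool
  | |- cmp (fun i x => false) => exact: c_bool
  end.

Ltac chyp := match goal with
  | H : cmp _ |- _ => exact: H
  | H : cmp ?F |- cmp (fun i x => ?F i _) => apply: (c_app H)
  end.
(** Redefined after each group of rules. Sections are closed between the groups because under a
    binder the rules are applied to an enlarged environment. *)
Ltac cfun := fail.
Ltac cauto := repeat first [chyp | cfun | cstep].

Section DualRules.
Context {E : idx -> Type} {eE : forall i, Enc (E i)}.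
Notation cD := (cmp (X := E) (Y := Dual_)).
Notation cP := (cmp (X := E) (Y := LPoly_)).

Lemma c_onum (f : forall i, E i -> rat) : cmp f -> cD (fun i x => onum (dual_ops i.2) (f i x)).
Proof. by move=> cf; rewrite /=; cauto. Qed.

Lemma c_oadd f g : cD f -> cD g -> cD (fun i x => oadd (dual_ops i.2) (f i x) (g i x)).
Proof. by move=> cf cg; rewrite /=; cauto. Qed.

Lemma c_omul f g : cD f -> cD g -> cD (fun i x => omul (dual_ops i.2) (f i x) (g i x)).
Proof. by move=> cf cg; rewrite /=; cauto. Qed.

Lemma c_oinv f : cD f -> cD (fun i x => oinv (dual_ops i.2) (f i x)).
Proof. by move=> cf; rewrite /=; cauto. Qed.
End DualRules.

Ltac cfun1 := lazymatch goal with
  | |- cmp (fun i x => onum _ _) => apply: c_onum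
  | |- cmp (fun i x => oadd _ _ _) => apply: c_oadd
  | |- cmp (fun i x => omul _ _ _) => apply: c_omul
  | |- cmp (fun i x => oinv _ _) => apply: c_oinv
  end.
Ltac cfun ::= cfun1.

Section PolyRules.
Context {E : idx -> Type} {eE : forall i, Enc (E i)}.
Notation cD := (cmp (X := E) (Y := Dual_)).
Notation cP := (cmp (X := E) (Y := LPoly_)).
Notation co := (dual_ops _).

Lemma c_pscale f g : cD f -> cP g -> cP (fun i x => pscale co (f i x) (g i x)).
Proof. by move=> cf cg; rewrite /pscale; cauto. Qed.

Lemma c_pmul f g : cP f -> cP g -> cP (fun i x => pmul co (f i x) (g i x)).
Proof. by move=> cf cg; rewrite /pmul; cauto. Qed.

Lemma c_pcst f : cD f -> cP (fun i x => pcst i.1 (f i x)).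
Proof. by move=> cf; rewrite /pcst; cauto. Qed.

Lemma c_pvar f : cmp (X := E) (Y := ordm) f -> cP (fun i x => pvar co (f i x)).
Proof. by move=> cf; rewrite /pvar; cauto. Qed.
End PolyRules.

Lemma c_pone {E : idx -> Type} {eE : forall i, Enc (E i)} :
  cmp (X := E) (Y := LPoly_) (fun i x => pone (dual_ops i.2) i.1).
Proof. by rewrite /pone; apply: c_pcst; cauto. Qed.

Ltac cfun2 := lazymatch goal with
  | |- cmp (fun i x => pscale _ _ _) => apply: c_pscale
  | |- cmp (fun i x => pmul _ _ _) => apply: c_pmul
  | |- cmp (fun i x => pcst _ _) => apply: c_pcst
  | |- cmp (fun i x => pvar _ _) => apply: c_pvar
  | |- cmp (fun i x => pone _ _) => exact: c_pone
  end.
Ltac cfun ::= first [cfun1 | cfun2].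

Section PolyRules2.
Context {E : idx -> Type} {eE : forall i, Enc (E i)}.
Notation cD := (cmp (X := E) (Y := Dual_)).
Notation cP := (cmp (X := E) (Y := LPoly_)).
Notation co := (dual_ops _).

Lemma c_pcompl f : cP f -> cP (fun i x => pcompl co (f i x)).
Proof. by move=> cf; rewrite /pcompl; apply: (c_cat (A := DMon_)); cauto. Qed.

Lemma c_pprod f : cmp (X := E) (Y := fun i => seq (LPoly_ i)) f -> cP (fun i x => pprod co (f i x)).
Proof. by move=> cf; rewrite /pprod; apply: (c_foldr (A := LPoly_) (B := LPoly_)); cauto. Qed.

Lemma c_lagrange f g h : cmp (X := E) (Y := ordm) f -> cD g -> cD h ->
  cP (fun i x => lagrange co (f i x) (g i x) (h i x)).
Proof. by move=> cf cg ch; rewrite /lagrange; cauto. Qed.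

Lemma c_const_val {V : idx -> Type} (fV : forall i, V i -> nat)
    (eV := fun i (v : V i) => enc_nat (fV i v)) (eC := fun i => enc_const (fV i))
    (sym : forall i, E i -> V i -> dual i.2) c :
  cmp (X := fun i => (E i * V i)%type) (Y := Dual_) (eX := fun i => @Enc_pair _ _ _ (eV i))
    (fun i x => sym i x.1 x.2) ->
  cmp (Y := fun i => const (V i)) (eY := eC) c ->
  cD (fun i x => const_val co (sym i x) (c i x)).
Proof.
move=> cs cc; rewrite /const_val.
have h : cmp (X := fun i => (E i * const (V i))%type) (eX := fun i => @Enc_pair _ _ _ (eC i))
    (Y := Dual_) (fun i x => const_val co (sym i x.1) x.2).
  by apply: (@c_const_fold_gen E Dual_ V _ _ fV (fun i _ => onum (dual_ops i.2)) sym
    (fun i _ => oadd (dual_ops i.2)) (fun i _ => omul (dual_ops i.2) (onum (dual_ops i.2) (-1)))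
    (fun i _ => omul (dual_ops i.2)) (fun i _ => oinv (dual_ops i.2))); try exact: cs; cauto.
exact: (c_app h (f := fun i x => (x, c i x)) (c_pair (@c_id _ _) cc)).
Qed.
End PolyRules2.

Section KvalRules.
Context {E : idx -> Type} {eE : forall i, Enc (E i)}.
Notation cD := (cmp (X := E) (Y := Dual_)).

Lemma c_dual_sym p q : cmp (X := E) (Y := ordl) p -> cmp (X := E) (Y := ordl) q ->
  cD (fun i x => dual_sym (p i x) (q i x)).
Proof. by move=> cp cq; rewrite /dual_sym; cauto. Qed.
End KvalRules.

Section KvalRules2.
Context {E : idx -> Type} {eE : forall i, Enc (E i)}.
Notation cD := (cmp (X := E) (Y := Dual_)).

Lemma c_kval p c :
  cmp (X := E) (Y := ordl) p -> cmp (X := E) (Y := Const_) c ->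
  cD (fun i x => const_val (dual_ops i.2) (dual_sym (p i x)) (c i x)).
Proof.
move=> cp cc; apply: (c_const_val (V := ordl) (fV := fun i => @nat_of_ord i.2)
  (sym := fun i x => dual_sym (p i x))) => //.
by apply: c_dual_sym; cauto.
Qed.
End KvalRules2.

Ltac cfun3 := lazymatch goal with
  | |- cmp (fun i x => pcompl _ _) => apply: c_pcompl
  | |- cmp (fun i x => pprod _ _) => apply: c_pprod
  | |- cmp (fun i x => lagrange _ _ _ _) => apply: c_lagrange
  | |- cmp (fun i x => const_val _ (dual_sym _) _) => apply: c_kval
  end.
Ltac cfun ::= first [cfun1 | cfun2 | cfun3].

Section WpRules.
Context {E : idx -> Type} {eE : forall i, Enc (E i)}.
Notation cD := (cmp (X := E) (Y := Dual_)).
Notation cP := (cmp (X := E) (Y := LPoly_)).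
Notation co := (dual_ops _).

Lemma c_psubst y f g : cmp (X := E) (Y := ordm) y -> cP f -> cP g ->
  cP (fun i x => psubst co (y i x) (f i x) (g i x)).
Proof.
move=> cy cf cg; rewrite /psubst.
apply: (c_flatten (A := DMon_)).
apply: (c_map (A := DMon_) (B := LPoly_)) => //.
by cauto.
Qed.

Lemma c_pdraw y (mu : forall i, E i -> nat -> dual i.2) g :
  cmp (X := E) (Y := ordm) y -> cmp (X := fun i => (E i * nat)%type) (Y := Dual_) (fun i x => mu i x.1 x.2) ->
  cP g -> cP (fun i x => pdraw co (y i x) (mu i x) (g i x)).
Proof.
move=> cy cmu cg; rewrite /pdraw.
apply: (c_map (A := DMon_) (B := DMon_)) => //.
have cmu' a b : cmp a -> cmp b ->
  cmp (X := fun i => (E i * (dual i.2 * seq 'I_i.1))%type) (Y := Dual_) (fun i x => mu i (a i x) (b i x)).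
  by move=> ca cb; apply: (c_app cmu (f := fun i x => (a i x, b i x))); cauto.
apply: c_pair; last by cauto.
by apply: c_omul; [cauto|apply: cmu'; cauto].
Qed.

Lemma c_kpoly p q :
  cmp (X := E) (Y := ordl) p -> cmp (X := E) (Y := Poly_) q ->
  cP (fun i x => kpoly co (dual_sym (p i x)) (q i x)).
Proof.
move=> cp cq; rewrite /kpoly.
apply: (c_map (A := KMon_)
  (B := DMon_)); last exact: cq.
by cauto.
Qed.

Lemma c_draw_moment mom p d
    args j :
  cmp (fun (i : idx) (x : nat * nat) => mom x.1 x.2) ->
  cmp (X := E) (Y := ordl) p -> cmp d -> cmp (X := E) (Y := fun i => seq (const 'I_i.2)) args -> cmp j ->
  cD (fun i x => draw_moment co (dual_sym (p i x)) mom (d i x) (args i x) (j i x)).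
Proof.
move=> cm cp cd ca cj; rewrite /draw_moment.
apply: (c_const_val (V := fun=> nat) (fV := fun=> id)
  (sym := fun i x k => nth (onum co 0) [seq const_val co (dual_sym (p i x)) c | c <- args i x] k)).
  apply: (c_nth (A := Dual_)); first by cauto.
    by apply: (c_map (A := Const_)); cauto.
  by cauto.
by apply: (c_app cm (f := fun i x => (d i x, j i x))); cauto.
Qed.

Lemma c_grid G :
  cmp (X := E) (Y := Grid_) G -> cmp (Y := Grid_)
    (fun i x => grid (G i x)).
Proof. by move=> cG; rewrite /grid; cauto. Qed.

Lemma c_cell_indicator G vs
    t tb :
  cmp (X := E) (Y := Grid_) G -> cmp (X := E) (Y := fun i => seq 'I_i.1) vs -> cD t ->
  cmp (X := E) (Y := Tab_) tb ->
  cP (fun i x => cell_indicator co (G i x) (vs i x) (t i x) (tb i x)).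
Proof.
move=> cG cvs ct ctb; rewrite /cell_indicator; apply: c_pmul; first by cauto.
apply: c_pprod; apply: (c_map (A := ordm) (B := LPoly_)) => //.
by apply: c_pprod; apply: (c_map (A := Dual_) (B := LPoly_)); cauto.
Qed.

Lemma c_cond_vars b : cmp (X := E) (Y := Cond_) b ->
  cmp (Y := fun i => seq 'I_i.1) (fun i x => cond_vars (b i x)).
Proof.
move=> cb; pose Y (i : idx) := seq 'I_i.1.
have cpv : cmp (X := Poly_) (Y := Y) (fun i q => poly_vars q).
  by rewrite /poly_vars; apply: c_flatten;
     apply: (c_map (E := Poly_) (A := KMon_)); [cauto|exact: c_id].
apply: (c_ext (f := fun i x => cond_fold [::] (fun q r => poly_vars q ++ poly_vars r)
  (fun q r => poly_vars q ++ poly_vars r) (fun q r => poly_vars q ++ poly_vars r)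
  id cat cat (b i x))).
  by move=> i x; elim: (b i x) => //= [? ->|? -> ? ->|? -> ? ->].
apply: (c_app (@c_cond_fold_gen E Y _ _ (fun i _ => [::]) (fun i _ q r => poly_vars q ++ poly_vars r)
  (fun i _ q r => poly_vars q ++ poly_vars r) (fun i _ q r => poly_vars q ++ poly_vars r)
  (fun i _ => id) (fun i _ => cat) (fun i _ => cat) _ _ _ _ _ _ _) (f := fun i x => (x, b i x))); cauto;
  by apply: (c_app cpv); cauto.
Qed.

End WpRules.

Ltac cfun4 := lazymatch goal with
  | |- cmp (fun i x => psubst _ _ _ _) => apply: c_psubst
  | |- cmp (fun i x => kpoly _ (dual_sym _) _) => apply: c_kpoly
  | |- cmp (fun i x => grid _) => apply: c_grid
  | |- cmp (fun i x => cell_indicator _ _ _ _ _) => apply: c_cell_indicator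
  | |- cmp (fun i x => cond_vars _) => apply: c_cond_vars
  end.
Ltac cfun ::= first [cfun1 | cfun2 | cfun3 | cfun4].

Section TruthRules.
Context {E : idx -> Type} {eE : forall i, Enc (E i)}.
Notation cD := (cmp (X := E) (Y := Dual_)).
Notation co := (dual_ops _).

Lemma c_apoly p tb
    q :
  cmp (X := E) (Y := ordl) p -> cmp (X := E) (Y := Tab_) tb -> cmp (X := E) (Y := Poly_) q ->
  cmp (Y := Ax_) (fun i x => apoly (dual_sym (p i x)) (tb i x) (q i x)).
Proof.
move=> cp ctb cq; rewrite /apoly; apply: (c_foldr (A := Ax_) (B := Ax_)); [by cauto|by cauto|].
apply: (c_map (A := KMon_) (B := Ax_)); last exact: cq.
apply: c_AMul; first by cauto.
by apply: (c_foldr (A := Ax_) (B := Ax_)); cauto.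
Qed.
End TruthRules.

Section TruthRules2.
Context {E : idx -> Type} {eE : forall i, Enc (E i)}.
Notation cD := (cmp (X := E) (Y := Dual_)).

Lemma c_dual_truth p tb
    b :
  cmp (X := E) (Y := ordl) p -> cmp (X := E) (Y := Tab_) tb -> cmp (X := E) (Y := Cond_) b ->
  cD (fun i x => dual_truth (dual_sym (p i x)) (b i x) (tb i x)).
Proof.
move=> cp ctb cb; rewrite /dual_truth; apply: c_pair; last by cauto.
rewrite /atruth; 
apply: (c_app (@c_cond_fold_gen E Ax_ _ _ (fun i _ => ANum 1)
    (fun i x q r => AIf (apoly (dual_sym (p i x)) (tb i x) q) (apoly (dual_sym (p i x)) (tb i x) r) (AIf (apoly (dual_sym (p i x)) (tb i x) r) (apoly (dual_sym (p i x)) (tb i x) q) (ANum 1) (ANum 0)) (ANum 0))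
    (fun i x q r => AIf (apoly (dual_sym (p i x)) (tb i x) q) (apoly (dual_sym (p i x)) (tb i x) r) (ANum 1) (ANum 0))
    (fun i x q r => AIf (apoly (dual_sym (p i x)) (tb i x) r) (apoly (dual_sym (p i x)) (tb i x) q) (ANum 0) (ANum 1))
    (fun i x a => AAdd (ANum 1) (AOpp a)) (fun i x => @AMul i.2)
    (fun i x a b => AAdd a (AMul (AAdd (ANum 1) (AOpp a)) b)) _ _ _ _ _ _ _)
  (f := fun i x => (x, b i x))); cauto; by apply: c_apoly; cauto.
Qed.
End TruthRules2.

Section WpRules2.
Variable mom : nat -> nat -> const nat.
Hypothesis cmom : cmp (fun (i : idx) (x : nat * nat) => mom x.1 x.2).
Notation co := (dual_ops _).

Section Indicator.
Context {E : idx -> Type} {eE : forall i, Enc (E i)}.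
Notation cP := (cmp (X := E) (Y := LPoly_)).

Lemma c_indicator p G
    b :
  cmp (X := E) (Y := ordl) p -> cmp (X := E) (Y := Grid_) G -> cmp (X := E) (Y := Cond_) b ->
  cP (fun i x => indicator co (dual_truth (dual_sym (p i x))) (G i x) (b i x)).
Proof.
move=> cp cG cb; rewrite /indicator; apply: c_pcompl; apply: c_pprod.
apply: (c_map (A := Tab_) (B := LPoly_)); last by cauto.
by apply: c_pcompl; apply: c_cell_indicator; cauto; apply: c_dual_truth; cauto.
Qed.

Lemma c_wp_assign p y
    e q :
  cmp (X := E) (Y := ordl) p -> cmp (X := E) (Y := ordm) y -> cmp (X := E) (Y := Rhs_) e -> cP q ->
  cP (fun i x => wp_assign co (dual_sym (p i x)) mom (y i x) (e i x) (q i x)).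
Proof.
move=> cp cy ce cq; rewrite /wp_assign.
apply: (c_app (@c_rhs_case_gen E LPoly_ _ _
  (fun i x d args => pdraw co (y i x) (draw_moment co (dual_sym (p i x)) mom d args) (q i x))
  (fun i x alts => wp_choice co (dual_sym (p i x)) (y i x) alts (q i x)) _ _)
  (f := fun i x => (x, e i x))); last by cauto.
  by apply: c_pdraw; cauto; apply: c_draw_moment; cauto.
rewrite /wp_choice; apply: (c_flatten (A := DMon_)).
apply: (c_map (A := fun i => (Defs.polynomial i.1 i.2 * const 'I_i.2)%type) (B := LPoly_)).
  by cauto.
exact: (c_snd (@c_id _ _)).
Qed.

Lemma c_wp_if p G
    b q r :
  cmp (X := E) (Y := ordl) p -> cmp (X := E) (Y := Grid_) G -> cmp (X := E) (Y := Cond_) b ->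
  cP q -> cP r ->
  cP (fun i x => wp_if co (dual_truth (dual_sym (p i x))) (G i x) (b i x) (q i x) (r i x)).
Proof.
move=> cp cG cb cq cr; rewrite /wp_if.
apply: (c_cat (A := DMon_));
  by apply: c_pmul; cauto; apply: c_indicator; cauto.
Qed.
End Indicator.

Section Wp.
Context {E : idx -> Type} {eE : forall i, Enc (E i)}.
Notation cP := (cmp (X := E) (Y := LPoly_)).

Lemma c_wp p G
    c q :
  cmp (X := E) (Y := ordl) p -> cmp (X := E) (Y := Grid_) G -> cmp (X := E) (Y := Stmt_) c ->
  cP q ->
  cP (fun i x => wp co (dual_sym (p i x)) mom (dual_truth (dual_sym (p i x))) (G i x) (c i x) (q i x)).
Proof.
move=> cp cG cc cq; rewrite /wp.
apply: (c_app (@c_stmt_fold_gen E LPoly_ _ _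
  (fun i x => wp_assign co (dual_sym (p i x)) mom)
  (fun i x => wp_if co (dual_truth (dual_sym (p i x))) (G i x)) _ _)
  (f := fun i x => ((x, q i x), c i x))).
- by apply: c_wp_assign; cauto.
- by apply: c_wp_if; cauto.
- by cauto.
Qed.
End Wp.

Section Term.
Context {E : idx -> Type} {eE : forall i, Enc (E i)}.

Lemma c_range_values p F :
  cmp (X := E) (Y := ordl) p -> cmp (X := E) (Y := Ranges_) F ->
  cmp (Y := Grid_) (fun i x => range_values co (dual_sym (p i x)) (F i x)).
Proof.
move=> cp cF; rewrite /range_values.
apply: (c_map (A := fun i => seq (const 'I_i.2)) (B := Tab_)) => //.
apply: (c_cons (A := Dual_)); first by cauto.
by apply: (c_map (A := Const_) (B := Dual_)); cauto.
Qed.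
End Term.

Section Term2.
Context {E : idx -> Type} {eE : forall i, Enc (E i)}.

Lemma c_sensitivity_term F
    init body x0
    p k n :
  cmp (X := E) (Y := Ranges_) F -> cmp (X := E) (Y := Stmt_) init -> cmp (X := E) (Y := Stmt_) body ->
  cmp (X := E) (Y := ordm) x0 -> cmp (X := E) (Y := ordl) p -> cmp k -> cmp n ->
  cmp (Y := Ax_) (fun i x => sensitivity_term mom (F i x) (init i x) (body i x) (x0 i x)
    (p i x) (k i x) (n i x)).
Proof.
move=> cF ci cb cx cp ck cn; rewrite /sensitivity_term; apply: (c_snd (A := Ax_)).
rewrite /wp_moment /ev0; apply: (c_foldr (A := Dual_) (B := Dual_)); [by cauto|by cauto|].
apply: (c_map (A := DMon_) (B := Dual_)); first by cauto.
apply: c_wp; cauto; first by apply: c_range_values; cauto.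
rewrite /wp_iter; apply: (c_iter (B := LPoly_)) => //.
  by apply: c_wp; cauto; apply: c_range_values; cauto.
apply: (c_cons (A := DMon_)); last exact: c_nil.
apply: c_pair; first by cauto.
apply: (c_ext (f := fun i x => map (fun _ => x0 i x) (iota 0 (k i x)))).
  by move=> i x; elim: (k i x) => // j IH; rewrite -addn1 iotaD map_cat IH nseqD.
by cauto.
Qed.
End Term2.
End WpRules2.

Section SolveRules.
Context {E : idx -> Type} {eE : forall i, Enc (E i)}.
Notation cR := (cmp (X := E) (Y := Row_)).
Notation cM := (cmp (X := E) (Y := Mat_)).

Lemma c_choose_row r p : cR r -> cR p -> cR (fun i x => choose_row (r i x) (p i x)).
Proof. by move=> cr cp; rewrite /choose_row /a_ifz; cauto. Qed.

Lemma c_eliminate r p : cR r -> cR p -> cR (fun i x => eliminate (r i x) (p i x)).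
Proof.
move=> cr cp; rewrite /eliminate; apply: (c_map (A := fun=> nat) (B := Ax_)); last by cauto.
by apply: c_if; first (by apply: c_isz; cauto); cauto.
Qed.

Lemma c_a_sum s : cR s -> cmp (Y := Ax_) (fun i x => a_sum (s i x)).
Proof. by move=> cs; rewrite /a_sum; cauto. Qed.

Lemma c_a_nat n : cmp n -> cmp (X := E) (Y := Ax_) (fun i x => a_nat i.2 (n i x)).
Proof. by move=> cn; rewrite /a_nat; cauto. Qed.

Lemma c_a_pow a n : cmp (Y := Ax_) a -> cmp n ->
  cmp (X := E) (Y := Ax_) (fun i x => a_pow (a i x) (n i x)).
Proof. by move=> ca cn; rewrite /a_pow; cauto. Qed.
End SolveRules.

Section SolveRules2.
Context {E : idx -> Type} {eE : forall i, Enc (E i)}.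
Notation cR := (cmp (X := E) (Y := Row_)).
Notation cM := (cmp (X := E) (Y := Mat_)).

Lemma c_pivot rows : cM rows -> cR (fun i x => pivot (rows i x)).
Proof.
move=> cr; rewrite /pivot; apply: (c_foldr (A := Row_) (B := Row_)); [|by cauto|by cauto].
by apply: c_choose_row; cauto.
Qed.

Lemma c_back_subst p xs : cR p -> cR xs -> cR (fun i x => back_subst (p i x) (xs i x)).
Proof.
move=> cp cx; rewrite /back_subst; apply: (c_cons (A := Ax_)); last by cauto.
by cauto; apply: c_a_sum; cauto.
Qed.
End SolveRules2.

Section SolveRules3.
Context {E : idx -> Type} {eE : forall i, Enc (E i)}.
Notation cR := (cmp (X := E) (Y := Row_)).
Notation cM := (cmp (X := E) (Y := Mat_)).

Lemma c_eliminate_all rows : cM rows -> cM (fun i x => eliminate_all (rows i x)).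
Proof.
move=> cr; rewrite /eliminate_all; apply: (c_map (A := Row_) (B := Row_)) => //.
by apply: c_eliminate; cauto; apply: c_pivot; cauto.
Qed.
End SolveRules3.

Section SolveRules4.
Context {E : idx -> Type} {eE : forall i, Enc (E i)}.
Notation cR := (cmp (X := E) (Y := Row_)).
Notation cM := (cmp (X := E) (Y := Mat_)).

Lemma c_solve n rows : cmp n -> cM rows -> cR (fun i x => solve (n i x) (rows i x)).
Proof.
move=> cn cr; rewrite /solve; apply: (c_foldr (A := fun=> nat) (B := Row_)); [|by cauto|by cauto].
apply: c_back_subst; last by cauto.
apply: c_pivot; apply: (c_iter (B := Mat_)); [|by cauto|by cauto].
by apply: c_eliminate_all; cauto.
Qed.
End SolveRules4.

Section ClosedRules.
Context {E : idx -> Type} {eE : forall i, Enc (E i)}.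
Notation cR := (cmp (X := E) (Y := Row_)).
Notation cM := (cmp (X := E) (Y := Mat_)).

Lemma c_char_poly_coefs v n : cR v -> cmp n -> cR (fun i x => char_poly_coefs (v i x) (n i x)).
Proof.
move=> cv cn; rewrite /char_poly_coefs; apply: (c_cat (A := Ax_)); last by cauto.
apply: (c_map (A := Ax_) (B := Ax_)); first by cauto.
apply: c_solve => //; rewrite /hankel_rows; apply: (c_map (A := fun=> nat) (B := Row_)); last by cauto.
by apply: (c_cons (A := Ax_)); cauto.
Qed.

Lemma c_closed_rows v n chi : cR v -> cmp n -> cR chi ->
  cM (fun i x => closed_rows (v i x) (n i x) (chi i x)).
Proof.
move=> cv cn cc; rewrite /closed_rows; apply: (c_map (A := fun=> nat) (B := Row_)); last by cauto.
apply: (c_cons (A := Ax_)); first by cauto.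
apply: (c_allpairs (A := fun=> nat) (B := fun=> nat) (C := Ax_)); [|by cauto|by cauto].
by apply: c_AMul; apply: c_a_pow; cauto; apply: c_a_nat; cauto.
Qed.
End ClosedRules.

Section MainRules.
Context {E : idx -> Type} {eE : forall i, Enc (E i)}.
Notation cR := (cmp (X := E) (Y := Row_)).

Lemma c_closed_form_of v n : cR v -> cmp n ->
  cmp (Y := fun i => closed_form i.2) (fun i x => closed_form_of (v i x) (n i x)).
Proof.
move=> cv cn; rewrite /closed_form_of.
have cc : cR (fun i x => char_poly_coefs (v i x) (n i x)) by apply: c_char_poly_coefs.
apply: c_ClosedForm; first by apply: (c_map (A := fun=> nat) (B := Ax_)); cauto.
apply: (c_map (A := fun=> nat) (B := fun i => (seq (aexp i.2) * aexp i.2)%type)); last by cauto.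
apply: (c_pair (A := Row_) (B := Ax_)); last first.
  apply: c_ARoot; last by cauto.
  exact: (c_app cc (f := fun i (x : E i * nat) => x.1) (c_fst (@c_id _ _))).
apply: (c_map (A := fun=> nat) (B := Ax_)); last by cauto.
apply: (c_nth (A := Ax_)); [by cauto| |by cauto].
apply: c_solve; first by cauto.
apply: c_closed_rows; [by cauto|by cauto|].
exact: (c_app cc (f := fun i (x : E i * nat * nat) => x.1.1) (c_fst (c_fst (@c_id _ _)))).
Qed.

End MainRules.

(** Nested pairs ending in [unit] have the encoding of a list, so this type is encoded exactly as
    [enc_input] prescribes. *)
Definition input : idx -> Type := fun i =>
  (nat * (nat * (stmt i.1 i.2 * (stmt i.1 i.2 * (seq (seq (const 'I_i.2)) *
  ('I_i.1 * ('I_i.2 * (nat * unit))))))))%type.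

#[global] Instance Enc_input i : Enc (input i).
Proof. unfold input; exact _. Defined.

Definition input_size (i : idx) (x : input i) : nat := tree_size (enc x).

Lemma main_alg_computable mom :
  cmp (fun (i : idx) (x : nat * nat) => mom x.1 x.2) ->
  exists A : lprog, forall m l (P : loop m l) (F : m.-tuple (seq (const 'I_l))) x p k,
    computes A (enc_input P F x p k)
      (enc_closed_form (main_alg mom (tree_size (enc_input P F x p k)) F (loop_init P) (loop_body P) x p k)).
Proof.
move=> cm.
have [|A hA] := @cmp_prog input (fun i => closed_form i.2) _ _
  (fun i x => main_alg mom (input_size x) x.2.2.2.2.1 x.2.2.1 x.2.2.2.1
     x.2.2.2.2.2.1 x.2.2.2.2.2.2.1 x.2.2.2.2.2.2.2.1).
  have cs : cmp input_size by exact: c_tree_size.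
  have co : cmp (fun i x => order_bound (@input_size i x)).
    by rewrite /order_bound /dim_bound /weight_bound; cauto.
  rewrite /main_alg; apply: c_closed_form_of; last by cauto.
  apply: (c_map (A := fun=> nat) (B := Ax_)); last by cauto.
  by apply: c_sensitivity_term => //; cauto.
exists A => m l P F x p k.
exact: (hA (m, l) (m, (l, (loop_init P, (loop_body P, (tval F, (x, (p, (k, tt))))))))).
Qed.

(** * Linear recurrences *)

Section Recurrence.
Variable F : numFieldType.
Implicit Types (p q r f : {poly F}) (v w : nat -> F).

(* The shift operator is substituted for the variable of [q]. *)
Definition pact q v (i : nat) : F := \sum_(j < size q) q`_j * v (i + j)%N.

Definition kills q v : Prop := forall i, pact q v i = 0.

Lemma pactE n q v i : (size q <= n)%N -> pact q v i = \sum_(j < n) q`_j * v (i + j)%N.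
Proof.
move=> qn; rewrite /pact (big_ord_widen n (fun j => q`_j * v (i + j)%N)) // big_mkcond/=.
apply: eq_bigr => j _; case: ltnP => // h; by rewrite nth_default ?mul0r.
Qed.

Lemma pactD q r v i : pact (q + r) v i = pact q v i + pact r v i.
Proof.
pose n := maxn (size q) (size r).
rewrite !(@pactE n) ?leq_maxl ?leq_maxr ?(leq_trans (size_polyD _ _))//.
by rewrite -big_split; apply: eq_bigr => j _; rewrite coefD mulrDl.
Qed.

Lemma pactZ c q v i : pact (c *: q) v i = c * pact q v i.
Proof.
rewrite !(@pactE (size q)) ?size_scale_leq// mulr_sumr.
by apply: eq_bigr => j _; rewrite coefZ mulrA.
Qed.

Lemma pactC c v i : pact c%:P v i = c * v i.
Proof. by rewrite (@pactE 1) ?size_polyC_leq1// big_ord1 coefC addn0. Qed.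

Lemma pactMX q v i : pact (q * 'X) v i = pact q v i.+1.
Proof.
rewrite (@pactE (size q).+1); last first.
  by rewrite (leq_trans (size_polyMleq _ _))// size_polyX addn2.
rewrite big_ord_recl coefMX mul0r add0r (@pactE (size q))//.
by apply: eq_bigr => j _; rewrite coefMX/= /bump/= add1n addnS addSn.
Qed.

Lemma pact_ext q v w i : v =1 w -> pact q v i = pact q w i.
Proof. by move=> e; apply: eq_bigr => j _; rewrite e. Qed.

(** Sequences become a module over the polynomials, so annihilators can be multiplied and reordered.
    By induction on [q], the shift and the scalars are enough. *)
Lemma pactM q r v i : pact (q * r) v i = pact q (pact r v) i.
Proof.
elim/poly_ind: q i => [|q c IH] i; first by rewrite mul0r /pact size_poly0 !big_ord0.
rewrite mulrDl pactD [RHS]pactD -mulrA (mulrC 'X) mulrA !pactMX IH.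
by rewrite mul_polyC pactZ pactC.
Qed.

Lemma pact_lin q v w c i : pact q (fun n => v n + c * w n) i = pact q v i + c * pact q w i.
Proof.
by rewrite /pact mulr_sumr -big_split; apply: eq_bigr => j _; rewrite mulrDr mulrCA.
Qed.

Lemma pact_sum (I : Type) (s : seq I) q (v : I -> nat -> F) i :
  pact q (fun n => \sum_(k <- s) v k n) i = \sum_(k <- s) pact q (v k) i.
Proof.
rewrite /pact exchange_big/=; apply: eq_bigr => j _; by rewrite mulr_sumr.
Qed.

Lemma kills_mull q r v : kills r v -> kills (q * r) v.
Proof.
by move=> h i; rewrite pactM; apply: big1 => j _; rewrite h mulr0.
Qed.

Lemma kills_mulr q r v : kills q v -> kills (q * r) v.
Proof. by move=> h; rewrite mulrC; apply: kills_mull. Qed.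

Lemma kills_dvd q r v : q %| r -> kills q v -> kills r v.
Proof. by move=> /dvdpP[p ->]; exact: kills_mull. Qed.

(** A monic recurrence of order [n] computes each further term from the [n] preceding ones. *)
Lemma monic_init_zero q v n : q \is monic -> size q = n.+1 -> kills q v ->
  (forall i, (i < n)%N -> v i = 0) -> forall i, v i = 0.
Proof.
move=> qm qn qv v0; elim/ltn_ind => i IH; case: (ltnP i n) => [|ni]; first exact: v0.
have := qv (i - n)%N; rewrite (@pactE n.+1) ?qn// big_ord_recr/= subnK//.
rewrite big1 ?add0r => [|j _]; last by rewrite IH ?mulr0//; have := ltn_ord j; lia.
by move/eqP: qm; rewrite /lead_coef qn/= => ->; rewrite mul1r.
Qed.

(** Multiplying by a power of X only delays the recurrence, so the degree can be raised to exactly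
    [n]. *)
Lemma kills_monic q v n : q != 0 -> (size q <= n.+1)%N -> kills q v ->
  exists q', [/\ q' \is monic, size q' = n.+1 & kills q' v].
Proof.
move=> q0 qn qv; exists ((lead_coef q)^-1 *: (q * 'X^(n.+1 - size q))).
have lq : lead_coef q != 0 by rewrite lead_coef_eq0.
split.
- by rewrite monicE lead_coefZ lead_coefM lead_coefXn mulr1 mulVf.
- by rewrite size_scale ?invr_eq0// size_mulXn// subnK.
- by move=> i; rewrite pactZ (kills_mulr _ qv) mulr0.
Qed.

(* Kronecker: it suffices to test [n] terms. *)
Lemma kills_of_init q chi v n : q \is monic -> size q = n.+1 -> kills q v ->
  (forall i, (i < n)%N -> pact chi v i = 0) -> kills chi v.
Proof.
move=> qm qn qv; apply: monic_init_zero qm qn _ => i.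
by rewrite -pactM mulrC pactM; apply: big1 => j _; rewrite qv mulr0.
Qed.

Definition pshift f : {poly F} := f \Po ('X + 1).

Lemma pshift_horner f (n : nat) : (pshift f).[n%:R] = f.[n.+1%:R].
Proof. by rewrite horner_comp !hornerE natr1. Qed.

(** Substituting X + 1 preserves degree and leading coefficient, so the leading terms cancel. *)
Lemma size_pshift_sub f : (size (pshift f - f)%R <= (size f).-1)%N.
Proof.
have [->|f0] := eqVneq f 0; first by rewrite /pshift comp_poly0 subr0 size_poly0.
rewrite -ltnS prednK ?size_poly_gt0//.
have X1 : ('X + 1 : {poly F}) = 'X + 1%:P by rewrite polyC1.
have sf : size (pshift f) = size f by rewrite /pshift size_comp_poly2// X1 size_XaddC.
have lf : lead_coef (pshift f) = lead_coef f.
  by rewrite /pshift lead_coef_comp ?X1 ?size_XaddC// lead_coefXaddC expr1n mulr1.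
rewrite ltn_neqAle (leq_trans (size_polyD _ _)) ?size_polyN ?sf ?maxnn// andbT.
apply: contra f0 => /eqP sz.
have : (pshift f - f)`_(size f).-1 = 0.
  by rewrite coefB -{1}sf -!lead_coefE lf subrr.
by rewrite -sz -lead_coefE => /eqP; rewrite lead_coef_eq0 -size_poly_eq0 sz size_poly_eq0.
Qed.

(** X - lam sends f(n) lam^n to lam (f(n+1) - f(n)) lam^n, whose polynomial has smaller degree. *)
Lemma kills_pow (lam : F) f k : (size f <= k)%N ->
  kills (('X - lam%:P) ^+ k) (fun n => f.[n%:R] * lam ^+ n).
Proof.
elim: k f => [|k IH] f; first by rewrite leqn0 size_poly_eq0 => /eqP -> i;
  rewrite expr0 /pact big1// => j _; rewrite horner0 mul0r mulr0.
move=> fk i; rewrite exprSr pactM.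
have e n : pact ('X - lam%:P) (fun n => f.[n%:R] * lam ^+ n) n =
    (lam *: (pshift f - f)).[n%:R] * lam ^+ n.
  rewrite pactD -[X in pact X]mul1r pactMX pactC -polyCN pactC mul1r.
  by rewrite hornerZ hornerD hornerN pshift_horner exprS; ring.
rewrite (pact_ext _ _ e); apply: IH.
rewrite (leq_trans (size_scale_leq _ _))// (leq_trans (size_pshift_sub _))//.
by move: fk; case: (size f).
Qed.

Lemma pshiftD f r : pshift (f + r) = pshift f + pshift r.
Proof. exact: raddfD. Qed.

Lemma pshiftZ c f : pshift (c *: f) = c *: pshift f.
Proof. exact: linearZ. Qed.

Lemma size_le_pred q d : (size q <= d.+1)%N -> q`_d = 0 -> (size q <= d)%N.
Proof.
move=> sq qd; apply/leq_sizeP => j; rewrite leq_eqVlt => /predU1P[<-//|dj].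
by rewrite nth_default// (leq_trans sq).
Qed.

(** The operator f(n) -> mu f(n+1) - z f(n) multiplies the leading coefficient by mu - z. In the
    resonant case mu = z it lowers the degree by one, with factor mu (d + 1) on X^(d+1); hence the
    allowance of one more degree for [g]. *)
Lemma shift_monomial (mu z : F) d : mu != 0 -> exists g : {poly F},
  (size g <= d.+2)%N /\ (size (mu *: pshift g - z *: g - 'X^d)%R <= d)%N.
Proof.
move=> mu0; have [<-|muz] := eqVneq mu z; last first.
  have mz0 : mu - z != 0 by rewrite subr_eq0.
  exists ((mu - z)^-1 *: 'X^d); split.
    by rewrite (leq_trans (size_scale_leq _ _))// size_polyXn.
  set g := (mu - z)^-1 *: 'X^d; have -> : mu *: pshift g - z *: g - 'X^d = mu *: (pshift g - g).
    have -> : 'X^d = (mu - z) *: g by rewrite scalerA divff// scale1r.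
    by rewrite scalerBl scalerBr; ring.
  rewrite (leq_trans (size_scale_leq _ _))// (leq_trans (size_pshift_sub _))//.
  by rewrite size_scale ?invr_eq0// size_polyXn.
have c0 : mu * d.+1%:R != 0 by rewrite mulf_neq0// pnatr_eq0.
exists ((mu * d.+1%:R)^-1 *: 'X^(d.+1)); split.
  by rewrite (leq_trans (size_scale_leq _ _))// size_polyXn.
rewrite pshiftZ -scalerBr -scalerBr scalerA invfM mulrA mulfV// mul1r.
have -> : pshift ('X^(d.+1)) = ('X + 1) ^+ d.+1.
  by rewrite /pshift rmorphXn/= comp_polyX.
(* (X+1)^(d+1) - X^(d+1) is a sum of d + 1 monic polynomials of degree d, whence the leading
   coefficient d + 1. *)
rewrite subrXX [_ - 'X]addrAC subrr add0r mul1r.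
have mon (i : 'I_d.+1) : ('X + 1) ^+ (d.+1.-1 - i) * 'X^i \is @monic F /\
    size (('X + 1) ^+ (d.+1.-1 - i) * 'X^i : {poly F}) = d.+1.
  have mX : 'X + 1 \is @monic F by rewrite -polyC1 monicXaddC.
  have mXn : ('X + 1) ^+ (d.+1.-1 - i) \is @monic F by rewrite monic_exp.
  split; first by rewrite monicMl// monicXn.
  rewrite size_monicM ?size_polyXn ?monic_neq0 ?monicXn// addnS/=.
  have := size_exp ('X + 1 : {poly F}) (d.+1.-1 - i); rewrite -{1 2}polyC1 size_XaddC mul1n => e.
  have p0 : (0 < size (('X + 1%:P) ^+ (d.+1.-1 - i) : {poly F}))%N.
    by rewrite size_poly_gt0 polyC1 monic_neq0.
  by move: e p0; rewrite polyC1/=; case: (size _) => //= k -> _; rewrite addSn subnK// -ltnS.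
apply: size_le_pred.
  rewrite (leq_trans (size_polyD _ _))// size_polyN size_polyXn geq_max leqnn andbT.
  rewrite (leq_trans (size_scale_leq _ _))//; apply: (leq_trans (size_sum _ _ _)).
  by apply/bigmax_leqP => i _; have [_ ->] := mon i.
rewrite coefB coefXn eqxx coefZ coef_sum (eq_bigr (fun=> 1)) => [|i _].
  by rewrite sumr_const card_ord mulVf ?pnatr_eq0// subrr.
by have [mi si] := mon i; move/monicP: mi; rewrite lead_coefE si.
Qed.

(** Leading coefficients are removed one by one with [shift_monomial]. *)
Lemma shift_surj (mu z : F) n p : mu != 0 -> (size p <= n)%N ->
  exists f : {poly F}, (size f <= n.+1)%N /\ mu *: pshift f - z *: f = p.
Proof.
move=> mu0; elim: n p => [|n IH] p.
  rewrite leqn0 size_poly_eq0 => /eqP ->; exists 0.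
  by rewrite size_poly0 /pshift comp_poly0 !scaler0 subr0.
move=> pn; have [g [sg hg]] := shift_monomial z n mu0.
set Lg := mu *: pshift g - z *: g in hg.
have [|f [sf hf]] := IH (p - p`_n *: Lg).
  apply: size_le_pred.
    rewrite (leq_trans (size_polyD _ _))// geq_max pn size_polyN.
    rewrite (leq_trans (size_scale_leq _ _))//.
    have -> : Lg = (Lg - 'X^n) + 'X^n by rewrite subrK.
    by rewrite (leq_trans (size_polyD _ _))// geq_max size_polyXn leqnn andbT (leq_trans hg).
  have -> : Lg = (Lg - 'X^n) + 'X^n by rewrite subrK.
  rewrite coefB coefZ coefD coefXn eqxx (nth_default _ hg) add0r mulr1 subrr//.
exists (f + p`_n *: g); split.
  rewrite (leq_trans (size_polyD _ _))// geq_max (leq_trans sf)//=.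
  by rewrite (leq_trans (size_scale_leq _ _)).
rewrite pshiftD pshiftZ !scalerDr opprD addrACA hf.
rewrite [_ *: (_ *: pshift g)]scalerA [_ *: (_ *: g)]scalerA (mulrC mu) (mulrC z) -!scalerA -scalerBr.
by rewrite subrK.
Qed.

(** Peels off the root [z]: applying X - z leaves a sequence with a closed form by induction,
    [shift_surj] gives a particular solution of the resulting first-order equation, and the rest is
    a multiple of z^n. *)
Lemma closed_form_exists (rs : seq F) v : kills (\prod_(z <- rs) ('X - z%:P)) v ->
  exists ps : nat -> {poly F}, (forall i, (size (ps i) <= size rs)%N) /\
    forall n, (size rs <= n)%N -> v n = \sum_(i < size rs) (ps i).[n%:R] * rs`_i ^+ n.
Proof.
elim: rs v => [|z rs IH] v.
  rewrite big_nil => h; exists (fun=> 0); split=> [i|n _]; first by rewrite size_poly0.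
  by rewrite big_ord0 -(h n) -polyC1 pactC mul1r.
rewrite big_cons => h.
have [|ps [sps hps]] := IH (pact ('X - z%:P) v) _.
  by move=> i; rewrite -pactM mulrC; exact: h.
(* A root 0 contributes nothing at positive indices, so its polynomial is set to 0. *)
have /choice[fs hfs] : forall i : nat, exists f : {poly F}, (size f <= (size rs).+1)%N /\
    (if rs`_i == 0 then f = 0 else rs`_i *: pshift f - z *: f = ps i).
  move=> i; case: eqP => [_|/eqP r0]; first by exists 0; rewrite size_poly0.
  exact: shift_surj r0 (sps i).
pose h0 n := v n - \sum_(i < size rs) (fs i).[n%:R] * rs`_i ^+ n.
have hS n : (size rs <= n)%N -> h0 n.+1 = z * h0 n.
  move=> sn; have := hps n sn.
  rewrite pactD -[X in pact X]mul1r pactMX -polyC1 pactC mul1r -polyCN pactC mulNr => hv.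
  have {}hv : v n.+1 = z * v n + \sum_(i < size rs) (ps i).[n%:R] * rs`_i ^+ n.
    by rewrite -hv; ring.
  rewrite /h0 hv mulrBr -addrA; congr (_ + _); rewrite mulr_sumr -!sumrN -big_split/=.
  apply: eq_bigr => i _; have := (hfs i).2; case: eqP => [r0 ->|_ <-].
    have n0 : (0 < n)%N by rewrite (leq_trans _ sn)// (leq_ltn_trans _ (ltn_ord i)).
    by rewrite r0 !horner0 !expr0n/= (gtn_eqF n0) !(mul0r, mulr0, subr0, oppr0).
  by rewrite hornerD hornerN !hornerZ pshift_horner exprS; ring.
have hE k : h0 (size rs + k)%N = h0 (size rs) * z ^+ k.
  elim: k => [|k IHk]; first by rewrite addn0 expr0 mulr1.
  by rewrite addnS hS ?leq_addr// IHk exprS; ring.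
(* For z = 0 the rest [h0] vanishes beyond index [size rs], and the claim concerns only such
   indices. *)
pose pz : {poly F} := if z == 0 then 0 else (h0 (size rs) / z ^+ size rs)%:P.
exists (fun i => if i is j.+1 then fs j else pz); split.
  case=> [|i]; last exact: (hfs i).1.
  by rewrite /pz; case: ifP; rewrite ?size_poly0//= (leq_trans (size_polyC_leq1 _)).
move=> n sn; rewrite big_ord_recl/=.
have -> : v n = h0 n + \sum_(i < size rs) (fs i).[n%:R] * rs`_i ^+ n by rewrite subrK.
congr (_ + _); rewrite -(subnKC (ltnW sn)) hE /pz.
have [->|z0] := eqVneq z 0.
  by rewrite horner0 mul0r expr0n subn_eq0 leqNgt sn mulr0.
by rewrite hornerC exprD mulrA divfK// expf_neq0.
Qed.

End Recurrence.

(** * Correctness of the closed form *)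

Section ClosedForm.
Variables (R : realType) (l : nat) (theta : 'I_l -> R).
Local Notation C := R[i].
Local Notation eval := (aexp_eval theta).
Local Notation "r `[ j ]" := (nth (ANum 0) r j) (at level 2, format "r `[ j ]").
Implicit Types (r p : seq (aexp l)) (rows : seq (seq (aexp l))) (x y : nat -> C).

Lemma eval_num0 : eval (ANum 0) = 0. Proof. exact: rmorph0. Qed.
Lemma eval_num1 : eval (ANum 1) = 1. Proof. exact: rmorph1. Qed.

Lemma eval_ifz a b c : eval (a_ifz a b c) = if eval a == 0 then eval b else eval c.
Proof.
rewrite /a_ifz /= !rmorph0 eq_le; case: ifP => //= _; by case: ifP.
Qed.

Definition entry r (j : nat) : C := eval (r`[j]).

Lemma entry_over r j : (size r <= j)%N -> entry r j = 0.
Proof. by move=> h; rewrite /entry nth_default// eval_num0. Qed.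

Lemma entry_map (f : nat -> aexp l) n j : entry [seq f j | j <- iota 0 n] j = if (j < n)%N then eval (f j) else 0.
Proof.
case: ltnP => h; last by rewrite entry_over// size_map size_iota.
by rewrite /entry (nth_map 0%N) ?size_iota// nth_iota.
Qed.

Definition sat n r x : Prop := entry r 0 = \sum_(j < n) entry r j.+1 * x j.

Local Notation In := List.In.
Local Notation sized w rows := (forall r, In r rows -> size r = w).

Lemma pivotP w rows : sized w rows ->
  (exists r, [/\ In r rows, entry r 1 != 0 & entry (pivot rows) =1 entry r]) \/
  ((forall r, In r rows -> entry r 1 = 0) /\ entry (pivot rows) =1 fun=> 0).
Proof.
elim: rows => [|r rows IH] /= sw.
  by right; split=> // j; rewrite entry_over.
have sr : size r = w by apply: sw; left.
have e j : entry (choose_row r (pivot rows)) j =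
    if (j < size r)%N then if entry r 1 == 0 then entry (pivot rows) j else entry r j else 0.
  by rewrite entry_map; case: ifP => // _; rewrite eval_ifz.
have [r1|r1] := eqVneq (entry r 1) 0; last first.
  left; exists r; split=> //; first by left.
  by move=> j; rewrite e (negbTE r1); case: ltnP => // h; rewrite entry_over.
have [[r' [r'in r'1 he]]|[h0 he]] := IH (fun r h => sw r (or_intror h)).
  left; exists r'; split=> //; first by right.
  move=> j; rewrite e r1 eqxx he; case: ltnP => // h; rewrite entry_over//.
  by rewrite (sw r') -?sr//; right.
right; split=> [r' [<-//|/h0//]|j].
by rewrite e r1 eqxx he; case: ifP.
Qed.

Lemma entry_eliminate w p r j : (size p <= w)%N -> size r = w -> (1 < w)%N ->
  let k := (if j == 0 then 0 else j.+1)%N in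
  entry (eliminate p r) j = entry r k - entry r 1 / entry p 1 * entry p k.
Proof.
move=> sp sr w1 k; rewrite entry_map sr /k; case: ltnP => h; first by case: ifP.
have -> : (j == 0)%N = false by lia.
by rewrite (@entry_over r j.+1) ?(@entry_over p j.+1) ?mulr0 ?subrr//; lia.
Qed.

Lemma size_pivot w rows : sized w rows -> (size (pivot rows) <= w)%N.
Proof. by case: rows => //= r rows h; rewrite size_map size_iota h//; left. Qed.

Lemma size_eliminate_all w rows : sized w rows ->
  sized w.-1 (eliminate_all rows).
Proof.
by move=> h r' /List.in_map_iff[r [<- /h sr]]; rewrite size_map size_iota sr.
Qed.

Lemma solveS n rows :
  solve n.+1 rows = back_subst (pivot rows) (solve n (eliminate_all rows)).
Proof.
rewrite /solve /= -[1%N]/(1 + 0)%N iotaDl foldr_map; congr back_subst.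
by elim: (iota 0 n) => //= k s ->; rewrite -iterS iterSr.
Qed.

Lemma size_solve n rows : size (solve n rows) = n.
Proof. by elim: n rows => // n IH rows; rewrite solveS /= IH. Qed.

Lemma eval_sum (s : seq (aexp l)) : eval (a_sum s) = \sum_(a <- s) eval a.
Proof. by elim: s => [|a s IH]; rewrite ?big_nil ?eval_num0// big_cons /= -IH. Qed.

(** Systems may be over- and underdetermined. Elimination preserves the existence of a solution, and
    back substitution recovers each original equation from its eliminated form, whatever solution
    was found. *)
Lemma solveP n w rows : (n < w)%N -> sized w rows ->
  (exists x, forall r, In r rows -> sat n r x) ->
  forall r, In r rows -> sat n r (entry (solve n rows)).
Proof.
elim: n w rows => [|n IH] w rows nw sw [x hx] r rin.
  by rewrite /sat big_ord0; have := hx r rin; rewrite /sat big_ord0.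
have w1 : (1 < w)%N by lia.
have sp := size_pivot sw.
have pE r' j : In r' rows -> entry (eliminate (pivot rows) r') j =
    entry r' (if j == 0 then 0 else j.+1)%N - entry r' 1 / entry (pivot rows) 1 *
    entry (pivot rows) (if j == 0 then 0 else j.+1)%N.
  by move=> r'in; apply: (@entry_eliminate w) => //; exact: sw.
have sumM a f g : \sum_(j < n) a * f j * g j = a * \sum_(j < n) f j * g j :> C.
  by rewrite mulr_sumr; apply: eq_bigr => j _; rewrite mulrA.
have satS r' y : sat n.+1 r' y <->
    entry r' 0 = entry r' 1 * y 0%N + \sum_(j < n) entry r' j.+2 * y j.+1.
  by rewrite /sat big_ord_recl.
set xs := solve n (eliminate_all rows).
have {IH} hxs : forall r, In r (eliminate_all rows) -> sat n r (entry xs).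
  apply: (IH w.-1); [lia|exact: size_eliminate_all|].
  exists (fun j => x j.+1) => _ /List.in_map_iff[r' [<- r'in]]; rewrite /sat pE//.
  under eq_bigr do rewrite pE//= mulrBl.
  rewrite big_split/= sumrN sumM; have := hx r' r'in; rewrite satS => ->.
  (* Either a multiple of a valid equation is subtracted, or all coefficients of the unknown vanish
     and the equations are unchanged. *)
  have [[q [qin q1 qE]]|[h0 hp]] := pivotP sw.
    have : sat n.+1 (pivot rows) x.
      by rewrite /sat qE (hx q qin); apply: eq_bigr => j _; rewrite qE.
    by rewrite satS => ->; rewrite -qE in q1; field.
  by rewrite (h0 _ r'in) !mul0r !subr0 add0r.
rewrite solveS -/xs satS.
have := hxs (eliminate (pivot rows) r) (List.in_map _ _ _ rin); rewrite /sat pE//=.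
under eq_bigr do rewrite pE//= mulrBl.
rewrite big_split/= sumrN sumM => /eqP; rewrite subr_eq => /eqP ->.
have -> : entry (back_subst (pivot rows) xs) 0 = (entry (pivot rows) 1)^-1 *
    (entry (pivot rows) 0 - \sum_(j < n) entry (pivot rows) j.+2 * entry xs j).
  rewrite {1}/entry /= eval_sum; congr (_ * (_ - _)).
  by rewrite big_map size_solve -{1}[n]subn0 -/(index_iota 0 n) big_mkord.
by rewrite -[X in _ = _ + X]/(\sum_(j < n) entry r j.+2 * entry xs j); ring.
Qed.


Lemma sum_allpairs (f : nat -> nat -> aexp l) x N M :
  \sum_(j < N * M) entry [seq f i d | i <- iota 0 N, d <- iota 0 M] j * x j =
  \sum_(i < N) \sum_(d < M) eval (f i d) * x (i * M + d)%N.
Proof.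
elim: N => [|N IH]; first by rewrite !big_ord0.
rewrite [RHS]big_ord_recr -IH.
have -> : [seq f i d | i <- iota 0 N.+1, d <- iota 0 M] =
    [seq f i d | i <- iota 0 N, d <- iota 0 M] ++ [seq f N d | d <- iota 0 M].
  by rewrite -addn1 iotaD map_cat flatten_cat/= cats0.
set s := [seq f i d | i <- _, d <- _].
have ss : size s = (N * M)%N by rewrite size_allpairs !size_iota.
rewrite -!(big_mkord xpredT (fun j => entry _ j * x j)) mulSn addnC.
rewrite (big_cat_nat (n := (N * M)%N)) ?leq_addr//=; congr (_ + _).
  rewrite !big_mkord; apply: eq_bigr => j _.
  by rewrite /entry nth_cat ss ltn_ord.
rewrite -{1}[(N * M)%N]add0n big_addn addKn big_mkord; apply: eq_bigr => d _.
rewrite /entry nth_cat ss ltnNge leq_addl/= addnK addnC -/(entry _ d) entry_map.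
by rewrite ltn_ord.
Qed.

Lemma in_iota k n : In k (iota 0 n) <-> (k < n)%N.
Proof.
suff h m : In k (iota m n) <-> (m <= k < m + n)%N by rewrite h.
by elim: n m => [|n IH] m /=; [|rewrite IH]; split=> //; lia.
Qed.

Lemma eval_nat n : eval (a_nat l n) = n%:R.
Proof. by elim: n => [|n IH]; rewrite ?eval_num0//= rmorph1 IH mulrS. Qed.

Lemma eval_pow a n : eval (a_pow a n) = eval a ^+ n.
Proof. by elim: n => [|n IH]; rewrite ?eval_num1//= IH -exprS. Qed.

Section ClosedFormOf.
Variables (v : seq (aexp l)) (V : nat -> C) (N : nat) (q : {poly C}).
Hypotheses (N0 : (0 < N)%N) (hv : forall n, (n < N + N * N + N)%N -> entry v n = V n)
  (q0 : q != 0) (qN : (size q <= N.+1)%N) (qV : kills q V).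

Let cs := char_poly_coefs v N.
Let chi : {poly C} := Poly (map eval cs).
Let a := solve N (hankel_rows v N).

Let chiE j : chi`_j = if (j < N)%N then - entry a j else (j == N)%:R.
Proof.
have sa : size a = N by rewrite size_solve.
rewrite coef_Poly /cs /char_poly_coefs -/a map_cat nth_cat !size_map sa.
case: ltnP => h; first by rewrite -map_comp (nth_map (ANum 0)) ?sa.
case: eqVneq => [->|jN]; first by rewrite subnn/= rmorph1.
by rewrite nth_default//= subn_gt0; lia.
Qed.

Let size_chi : size chi = N.+1.
Proof.
apply/eqP; rewrite eqn_leq; apply/andP; split.
  by apply/leq_sizeP => j Nj; rewrite chiE ltnNge (ltnW Nj)/= gtn_eqF.
have : chi`_N != 0 by rewrite chiE ltnn eqxx oner_eq0.
by rewrite ltnNge; apply: contra => h; rewrite nth_default.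
Qed.

Let chi_monic : chi \is monic.
Proof. by rewrite monicE lead_coefE size_chi chiE ltnn eqxx. Qed.

Let sat_hankel i x : (i < N)%N ->
  (sat N (v`[i + N] :: [seq v`[i + j] | j <- iota 0 N]) x <->
   V (i + N)%N = \sum_(j < N) V (i + j)%N * x j).
Proof.
move=> iN; rewrite /sat [LHS]/= -[entry (_ :: _) 0]/(entry v (i + N)) hv; last by nia.
rewrite (eq_bigr (fun j : 'I_N => V (i + j)%N * x j)) => [//|j _].
rewrite -[entry (_ :: _) _]/(entry [seq v`[i + j] | j <- iota 0 N] j) entry_map ltn_ord.
by rewrite -/(entry v _) hv//; have := ltn_ord j; nia.
Qed.

(** A monic annihilator of degree [N] solves the Hankel system, so the computed vector satisfies it
    as well. It may be a different solution, but [N] vanishing terms already force an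
    annihilator. *)
Let kills_chi : kills chi V.
Proof.
have [q' [q'm sq' q'V]] := kills_monic q0 qN qV.
apply: (kills_of_init q'm sq' q'V) => i iN.
have pactN (g : {poly C}) : size g = N.+1 -> g`_N = 1 ->
    pact g V i = V (i + N)%N + \sum_(j < N) V (i + j)%N * g`_j.
  move=> sp pN; rewrite (@pactE _ N.+1) ?sp// big_ord_recr/= pN mul1r addrC.
  by congr (_ + _); apply: eq_bigr => j _; rewrite mulrC.
rewrite pactN// ?chiE ?ltnn ?eqxx//.
rewrite (eq_bigr (fun j : 'I_N => - (V (i + j)%N * entry a j))) => [|j _]; last first.
  by rewrite chiE ltn_ord mulrN.
rewrite sumrN; apply/eqP; rewrite subr_eq0; apply/eqP.
have : sat N (v`[i + N] :: [seq v`[i + j] | j <- iota 0 N]) (entry a).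
  apply: (@solveP N N.+1) => //.
  - by move=> _ /List.in_map_iff[k [<- _]]; rewrite /= size_map size_iota.
  - exists (fun j => - q'`_j) => _ /List.in_map_iff[k [<- /in_iota kN]].
    apply/sat_hankel => //; have := q'V k; rewrite (@pactE _ N.+1) ?sq'// big_ord_recr/=.
    have -> : q'`_N = 1 by move/monicP: q'm; rewrite lead_coefE sq'.
    rewrite mul1r => /eqP; rewrite addrC addr_eq0 => /eqP ->; rewrite -sumrN.
    by apply: eq_bigr => j _; rewrite mulrN mulrC.
  - by apply/List.in_map_iff; exists i; split=> //; apply/in_iota.
by move/sat_hankel; apply.
Qed.

Let lam i : C := eval (ARoot cs i).

Let chi_prod : chi = \prod_(z <- sorted_roots chi) ('X - z%:P).
Proof.
rewrite (perm_big _ (permEl (perm_sort _ _)))/=.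
case: (closed_field_poly_normal chi) => rs /= h.
by rewrite [LHS]h (monicP chi_monic) scale1r.
Qed.

Let size_roots : size (sorted_roots chi) = N.
Proof. by have := size_chi; rewrite {1}chi_prod size_prod_XsubC => -[]. Qed.

Let lamE i : lam i = (sorted_roots chi)`_i. Proof. by []. Qed.

Let c := solve (N * N) (closed_rows v N cs).

Let sat_closed n x : (n < N * N)%N ->
  (sat (N * N) (v`[N + n] :: [seq AMul (a_pow (a_nat l (N + n)) d) (a_pow (ARoot cs i) (N + n))
                    | i <- iota 0 N, d <- iota 0 N]) x <->
   V (N + n)%N = \sum_(i < N) \sum_(d < N) ((N + n)%:R ^+ d * lam i ^+ (N + n)) * x (i * N + d)%N).
Proof.
move=> iN; rewrite /sat -[entry (_ :: _) 0]/(entry v (N + n)) hv; last by nia.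
rewrite (sum_allpairs (fun i d => AMul (a_pow (a_nat l (N + n)) d) (a_pow (ARoot cs i) (N + n)))).
by under eq_bigr do under eq_bigr do rewrite /= !eval_pow eval_nat.
Qed.

(** [chi ^+ N], of degree [N * N], annihilates both sides, as the candidate has degrees below [N] at
    each root. So it suffices to compare the [N * N] terms used in the linear system, which is
    solvable by [closed_form_exists]. *)
Let closedE n : (N <= n)%N ->
  V n = \sum_(i < N) \sum_(d < N) (n%:R ^+ d * lam i ^+ n) * entry c (i * N + d)%N.
Proof.
pose E n := \sum_(i < N) \sum_(d < N) (n%:R ^+ d * lam i ^+ n) * entry c (i * N + d)%N.
have cmo : chi ^+ N \is monic by exact: monic_exp.
have csz : size (chi ^+ N) = (N * N).+1.
  have := size_exp chi N; rewrite size_chi/= => h.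
  have : (0 < size (chi ^+ N)%R)%N by rewrite size_poly_gt0 monic_neq0.
  by case: (size (chi ^+ N)%R) h => //= k ->.
have killsE : kills (chi ^+ N) E.
  move=> n0; rewrite /E /=.
  rewrite (@pact_ext _ _ _ (fun n => \sum_(i <- enum 'I_N) \sum_(d <- enum 'I_N)
      (n%:R ^+ d * lam i ^+ n) * entry c (i * N + d)%N)); last first.
    by move=> n1; rewrite big_enum; apply: eq_bigr => i _; rewrite big_enum.
  rewrite pact_sum; apply: big1_seq => i _; rewrite pact_sum; apply: big1_seq => d _.
  have dv : ('X - (lam i)%:P) ^+ N %| chi ^+ N.
    apply: dvdp_exp2r; rewrite chi_prod lamE (big_nth 0) size_roots.
    rewrite big_mkord (bigD1 i)//= dvdp_mulIl//.
  have sf : (size (entry c (i * N + d) *: 'X^d : {poly C}) <= N)%N.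
    by rewrite (leq_trans (size_scale_leq _ _))// size_polyXn ltn_ord.
  rewrite -(kills_dvd dv (kills_pow (lam i) sf) n0); apply: pact_ext => n1.
  by rewrite hornerZ hornerXn; ring.
have shiftK (g : {poly C}) w : kills g w -> kills g (fun k => w (N + k)%N).
  by move=> h i; rewrite -(h (N + i)%N); apply: eq_bigr => j _; rewrite addnA.
have diffK : kills (chi ^+ N) (fun k => V (N + k)%N - E (N + k)%N).
  move=> i; rewrite (@pact_ext _ _ _ (fun k => V (N + k)%N + -1 * E (N + k)%N)).
    rewrite pact_lin (shiftK _ _ killsE) mulr0 addr0.
    by rewrite (shiftK _ V)// -(prednK N0) exprS; apply: kills_mulr.
  by move=> k; rewrite mulN1r.
move=> Nn; apply/eqP; rewrite -subr_eq0 -/(E n) -(subnKC Nn); apply/eqP.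
move: (n - N)%N; apply: (monic_init_zero cmo csz diffK) => k kN; apply/eqP.
rewrite subr_eq0; apply/eqP; apply/(sat_closed (entry c) kN).
apply: (@solveP _ (N * N).+1) => //.
- move=> _ /List.in_map_iff[k' [<- _]]; rewrite /= size_allpairs !size_iota//.
- have [|ps [sps hps]] := @closed_form_exists _ (sorted_roots chi) V.
    by rewrite -chi_prod.
  rewrite size_roots in sps hps.
  exists (fun j => (ps (j %/ N)%N)`_(j %% N)) => _ /List.in_map_iff[k' [<- /in_iota kN']].
  apply/sat_closed => //; rewrite hps ?leq_addr//; apply: eq_bigr => i _.
  rewrite (horner_coef_wide _ (sps i)) mulr_suml; apply: eq_bigr => d _.
  rewrite divnMDl// divn_small ?ltn_ord// addn0 modnMDl modn_small ?ltn_ord//.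
  by rewrite -lamE; ring.
- by apply/List.in_map_iff; exists k; split=> //; apply/in_iota.
Qed.

Lemma closed_form_ofP n : cf_eval theta (closed_form_of v N) n = V n.
Proof.
rewrite /cf_eval /closed_form_of -/cs -/c /= size_map size_iota; case: ltnP => nN.
  by rewrite (nth_map (ANum 0)) ?size_map ?size_iota// (nth_map 0%N) ?size_iota// nth_iota// -/(entry v n) hv//; lia.
rewrite closedE// big_map -{1}[N]subn0 -/(index_iota 0 N) big_mkord; apply: eq_bigr => i _ /=.
rewrite -/(lam i) (@horner_coef_wide _ N); last first.
  by rewrite (leq_trans (size_Poly _))// !size_map size_iota.
rewrite mulr_suml; apply: eq_bigr => d _; rewrite coef_Poly.
rewrite (nth_map (ANum 0)) ?size_map ?size_iota// (nth_map 0%N) ?size_iota// nth_iota//.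
by rewrite -/(entry c _); ring.
Qed.

End ClosedFormOf.
End ClosedForm.

(** * Integration with respect to the kernels of the semantics *)

Local Open Scope ereal_scope.

Lemma ge0_integral_kseq d (T : measurableType d) (R : realType) (k1 k2 : R.-pker T ~> T)
    s (f : T -> \bar R) : (forall z, 0 <= f z) -> measurable_fun [set: T] f ->
  \int[kseq k1 k2 s]_z f z = \int[k1 s]_y \int[k2 y]_z f z.
Proof. exact: (@integral_kcomp _ _ _ T T T R k1 (kernel.kernel_snd k2)). Qed.

Lemma ge0_integral_kdraw d d' (T : measurableType d) (V : measurableType d') (R : realType)
    (mu : probability V R) (g : T * V -> T) (mg : measurable_fun [set: T * V] g) s
    (f : T -> \bar R) : (forall z, 0 <= f z) -> measurable_fun [set: T] f ->
  \int[kdraw mu mg s]_z f z = \int[mu]_v f (g (s, v)).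
Proof.
move=> f0 mf.
have mgs : measurable_fun [set: V] (fun v => g (s, v)).
  by apply: (measurableT_comp mg); exact: pair1_measurable.
pose gs : {mfun V >-> T} := HB.pack (fun v => g (s, v)) (isMeasurableFun.Build _ _ _ _ _ mgs).
rewrite (@eq_measure_integral _ _ _ _ (pushforward mu gs)); last by [].
by rewrite ge0_integral_pushforward.
Qed.

Lemma ge0_integral_kchoice d (T : measurableType d) (R : realType) (ps : seq R)
    (g : nat -> T -> T) (mg : forall i, measurable_fun [set: T] (g i)) s
    (f : T -> \bar R) : (forall z, 0 <= f z) -> measurable_fun [set: T] f ->
  \int[kchoice ps mg s]_z f z =
  \sum_(i < (size ps).+1) (choice_weight ps i)%:E * f (g i s).
Proof.
move=> f0 mf; rewrite /kchoice /choice_measure ge0_integral_measure_sum//.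
apply: eq_bigr => i _; rewrite ge0_integral_mscale//= integral_dirac//.
by rewrite diracT mul1e.
Qed.

Lemma ge0_integral_kif d (T : measurableType d) (R : realType) (k1 k2 : R.-pker T ~> T)
    (b : T -> bool) (mb : measurable_fun [set: T] b) s (f : T -> \bar R) :
  \int[kif k1 k2 mb s]_z f z = if b s then \int[k1 s]_z f z else \int[k2 s]_z f z.
Proof. by rewrite /kif; case: ifP. Qed.

Local Close Scope ereal_scope.

(** * Functions of polynomial growth on the state space *)

Section PolyBound.
Variables (R : realType) (m l : nat).
Local Notation state := (state R m).
Implicit Types (s : state) (f g : state -> R).

(** At least 1, so that its powers increase, and dominating each coordinate, so that multiples of
    its powers bound all polynomials. *)
Definition bnd s : R := 1 + \sum_(y < m) tnth s y ^+ 2.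

(* Measurable functions of polynomial growth. *)
Definition pb f : Prop := measurable_fun [set: state] (f : state -> measurableTypeR R) /\
  exists (C : R) (k : nat), 0 <= C /\ forall s, `|f s| <= C * bnd s ^+ k.

Lemma bnd_ge1 s : 1 <= bnd s.
Proof. by rewrite lerDl sumr_ge0// => y _; rewrite sqr_ge0. Qed.

Lemma bnd_ge0 s : 0 <= bnd s. Proof. by rewrite (le_trans _ (bnd_ge1 s)). Qed.

Lemma bnd_exp_le s k k' : (k <= k')%N -> bnd s ^+ k <= bnd s ^+ k'.
Proof. by move=> kk; apply: ler_weXn2l => //; exact: bnd_ge1. Qed.

Lemma measurable_bnd : measurable_fun [set: state] (bnd : state -> measurableTypeR R).
Proof.
apply: measurable_funD; first exact: measurable_cst.
by apply: measurable_sum => y; apply: measurable_funX; exact: measurable_tnth.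
Qed.

Lemma pb_cst (c : R) : pb (fun=> c).
Proof.
split; first exact: measurable_cst.
by exists `|c|, 0%N; split=> // s; rewrite expr0 mulr1.
Qed.

Lemma pb_bnd (C : R) k : pb (fun s => C * bnd s ^+ k).
Proof.
split.
  apply: measurable_funM; first exact: measurable_cst.
  by apply: measurable_funX; exact: measurable_bnd.
by exists `|C|, k; split=> // s; rewrite normrM (ger0_norm (exprn_ge0 _ (bnd_ge0 s))).
Qed.

Lemma pb_tnth y : pb (fun s => tnth s y).
Proof.
split; first exact: measurable_tnth.
exists 1, 1%N; split=> // s; rewrite expr1 mul1r.
have h : tnth s y ^+ 2 + 1 <= bnd s.
  by rewrite addrC lerD2l (bigD1 y)//= lerDl sumr_ge0// => z _; rewrite sqr_ge0.
apply: le_trans h; rewrite -real_normK ?num_real//.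
have := sqr_ge0 (`|tnth s y| - 1); have := normr_ge0 (tnth s y); nra.
Qed.

Lemma pbD f g : pb f -> pb g -> pb (fun s => f s + g s).
Proof.
move=> [mf [C [k [C0 hf]]]] [mg [C' [k' [C'0 hg]]]]; split; first exact: measurable_funD.
exists (C + C'), (maxn k k'); split=> [|s]; first exact: addr_ge0.
rewrite (le_trans (ler_normD _ _))// mulrDl lerD//.
  by rewrite (le_trans (hf s))// ler_wpM2l// bnd_exp_le// leq_maxl.
by rewrite (le_trans (hg s))// ler_wpM2l// bnd_exp_le// leq_maxr.
Qed.

Lemma pbM f g : pb f -> pb g -> pb (fun s => f s * g s).
Proof.
move=> [mf [C [k [C0 hf]]]] [mg [C' [k' [C'0 hg]]]]; split; first exact: measurable_funM.
exists (C * C'), (k + k')%N; split=> [|s]; first exact: mulr_ge0.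
by rewrite normrM exprD mulrACA ler_pM.
Qed.

Lemma pb_abs f : pb f -> pb (fun s => `|f s|).
Proof.
move=> [mf [C [k [C0 hf]]]]; split; first exact: (measurableT_comp (@normr_measurable R setT) mf).
by exists C, k; split=> // s; rewrite normr_id.
Qed.

Lemma pb_sum (I : Type) (r : seq I) (f : I -> state -> R) :
  (forall i, pb (f i)) -> pb (fun s => \sum_(i <- r) f i s).
Proof.
move=> h; elim: r => [|i r IH].
  by under eq_fun do rewrite big_nil; exact: pb_cst.
by under eq_fun do rewrite big_cons; exact: pbD.
Qed.

Lemma pb_prod (I : Type) (r : seq I) (f : I -> state -> R) :
  (forall i, pb (f i)) -> pb (fun s => \prod_(i <- r) f i s).
Proof.
move=> h; elim: r => [|i r IH].
  by under eq_fun do rewrite big_nil; exact: pb_cst.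
by under eq_fun do rewrite big_cons; exact: pbM.
Qed.

Lemma pbX f k : pb f -> pb (fun s => f s ^+ k).
Proof.
move=> h; elim: k => [|k IH].
  by under eq_fun do rewrite expr0; exact: pb_cst.
by under eq_fun do rewrite exprS; exact: pbM.
Qed.

Lemma pb_poly_eval (theta : 'I_l -> R) (q : Defs.polynomial m l) : pb (poly_eval theta q).
Proof.
apply: pb_sum => a; apply: pbM; first exact: pb_cst.
by apply: pb_prod => y; exact: pb_tnth.
Qed.

(** The bound is a product of a function of the state and one of the new value, so integrating over
    a draw leaves a bound of the same kind. *)
Lemma bnd_update s x v : bnd (update s x v) <= bnd s * (1 + v ^+ 2).
Proof.
apply: (@le_trans _ _ (bnd s + v ^+ 2)); last first.
  rewrite mulrDr mulr1 lerD2l ler_peMl ?sqr_ge0// bnd_ge1//.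
rewrite /bnd -addrA lerD2l (bigD1 x)//= [X in _ <= X + _](bigD1 x)//=.
rewrite tnth_mktuple eqxx (eq_bigr (fun y => tnth s y ^+ 2)) => [|y yx].
  have := sqr_ge0 (tnth s x); lra.
by rewrite tnth_mktuple (negbTE yx).
Qed.

Lemma pb_comp_update f x g : pb f -> pb g -> pb (fun s => f (update s x (g s))).
Proof.
move=> [mf [C [k [C0 hf]]]] [mg hg]; split.
  apply: (measurableT_comp mf).
  have mp : measurable_fun [set: state] (fun s => (s, g s) : state * measurableTypeR R).
    by apply: measurable_fun_pair => //; exact: measurable_id.
  exact: (measurableT_comp (measurable_update x) mp).
have [_ [C' [k' [C'0 h']]]] : pb (fun s => C * (bnd s * (1 + g s * g s)) ^+ k).
  apply: pbM; first exact: pb_cst.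
  apply: pbX; apply: pbM; last by apply: pbD; [exact: pb_cst|exact: pbM].
  by have := pb_bnd 1 1; under eq_fun do rewrite mul1r expr1.
exists C', k'; split=> // s; apply: (le_trans (hf _)).
apply: le_trans (h' s); rewrite ger0_norm; last first.
  by rewrite mulr_ge0// exprn_ge0// mulr_ge0 ?bnd_ge0// -expr2 addr_ge0// sqr_ge0.
rewrite ler_wpM2l// lerXn2r ?nnegrE ?bnd_ge0//.
  by rewrite mulr_ge0 ?bnd_ge0// -expr2 addr_ge0// sqr_ge0.
by rewrite -expr2 bnd_update.
Qed.

(** Integrals against the kernels are computed for nonnegative functions first and extended by
    subtraction. *)
Lemma pb_split f : pb f -> exists f1 f2, [/\ pb f1, pb f2, forall s, 0 <= f1 s,
  forall s, 0 <= f2 s & f = fun s => f1 s - f2 s].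
Proof.
move=> hf; exists (fun s => 2^-1 * (`|f s| + f s)), (fun s => 2^-1 * (`|f s| + -1 * f s)); split.
- by apply: pbM; [exact: pb_cst|apply: pbD => //; exact: pb_abs].
- apply: pbM; [exact: pb_cst|apply: pbD; first exact: pb_abs].
  by apply: pbM => //; exact: pb_cst.
- by move=> s; rewrite mulr_ge0// -lerBlDr sub0r -normrN ler_norm.
- by move=> s; rewrite mulr_ge0// mulN1r subr_ge0 ler_norm.
- by apply/funext => s; field.
Qed.

End PolyBound.

(** * Expectations after the execution of a statement *)

Section ExecIntegral.
Variables (R : realType) (D : distributions R) (m l : nat) (theta : 'I_l -> R).
Local Notation state := (state R m).
Local Notation exec := (exec D theta).
Implicit Types (s : state) (f g : state -> R) (c : stmt m l).

Lemma measurable_EFin f : measurable_fun [set: state] (f : state -> measurableTypeR R) ->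
  measurable_fun [set: state] (fun s => (f s)%:E).
Proof. by move=> mf; apply/measurable_EFinP. Qed.

Lemma measurable_absE f : pb f -> measurable_fun [set: state] (fun s => (`|f s|)%:E).
Proof. by move=> hf; apply: measurable_EFin; exact: (pb_abs hf).1. Qed.

Lemma draw_growth d (args : seq R) k : dist_dom D d args ->
  exists M : R, 0 <= M /\ (\int[dist_law D d args]_v ((1 + v ^+ 2) ^+ k)%R%:E = M%:E)%E.
Proof.
move=> dom; set nu := dist_law D d args.
have intX j : nu.-integrable [set: measurableTypeR R] (fun v => (v ^+ j)%:E).
  by have [h _ _] := dist_momentP j dom.
have int : nu.-integrable [set: measurableTypeR R] (fun v : measurableTypeR R => ((1 + v ^+ 2) ^+ k)%R%:E).
  rewrite [X in integrable _ _ X](_ : _ = fun v : measurableTypeR R => (\sum_(i < k.+1) ('C(k, i)%:R%:E * (v ^+ (2 * i))%R%:E))%E).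
    by apply: integrable_sum => // i _; apply: integrableZl.
  apply/funext => v; rewrite exprDn -sumEFin; apply: eq_bigr => i _.
  by rewrite expr1n mul1r -exprM -EFinM mulr_natl.
have fn := integrable_fin_num measurableT int.
exists (fine (\int[nu]_v ((1 + v ^+ 2) ^+ k)%R%:E)%E); rewrite fineK//; split=> //.
apply: fine_ge0; apply: integral_ge0 => v _; rewrite lee_fin exprn_ge0//.
by rewrite addr_ge0// sqr_ge0.
Qed.

(** Integrability alone would not pass through a sequence, whose inner integral has to be integrable
    again; polynomial growth does. *)
Lemma exec_growth c : stmt_valid D theta c -> forall f, pb f ->
  exists (C : R) (k : nat), 0 <= C /\
  forall s, (\int[exec c s]_s' (`|f s'|)%:E <= (C * bnd s ^+ k)%R%:E)%E.
Proof.
have abs0 f (s : state) : (0 <= (`|f s|)%:E)%E by rewrite lee_fin.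
elim: c => [|x [d args|alts]|c1 IH1 c2 IH2|b c1 IH1 c2 IH2] /=.
- move=> _ f hf; have [mf [C [k [C0 hk]]]] := hf; exists C, k; split=> // s.
  rewrite /kdirac integral_dirac//; last exact: measurable_absE.
  by rewrite diracT mul1e lee_fin.
- move=> [_ dom] f hf; have [mf [C [k [C0 hk]]]] := hf.
  have [M [M0 hM]] := draw_growth k dom.
  exists (C * M), k; split=> [|s]; first exact: mulr_ge0.
  rewrite ge0_integral_kdraw//; last exact: measurable_absE.
  apply: (@le_trans _ _ (\int[dist_law D d (map (const_eval theta) args)]_v
     ((C * bnd s ^+ k)%R%:E * ((1 + v ^+ 2) ^+ k)%R%:E))%E).
    apply: ge0_le_integral => //.
    - apply: (measurableT_comp (measurable_absE hf)).
      by apply: (measurableT_comp (measurable_update x)); exact: pair1_measurable.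
    - apply: measurable_funeM; apply/measurable_EFinP; apply: measurable_funX.
      apply: measurable_funD; first exact: measurable_cst.
      by apply: measurable_funX; exact: measurable_id.
    - move=> v _; rewrite -EFinM lee_fin (le_trans (hk _))// -mulrA ler_wpM2l//.
      rewrite -exprMn lerXn2r ?nnegrE ?bnd_ge0//.
        by rewrite mulr_ge0 ?bnd_ge0// addr_ge0// sqr_ge0.
      exact: bnd_update.
  rewrite ge0_integralZl//; last 3 first.
  - apply/measurable_EFinP; apply: measurable_funX.
    apply: measurable_funD; first exact: measurable_cst.
    by apply: measurable_funX; exact: measurable_id.
  - by move=> v _; rewrite lee_fin exprn_ge0// addr_ge0// sqr_ge0.
  - by rewrite lee_fin mulr_ge0// exprn_ge0// bnd_ge0.
  by rewrite hM -EFinM lee_fin mulrAC.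
- move=> _ f hf; set ps := [seq _ | _ <- _].
  have [_ [C [k [C0 hk]]]] : pb (fun s => \sum_(i <- index_enum 'I_(size ps).+1)
      choice_weight ps i * `|f (alternative theta x alts i s)|).
    apply: pb_sum => i; apply: pbM; first exact: pb_cst.
    apply: pb_abs; apply: (pb_comp_update (f := f)) => //; exact: pb_poly_eval.
  exists C, k; split=> // s; rewrite ge0_integral_kchoice//; last exact: measurable_absE.
  under eq_bigr do rewrite -EFinM.
  rewrite sumEFin lee_fin (le_trans _ (hk s))// ?ler_norm//.
  exact: measurable_alternative.
- move=> [v1 v2] f hf; have [C2 [k2 [C20 h2]]] := IH2 v2 f hf.
  have [C1 [k1 [C10 h1]]] := IH1 v1 _ (pb_bnd m C2 k2).
  exists C1, k1; split=> // s; rewrite ge0_integral_kseq//; last exact: measurable_absE.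
  apply: le_trans (h1 s); apply: ge0_le_integral => //.
  - by move=> y _; apply: integral_ge0.
  - apply: measurable_fun_integral_kernel => //; last exact: measurable_absE.
    exact: measurable_kernel.
  - by apply: measurable_absE; exact: pb_bnd.
  - by move=> y _; rewrite (le_trans (h2 y))// lee_fin ler_norm.
- move=> [_ v1 v2] f hf; have [C2 [k2 [C20 h2]]] := IH2 v2 f hf.
  have [C1 [k1 [C10 h1]]] := IH1 v1 f hf.
  exists (C1 + C2), (maxn k1 k2); split=> [|s]; first exact: addr_ge0.
  rewrite ge0_integral_kif mulrDl EFinD; case: ifP => _.
    rewrite (le_trans (h1 s))// -EFinD lee_fin ler_wpDr ?mulr_ge0 ?exprn_ge0 ?bnd_ge0//.
    by rewrite ler_wpM2l// bnd_exp_le// leq_maxl.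
  rewrite (le_trans (h2 s))// -EFinD lee_fin ler_wpDl ?mulr_ge0 ?exprn_ge0 ?bnd_ge0//.
  by rewrite ler_wpM2l// bnd_exp_le// leq_maxr.
Qed.


Lemma exec_integrable c s f : stmt_valid D theta c -> pb f ->
  (exec c s : {measure set state -> \bar R}).-integrable [set: state] (EFin \o f).
Proof.
move=> vc hf; apply/integrableP; split; first exact: measurable_EFin hf.1.
have [C [k [C0 h]]] := exec_growth vc hf.
by apply: le_lt_trans (h s) _; rewrite ltry.
Qed.

Definition Ex c f s : R := \int[exec c s]_s' f s'.

Lemma ExE c f s : stmt_valid D theta c -> pb f ->
  (\int[exec c s]_s' (f s')%:E = (Ex c f s)%:E)%E.
Proof.
by move=> vc hf; rewrite /Ex /Rintegral fineK//; apply: integrable_fin_num => //; exact: exec_integrable.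
Qed.

Lemma ExB c f g s : stmt_valid D theta c -> pb f -> pb g ->
  Ex c (fun s => f s - g s) s = Ex c f s - Ex c g s.
Proof. by move=> vc hf hg; apply: RintegralB => //; exact: exec_integrable. Qed.

Lemma ExD c f g s : stmt_valid D theta c -> pb f -> pb g ->
  Ex c (fun s => f s + g s) s = Ex c f s + Ex c g s.
Proof. by move=> vc hf hg; apply: RintegralD => //; exact: exec_integrable. Qed.

Lemma ExZ c (r : R) f s : stmt_valid D theta c -> pb f ->
  Ex c (fun s => r * f s) s = r * Ex c f s.
Proof. by move=> vc hf; apply: RintegralZl => //; exact: exec_integrable. Qed.

Lemma Ex_sum c (I : Type) (r : seq I) (f : I -> state -> R) s : stmt_valid D theta c ->
  (forall i, pb (f i)) -> Ex c (fun s => \sum_(i <- r) f i s) s = \sum_(i <- r) Ex c (f i) s.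
Proof.
move=> vc hf; elim: r => [|i r IH].
  under [in LHS]eq_fun do rewrite big_nil; rewrite big_nil.
  transitivity (Ex c (fun=> 0 * 0) s); last by rewrite ExZ ?mul0r//; exact: pb_cst.
  by congr Ex; apply/funext => x; rewrite mul0r.
under [in LHS]eq_fun do rewrite big_cons.
by rewrite big_cons -IH ExD//; exact: pb_sum.
Qed.

Lemma pb_Ex c f : stmt_valid D theta c -> pb f -> pb (Ex c f).
Proof.
move=> vc hf; split.
  have [f1 [f2 [p1 p2 f10 f20 ->]]] := pb_split hf.
  have mE g : pb g -> (forall s, 0 <= g s) -> measurable_fun [set: state] (Ex c g : state -> measurableTypeR R).
    move=> pg g0; apply/measurable_EFinP.
    rewrite (_ : _ \o _ = fun s => (\int[exec c s]_s' (g s')%:E)%E); last first.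
      by apply/funext => s; rewrite ExE.
    apply: measurable_fun_integral_kernel => //; first exact: measurable_kernel.
    exact: measurable_EFin pg.1.
  rewrite (_ : Ex c _ = fun s => Ex c f1 s - Ex c f2 s); last first.
    by apply/funext => s; rewrite ExB.
  by apply: measurable_funB; exact: mE.
have [C [k [C0 h]]] := exec_growth vc hf.
exists C, k; split=> // s; rewrite -lee_fin; apply: le_trans (h s).
by rewrite /Ex EFin_normr_Rintegral//; [exact: le_abse_integral (measurable_EFin hf.1)|exact: exec_integrable].
Qed.

Lemma Ex_skip f s : pb f -> Ex (@SSkip m l) f s = f s.
Proof.
move=> hf; rewrite /Ex /Rintegral /= /kdirac integral_dirac//; last exact: measurable_EFin hf.1.
by rewrite diracT mul1e.
Qed.

Lemma Ex_seq c1 c2 f s : stmt_valid D theta c1 -> stmt_valid D theta c2 -> pb f ->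
  Ex (SSeq c1 c2) f s = Ex c1 (Ex c2 f) s.
Proof.
move=> v1 v2 hf; have vc : stmt_valid D theta (SSeq c1 c2) by [].
have E g : pb g -> (forall s, 0 <= g s) -> Ex (SSeq c1 c2) g s = Ex c1 (Ex c2 g) s.
  move=> pg g0; apply: EFin_inj; rewrite -ExE// -ExE//; last exact: pb_Ex.
  rewrite /= ge0_integral_kseq//; last exact: measurable_EFin pg.1.
  by apply: eq_integral => y _; rewrite ExE.
have [f1 [f2 [p1 p2 f10 f20 ->]]] := pb_split hf.
rewrite ExB// !E// -ExB//; try exact: pb_Ex.
by congr Ex; apply/funext => y; rewrite ExB.
Qed.

Lemma Ex_if b c1 c2 f s :
  Ex (SIf b c1 c2) f s = if cond_holds theta b s then Ex c1 f s else Ex c2 f s.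
Proof. by rewrite /Ex /= /kif; case: ifP. Qed.

Lemma Ex_choice x alts f s : pb f -> is_distr [seq const_eval theta a.2 | a <- alts] ->
  Ex (SAssign x (RChoice alts)) f s =
  \sum_(a <- alts) const_eval theta a.2 * f (update s x (poly_eval theta a.1 s)).
Proof.
move=> hf hd; set ps := [seq const_eval theta a.2 | a <- alts] in hd *.
have E g : pb g -> (forall s, 0 <= g s) -> Ex (SAssign x (RChoice alts)) g s =
    \sum_(i < (size ps).+1) choice_weight ps i * g (alternative theta x alts i s).
  move=> pg g0; rewrite /Ex /Rintegral /= ge0_integral_kchoice//; last exact: measurable_EFin pg.1.
    by under [in LHS]eq_bigr do rewrite -EFinM; rewrite sumEFin.
  exact: measurable_alternative.
have E2 g : \sum_(i < (size ps).+1) choice_weight ps i * g (alternative theta x alts i s) =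
  \sum_(a <- alts) const_eval theta a.2 * g (update s x (poly_eval theta a.1 s)).
  rewrite big_ord_recr/= {2}/choice_weight hd nth_default// mul0r addr0.
  rewrite (big_nth ([::], KNum 0)) big_mkord size_map; apply: eq_bigr => i _.
  by rewrite /choice_weight hd /alternative !(nth_map ([::], KNum 0)).
have [f1 [f2 [p1 p2 f10 f20 ->]]] := pb_split hf.
have int g : pb g -> (exec (SAssign x (RChoice alts)) s : {measure set state -> \bar R}).-integrable
    [set: state] (EFin \o g).
  move=> pg; apply/integrableP; split; first exact: measurable_EFin pg.1.
  rewrite /= ge0_integral_kchoice//; last exact: measurable_absE.
    by under eq_bigr do rewrite -EFinM; rewrite sumEFin ltry.
  exact: measurable_alternative.
rewrite {1}/Ex RintegralB//; [|exact: int|exact: int].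
rewrite -!/(Ex _ _ _) !E// !E2 -sumrB; apply: eq_bigr => a _; by rewrite mulrBr.
Qed.

Lemma Ex_draw x d args f s : pb f -> dist_dom D d (map (const_eval theta) args) ->
  Ex (SAssign x (RDraw m d args)) f s =
  \int[dist_law D d (map (const_eval theta) args)]_v f (update s x v).
Proof.
move=> hf dom; set nu := dist_law D d _.
have mu : measurable_fun [set: measurableTypeR R] (fun v : measurableTypeR R => update s x v).
  exact: (measurableT_comp (measurable_update x) (pair1_measurable s)).
have int g : pb g -> nu.-integrable [set: measurableTypeR R] (fun v => (g (update s x v))%:E).
  move=> pg; apply/integrableP; split.
    by apply: (measurableT_comp (measurable_EFin pg.1)).
  have [C [k [C0 h]]] := pg.2; have [M [M0 hM]] := draw_growth k dom.
  apply: (@le_lt_trans _ _ (C * bnd s ^+ k * M)%R%:E); last exact: ltry.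
  have mp : measurable_fun [set: measurableTypeR R] (fun v : measurableTypeR R => ((1 + v ^+ 2) ^+ k)%R%:E).
    apply/measurable_EFinP; apply: measurable_funX.
    apply: measurable_funD; first exact: measurable_cst.
    by apply: measurable_funX; exact: measurable_id.
  have p0 (v : R) : 0 <= (1 + v ^+ 2) ^+ k by rewrite exprn_ge0// addr_ge0// sqr_ge0.
  rewrite EFinM -hM -ge0_integralZl//; last 2 first.
  - by move=> v _; rewrite lee_fin.
  - by rewrite lee_fin mulr_ge0// exprn_ge0// bnd_ge0.
  apply: ge0_le_integral => //.
  - by apply: (measurableT_comp (measurable_absE pg)).
  - exact: measurable_funeM.
  - move=> v _; rewrite -EFinM lee_fin (le_trans (h _))// -mulrA ler_wpM2l//.
    rewrite -exprMn lerXn2r ?nnegrE ?bnd_ge0//; last exact: bnd_update.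
    by rewrite mulr_ge0 ?bnd_ge0// addr_ge0// sqr_ge0.
have vc g : pb g -> (exec (SAssign x (RDraw m d args)) s : {measure set state -> \bar R}).-integrable
    [set: state] (EFin \o g).
  move=> pg; apply/integrableP; split; first exact: measurable_EFin pg.1.
  rewrite /= ge0_integral_kdraw//; last exact: measurable_absE.
  by have /integrableP[] := int _ pg.
have [f1 [f2 [p1 p2 f10 f20 ->]]] := pb_split hf.
rewrite {1}/Ex RintegralB//; [|exact: vc|exact: vc].
rewrite RintegralB//; [|exact: int|exact: int].
have E g : pb g -> (forall s, 0 <= g s) -> \int[exec (SAssign x (RDraw m d args)) s]_z g z = \int[nu]_v g (update s x v).
  move=> pg g0; rewrite /Rintegral /= ge0_integral_kdraw//; exact: measurable_EFin pg.1.
by rewrite !E.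
Qed.

End ExecIntegral.

(** * Semantics of the weakest preconditions *)

(* Coefficients as functions of the parameter [p]; whether an inverse is that of
   zero is decided at the value [t0] of interest. *)
Definition fun_ops (R : realType) (t0 : R) : ops (R -> R) := {|
  onum q := fun=> ratr q;
  oadd u v := fun t => u t + v t;
  omul u v := fun t => u t * v t;
  oinv u := fun t => if u t0 == 0 then 0 else (u t)^-1 |}.

Lemma const_valE (R : realType) (t0 : R) (V : Type) (sym : V -> R -> R) (c : const V) :
  const_defined (sym^~ t0) c ->
  forall t, const_val (fun_ops t0) sym c t = const_eval (sym^~ t) c.
Proof.
rewrite /const_val; elim: c => //= [c1 IH1 c2 IH2 /andP[/IH1 h1 /IH2 h2] t|c IH /IH h t
    |c1 IH1 c2 IH2 /andP[/IH1 h1 /IH2 h2] t|c IH /andP[/IH h c0] t].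
- by rewrite h1 h2.
- by rewrite h rmorphN rmorph1 mulN1r.
- by rewrite h1 h2.
- by rewrite !h (negbTE c0).
Qed.

Section Ev.
Variables (R : realType) (m : nat) (t0 t : R).
Local Notation O := (fun_ops t0).
Local Notation poly := (lpoly (R -> R) m).
Local Notation state := (state R m).
Implicit Types (q r : poly) (s : state).

Definition ev q s : R := \sum_(a <- q) a.1 t * \prod_(y <- a.2) tnth s y.

Lemma ev_cat q r s : ev (q ++ r) s = ev q s + ev r s.
Proof. exact: big_cat. Qed.

Lemma ev_flatten (qs : seq poly) s : ev (flatten qs) s = \sum_(q <- qs) ev q s.
Proof.
elim: qs => [|q qs IH]; first by rewrite /ev !big_nil.
by rewrite /= ev_cat IH big_cons.
Qed.

Lemma ev_scale c q s : ev (pscale O c q) s = c t * ev q s.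
Proof. by rewrite /ev big_map mulr_sumr; apply: eq_bigr => a _ /=; rewrite mulrA. Qed.

Lemma ev_mul q r s : ev (pmul O q r) s = ev q s * ev r s.
Proof.
rewrite /pmul ev_flatten big_map /ev mulr_suml; apply: eq_bigr => a _.
rewrite big_map mulr_sumr; apply: eq_bigr => b _ /=.
by rewrite big_cat/= mulrACA.
Qed.

Lemma ev_cst c s : ev (pcst m c) s = c t.
Proof. by rewrite /ev big_seq1 big_nil mulr1. Qed.

Lemma ev_one s : ev (pone O m) s = 1.
Proof. by rewrite ev_cst /= rmorph1. Qed.

Lemma ev_var y s : ev (pvar O y) s = tnth s y.
Proof. by rewrite /ev !big_seq1 /= rmorph1 mul1r. Qed.

Lemma ev_compl q s : ev (pcompl O q) s = 1 - ev q s.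
Proof. by rewrite ev_cat ev_one ev_scale /= rmorphN rmorph1 mulN1r. Qed.

Lemma ev_prod (qs : seq poly) s : ev (pprod O qs) s = \prod_(q <- qs) ev q s.
Proof.
elim: qs => [|q qs IH]; first by rewrite big_nil ev_one.
by rewrite /= ev_mul IH big_cons.
Qed.

Lemma ev_subst x r q s : ev (psubst O x r q) s = ev q (update s x (ev r s)).
Proof.
rewrite ev_flatten big_map /ev; apply: eq_bigr => a _; rewrite -/(ev _ s) ev_scale ev_prod.
rewrite big_map; congr (_ * _); apply: eq_bigr => y _; rewrite tnth_mktuple.
rewrite -val_eqE; case: ifP => _ //; exact: ev_var.
Qed.

Lemma pb_ev q : pb (ev q).
Proof.
apply: pb_sum => a; apply: pbM; first exact: pb_cst.
by apply: pb_prod => y; exact: pb_tnth.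
Qed.

Definition cofactor_of (x : 'I_m) (a : (R -> R) * seq 'I_m) s : R :=
  a.1 t * \prod_(y <- a.2 | y != x) tnth s y.

Definition deg_in (x : 'I_m) (a : (R -> R) * seq 'I_m) : nat :=
  size [seq y : 'I_m <- a.2 | y == x :> nat].

(** Isolates the powers of [x], which a draw replaces by moments. *)
Lemma ev_update x q s v :
  ev q (update s x v) = \sum_(a <- q) cofactor_of x a s * v ^+ deg_in x a.
Proof.
apply: eq_bigr => a _; rewrite /cofactor_of -mulrA; congr (_ * _).
rewrite (bigID (fun y => y != x))/=; congr (_ * _).
  by apply: eq_bigr => y /negbTE yx; rewrite tnth_mktuple yx.
under eq_bigl do rewrite negbK.
rewrite (eq_bigr (fun=> v)) => [|y /eqP ->]; last by rewrite tnth_mktuple eqxx.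
by rewrite big_const_seq iter_mulr_1 /deg_in size_filter.
Qed.

Lemma ev_draw x (mu : nat -> R -> R) q s :
  ev (pdraw O x mu q) s = \sum_(a <- q) cofactor_of x a s * mu (deg_in x a) t.
Proof.
rewrite /ev big_map; apply: eq_bigr => a _ /=; rewrite /cofactor_of mulrAC; congr (_ * _ * _).
rewrite big_filter; apply: eq_bigl => y; rewrite val_eqE; by case: eqP.
Qed.

End Ev.

Lemma eq_sum_all (V : nmodType) (T : Type) (P : pred T) (r : seq T) (f g : T -> V) :
  all P r -> (forall a, P a -> f a = g a) -> \sum_(a <- r) f a = \sum_(a <- r) g a.
Proof.
move=> + fg; elim: r => [|a r IH] /=; first by rewrite !big_nil.
by move=> /andP[/fg h /IH]; rewrite !big_cons h => ->.
Qed.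

Section WpCorrect.
Variables (R : realType) (D : distributions R) (m l : nat) (theta : 'I_l -> R) (p : 'I_l) (t : R).
Variables (G : seq (seq (R -> R))) (F : m.-tuple (seq (const 'I_l)))
  (tr : cond m l -> seq (R -> R) -> R -> R).
Local Notation t0 := (theta p).
Local Notation O := (fun_ops t0).
Local Notation th := (set_param theta p t).
Local Notation state := (state R m).
Local Notation poly := (lpoly (R -> R) m).

Definition fun_sym (q : 'I_l) (u : R) : R := set_param theta p u q.
Local Notation wp := (wp O fun_sym (dist_moment D) tr G).

Lemma fun_sym0 : fun_sym^~ t0 = theta.
Proof. by apply/funext => q; rewrite /fun_sym /set_param; case: eqP => [->|]. Qed.

Lemma ev_kpoly (q : Defs.polynomial m l) s : poly_defined theta q ->
  ev t (kpoly O fun_sym q) s = poly_eval th q s.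
Proof.
move=> h; rewrite /ev big_map /poly_eval; apply: (eq_sum_all h) => a ha /=.
by rewrite const_valE ?fun_sym0.
Qed.

Lemma draw_momentE d (args : seq (const 'I_l)) j : all (const_defined theta) args ->
  dist_dom D d (map (const_eval theta) args) ->
  draw_moment O fun_sym (dist_moment D) d args j t =
  const_eval (nth 0 (map (const_eval th) args)) (dist_moment D d j).
Proof.
move=> /(all_nthP (KNum 0)) ha dom.
have e i u : nth (onum O 0) [seq const_val O fun_sym c | c <- args] i u =
    nth 0 [seq const_eval (fun_sym^~ u) c | c <- args] i.
  have [h|h] := ltnP i (size args); last by rewrite !nth_default ?size_map//= rmorph0.
  rewrite !(nth_map (KNum 0))// const_valE// fun_sym0; exact: ha.
rewrite /draw_moment const_valE; last first.
  have [_ h _] := dist_momentP j dom.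
  by congr (is_true (const_defined _ _)): h; apply/funext => i; rewrite e fun_sym0.
by congr const_eval; apply/funext => i; rewrite e.
Qed.

Definition indicator_exact (b : cond m l) : Prop := forall s,
  (forall y, y \in cond_vars b -> in_range F th y (tnth s y)) ->
  ev t (indicator O tr G b) s = (cond_holds th b s)%:R.

Lemma ev_wp_if b (q r : poly) s : indicator_exact b ->
  (forall y, y \in cond_vars b -> in_range F th y (tnth s y)) ->
  ev t (wp_if O tr G b q r) s = if cond_holds th b s then ev t q s else ev t r s.
Proof.
move=> hb hs; rewrite ev_cat !ev_mul ev_compl hb//.
by case: ifP => _; rewrite ?subrr ?subr0 !(mul1r, mul0r) ?addr0 ?add0r.
Qed.

Lemma ev_wp_choice x alts (q : poly) s :
  all (fun a => poly_defined theta a.1 && const_defined theta a.2) alts ->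
  ev t (wp_choice O fun_sym x alts q) s =
  \sum_(a <- alts) const_eval th a.2 * ev t q (update s x (poly_eval th a.1 s)).
Proof.
move=> h; rewrite ev_flatten big_map; apply: (eq_sum_all h) => a /andP[h1 h2] /=.
by rewrite ev_scale ev_subst ev_kpoly// const_valE// fun_sym0.
Qed.

Lemma Ex_ae c f g s : stmt_valid D th c -> pb f -> pb g ->
  {ae (exec D th c s : {measure set state -> \bar R}), forall s', f s' = g s'} ->
  Ex D th c f s = Ex D th c g s.
Proof.
move=> vc hf hg h; rewrite /Ex /Rintegral; congr fine; apply: ae_eq_integral => //.
- exact: measurable_EFin hf.1.
- exact: measurable_EFin hg.1.
- by apply: filterS h => s' e _; rewrite e.
Qed.

(** The polynomial has the intended value only where branching variables are in range. After the
    first part of a sequence this is known almost surely, hence the use of [Ex_ae]. *)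
Lemma Ex_wp c (q : poly) s : stmt_valid D theta c -> stmt_valid D th c ->
  (forall b, List.In b (stmt_conds c) -> indicator_exact b) ->
  branches_in_range D F th c s -> Ex D th c (ev t q) s = ev t (wp c q) s.
Proof.
elim: c q s => [|x [d args|alts]|c1 IH1 c2 IH2|b c1 IH1 c2 IH2] q s /=.
- by move=> *; rewrite Ex_skip//; exact: pb_ev.
- move=> [ha dom] [_ dom'] _ _; rewrite Ex_draw//; last exact: pb_ev.
  set nu := dist_law D d _.
  have intX j : nu.-integrable [set: measurableTypeR R] (fun v => (v ^+ j)%:E).
    by have [h _ _] := dist_momentP j dom'.
  transitivity (\int[nu]_v (\sum_(a <- q) cofactor_of t x a s * v ^+ deg_in x a)).
    by apply: eq_Rintegral => v _; rewrite ev_update.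
  rewrite ev_draw; elim: q => [|a q IH].
    rewrite big_nil; under eq_Rintegral do rewrite big_nil.
    by rewrite Rintegral_cst// mul0r.
  rewrite big_cons; under eq_Rintegral do rewrite big_cons.
  have intM a' : nu.-integrable [set: measurableTypeR R]
      (fun v => (cofactor_of t x a' s * v ^+ deg_in x a')%:E).
    by under eq_fun do rewrite EFinM; apply: integrableZl.
  rewrite RintegralD//; last 2 first.
  - exact: intM.
  - rewrite (_ : _ \o _ = fun v => (\sum_(a <- q) (cofactor_of t x a s * v ^+ deg_in x a)%:E)%E).
      exact: integrable_sum.
    by apply/funext => v /=; rewrite sumEFin.
  congr (_ + _); last exact: IH.
  rewrite RintegralZl//; last exact: intX.
  congr (_ * _).
  by have [_ _ ->] := dist_momentP (deg_in x a) dom'; rewrite draw_momentE.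
- move=> [ha _] [_ hd] _ _; rewrite Ex_choice//; last exact: pb_ev.
  by rewrite /wp /wp_assign /= ev_wp_choice.
- move=> [v1 v2] [v1' v2'] hc [b1 b2]; rewrite Ex_seq//; last exact: pb_ev.
  rewrite -(IH1 _ s v1 v1')//; last first.
    by move=> b hb; apply: hc; apply/List.in_app_iff; left.
  apply: Ex_ae => //; [apply: pb_Ex => //; exact: pb_ev|exact: pb_ev|].
  apply: filterS b2 => s' hs'; apply: IH2 => // b hb.
  by apply: hc; apply/List.in_app_iff; right.
- move=> [_ v1 v2] [_ v1' v2'] hc [hr br]; rewrite Ex_if ev_wp_if//; last by apply: hc; left.
  case: ifP br => _ br.
    by apply: IH1 => // b' hb'; apply: hc; right; apply/List.in_app_iff; left.
  by apply: IH2 => // b' hb'; apply: hc; right; apply/List.in_app_iff; right.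
Qed.

End WpCorrect.

(** * Exactness of the indicators of the branching conditions *)

Section ListProd.
Variables (R : comPzRingType) (T : Type).
Implicit Types (r : seq T) (f : T -> R).

Lemma prod_list0 r f a : List.In a r -> f a = 0 -> \prod_(b <- r) f b = 0.
Proof.
move=> + fa; elim: r => //= b r IH [->|/IH h]; rewrite big_cons; first by rewrite fa mul0r.
by rewrite h mulr0.
Qed.

Lemma prod_list1 r f : (forall a, List.In a r -> f a = 1) -> \prod_(b <- r) f b = 1.
Proof.
elim: r => [|b r IH] h; first by rewrite big_nil.
by rewrite big_cons h ?IH ?mul1r//=; [move=> a ha; apply: h; right|left].
Qed.
End ListProd.

Lemma in_allpairs (A B C : Type) (f : A -> B -> C) s t z :
  List.In z [seq f a b | a <- s, b <- t] <->
  exists a b, [/\ List.In a s, List.In b t & z = f a b].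
Proof.
elim: s => [|a s IH] /=; first by split=> // -[? [? []]].
rewrite List.in_app_iff IH List.in_map_iff; split.
  move=> [[b [<- hb]]|[a' [b [ha hb ->]]]]; first by exists a, b; split=> //; left.
  by exists a', b; split=> //; right.
move=> [a' [b [[->|ha] hb ->]]]; first by left; exists b.
by right; exists a', b.
Qed.

Lemma in_nth (T : Type) (d : T) (s : seq T) n : (n < size s)%N -> List.In (nth d s n) s.
Proof. by elim: s n => //= a s IH [|n] h; [left|right; exact: IH]. Qed.

Lemma in_mem (T : eqType) (a : T) (s : seq T) : List.In a s <-> a \in s.
Proof.
elim: s => //= b s IH; rewrite inE; split.
  by move=> [->|/IH ->]; rewrite ?eqxx ?orbT.
by move=> /orP[/eqP->|/IH h]; [left|right].
Qed.

Lemma grid_in (K : Type) (d : K) (G : seq (seq K)) tb : List.In tb (grid G) ->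
  forall k, (k < size G)%N -> List.In (nth d tb k) (nth [::] G k).
Proof.
elim: G tb => //= vs G IH tb /in_allpairs[c [tb' [hc htb ->]]] [|k] //=.
by rewrite ltnS => /(IH _ htb).
Qed.

Lemma in_grid (K : Type) (d : K) (G : seq (seq K)) (f : nat -> K) n :
  (forall k, (k < size G)%N -> List.In (f (n + k)%N) (nth [::] G k)) ->
  List.In [seq f k | k <- iota n (size G)] (grid G).
Proof.
elim: G n => [|vs G IH] n h; first by left.
apply/in_allpairs; exists (f n), [seq f k | k <- iota n.+1 (size G)]; split=> //.
  by have := h 0%N isT; rewrite addn0.
by apply: IH => k hk; rewrite addSnnS; exact: (h k.+1).
Qed.

Section CondVars.
Variables (R : realType) (m l : nat) (th : 'I_l -> R).

Lemma poly_eval_vars (q : Defs.polynomial m l) (s s' : state R m) :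
  (forall y, y \in poly_vars q -> tnth s y = tnth s' y) -> poly_eval th q s = poly_eval th q s'.
Proof.
rewrite /poly_eval /poly_vars; elim: q => [|a q IH] h; first by rewrite !big_nil.
rewrite !big_cons IH => [|y hy]; last by apply: h; rewrite /= mem_cat hy orbT.
congr (_ * _ + _); apply: eq_big_seq => y hy; apply: h.
by rewrite /= mem_cat hy.
Qed.

Lemma cond_holds_vars (b : cond m l) (s s' : state R m) :
  (forall y, y \in cond_vars b -> tnth s y = tnth s' y) ->
  cond_holds th b s = cond_holds th b s'.
Proof.
elim: b => //= [q r|q r|q r|b IH /IH->//|b1 IH1 b2 IH2|b1 IH1 b2 IH2] h;
  try by rewrite !(@poly_eval_vars _ s s')// => y hy; apply: h; rewrite mem_cat hy ?orbT.
- by rewrite IH1 ?IH2// => y hy; apply: h; rewrite mem_cat hy ?orbT.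
- by rewrite IH1 ?IH2// => y hy; apply: h; rewrite mem_cat hy ?orbT.
Qed.

End CondVars.

Section Indicator.
Variables (R : realType) (D : distributions R) (m l : nat) (theta : 'I_l -> R) (p : 'I_l) (t : R).
Variables (F : m.-tuple (seq (const 'I_l))).
Local Notation t0 := (theta p).
Local Notation O := (fun_ops t0).
Local Notation th := (set_param theta p t).

Definition fun_ranges : seq (seq (R -> R)) := range_values O (fun_sym theta p) F.

Definition table_state (tb : seq (R -> R)) : state R m := [tuple nth (fun=> 0) tb y t0 | y < m].

(** Constant in [t]: conditions are decided at [theta], and regularity transfers the outcome to
    [t]. *)
Definition fun_truth (b : cond m l) (tb : seq (R -> R)) : R -> R :=
  fun=> (cond_holds theta b (table_state tb))%:R.

Hypothesis Fdef : forall y, all (const_defined theta) (tnth F y).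
Hypothesis Fsep : forall y c c', List.In c (nth [::] fun_ranges y) ->
  List.In c' (nth [::] fun_ranges y) -> c t0 != c' t0 -> c t != c' t.

Let rangeE (y : 'I_m) : nth [::] fun_ranges y =
  onum O 0 :: [seq const_val O (fun_sym theta p) c | c <- tnth F y].
Proof. by rewrite /fun_ranges /range_values (nth_map [::]) ?size_tuple// (tnth_nth [::]). Qed.

Let size_ranges : size fun_ranges = m.
Proof. by rewrite size_map size_tuple. Qed.

Let range_nth (y : 'I_m) j u : (j < size (tnth F y))%N ->
  nth (fun=> 0) (nth [::] fun_ranges y) j.+1 u = nth 0 [seq const_eval (set_param theta p u) c | c <- tnth F y] j.
Proof.
move=> h; rewrite rangeE /= !(nth_map (KNum 0))// const_valE ?fun_sym0//.
by move/(all_nthP (KNum 0)): (Fdef y); exact.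
Qed.

Let param0 : set_param theta p t0 = theta. Proof. exact: fun_sym0. Qed.

Let ev_lagrange (y : 'I_m) (a c : R -> R) (s : state R m) :
  (a t0 != c t0 -> a t != c t) ->
  (tnth s y = a t -> ev t (lagrange O y a c) s = 1) /\
  (tnth s y = c t -> a t0 != c t0 -> ev t (lagrange O y a c) s = 0).
Proof.
move=> sep; rewrite /ev /lagrange big_cons big_seq1 /= big_seq1 big_nil mulr1.
rewrite !rmorphN !rmorph1; split=> [->|-> ac] /=; first by ring.
have := sep ac; rewrite -subr_eq0 => h; rewrite mulN1r subr_eq0 (negbTE ac).
by rewrite !mulN1r; field.
Qed.

(** Cells of values that coincide at [t0] are not separated, even if the values differ at [t]. This
    is harmless: truth values are taken at [t0], where tables with such values give the same
    outcome. *)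
Lemma indicator_exactP (b : cond m l) :
  (forall idx : 'I_m -> nat, (forall y, y \in cond_vars b -> (idx y < size (tnth F y))%N) ->
    cond_holds th b (range_state F th idx) = cond_holds theta b (range_state F theta idx)) ->
  indicator_exact theta p t fun_ranges F fun_truth b.
Proof.
move=> same s hs.
have /choice[idx hidx] : forall y : 'I_m, exists j : nat, y \in cond_vars b ->
    (j < size (tnth F y))%N /\ tnth s y = nth 0 [seq const_eval th c | c <- tnth F y] j.
  move=> y; have [yb|_] := boolP (y \in cond_vars b); last by exists 0%N.
  have := hs y yb; rewrite /in_range => /(nthP 0)[j]; rewrite size_map => jF <-.
  by exists j.
(* The table of [s]. The successor accounts for the value 0 put in front of each range, which also
   serves as the entry of the variables outside the condition. *)
pose f (k : nat) : R -> R := if insub k is Some y then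
  if y \in cond_vars b then nth (fun=> 0) (nth [::] fun_ranges k) (idx y).+1 else onum O 0
  else onum O 0.
pose tb := [seq f k | k <- iota 0 (size fun_ranges)].
have tbE (y : 'I_m) : y \in cond_vars b ->
    nth (fun=> 0) tb y = nth (fun=> 0) (nth [::] fun_ranges y) (idx y).+1.
  move=> yb; rewrite (nth_map 0%N) ?size_iota ?size_ranges// nth_iota// /f add0n.
  by rewrite valK yb.
have tbt (y : 'I_m) : y \in cond_vars b -> nth (fun=> 0) tb y t = tnth s y.
  by move=> yb; have [h ->] := hidx y yb; rewrite tbE// range_nth.
have tb_in : List.In tb (grid fun_ranges).
  apply: in_grid (fun=> 0) _ _ _ _ => k; rewrite add0n size_ranges => km; rewrite /f insubT.
  case: ifP => [/hidx[h _]|_]; last by rewrite (rangeE (Ordinal km)); left.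
  apply: in_nth; rewrite (rangeE (Ordinal km))/= ltnS size_map.
  exact: h.
have truth_tb : cond_holds theta b (table_state tb) = cond_holds th b s.
  transitivity (cond_holds theta b (range_state F theta idx)).
    apply: cond_holds_vars => y yb; have [h _] := hidx y yb.
    by rewrite !tnth_mktuple tbE// range_nth// param0.
  rewrite -same => [|y /hidx[]//]; apply: cond_holds_vars => y yb.
  by have [_ ->] := hidx y yb; rewrite tnth_mktuple.
rewrite ev_compl ev_prod big_map.
have cellE tb' : ev t (cell_indicator O fun_ranges (cond_vars b) (fun_truth b tb') tb') s =
    (cond_holds theta b (table_state tb'))%:R *
    \prod_(y <- cond_vars b) \prod_(c <- nth [::] fun_ranges y)
       ev t (lagrange O y (nth (onum O 0) tb' y) c) s.
  rewrite ev_mul ev_cst ev_prod big_map; congr (_ * _); apply: eq_bigr => y _.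
  by rewrite ev_prod big_map.
have nthE tb' (y : 'I_m) : size tb' = m -> nth (onum O 0) tb' y = nth (fun=> 0) tb' y.
  by move=> sz; apply: set_nth_default; rewrite sz.
have size_grid tb' : List.In tb' (grid fun_ranges) -> size tb' = m.
  rewrite -size_ranges; elim: (fun_ranges) tb' => [|vs G IH] tb' /=; first by case=> // <-.
  by move=> /in_allpairs[c [tb2 [_ /IH h ->]]] /=; rewrite h.
have grid_y tb' (y : 'I_m) : List.In tb' (grid fun_ranges) ->
    List.In (nth (fun=> 0) tb' y) (nth [::] fun_ranges y).
  by move=> h; apply: grid_in => //; rewrite size_ranges.
case: (boolP (cond_holds th b s)) => hb.
  rewrite (prod_list0 tb_in) ?subr0// ev_compl cellE truth_tb hb mul1r.
  rewrite prod_list1 ?subrr// => y /in_mem yb; apply: prod_list1 => c hc.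
  rewrite nthE ?size_grid//; apply: (@ev_lagrange y (nth (fun=> 0) tb y) c s _).1; last by rewrite tbt.
  by apply: (@Fsep y) => //; exact: grid_y.
rewrite prod_list1 ?subrr// => tb' htb'; rewrite ev_compl cellE.
case: (boolP (cond_holds theta b (table_state tb'))) => h'; last by rewrite mul0r subr0.
(* A table that makes the condition true differs from that of [s] at [t0], so one of its Lagrange
   factors vanishes at [s]. *)
have [y yb yne] : exists2 y, y \in cond_vars b & nth (fun=> 0) tb' y t0 != nth (fun=> 0) tb y t0.
  apply: contrapT => hn; have : cond_holds theta b (table_state tb') = cond_holds theta b (table_state tb).
    apply: cond_holds_vars => y yb; rewrite !tnth_mktuple; apply/eqP.
    by apply: contrapT => ne; apply: hn; exists y => //; exact/negP.
  by rewrite h' truth_tb (negbTE hb).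
rewrite (@prod_list0 _ _ _ _ y) ?mulr0 ?subr0//; first exact/in_mem.
apply: (@prod_list0 _ _ _ _ (nth (fun=> 0) tb y)); first exact: grid_y.
rewrite nthE ?size_grid//; apply: (@ev_lagrange y (nth (fun=> 0) tb' y) (nth (fun=> 0) tb y) s _).2 => //; last by rewrite tbt.
by apply: (@Fsep y); exact: grid_y.
Qed.

End Indicator.

(** * Decomposition into irreducible cells *)

Section Subspace.
Variables (R : realType) (n : nat) (U : 'rV[R]_n -> Prop).
Hypothesis U0 : U 0.
Hypothesis UD : forall (c : R) a b, U a -> U b -> U (c *: a + b).

Let U_sub k (A : 'M[R]_(k, n)) : (forall i, U (row i A)) -> forall b, (b <= A)%MS -> U b.
Proof.
move=> UA b /submxP[u ->]; rewrite mulmx_sum_row.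
elim/big_ind : _ => // [a c ha hc|i _]; first by rewrite -[a]scale1r; exact: UD.
by rewrite -[_ *: _]addr0; exact: UD.
Qed.

(** A matrix of maximal rank among those with rows in [U] spans it, since appending a vector of [U]
    cannot raise the rank. *)
Lemma subspace_matrix : exists k (A : 'M[R]_(k, n)), forall b, U b <-> (b <= A)%MS.
Proof.
pose P r := `[< exists k (A : 'M[R]_(k, n)), (forall i, U (row i A)) /\ \rank A = r >].
have exP : exists r, P r.
  by exists 0%N; apply/asboolP; exists 0%N, 0; split; [case|exact: mxrank0].
have bP r : P r -> (r <= n)%N by move=> /asboolP[k [A [_ <-]]]; exact: rank_leq_col.
case: (ex_maxnP exP bP) => r /asboolP[k [A [UA rA]]] maxr; exists k, A => b; split; last exact: U_sub.
move=> Ub; pose A' := col_mx A b.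
have UA' i : U (row i A').
  case: (split_ordP i) => j ->; rewrite ?rowKu ?rowKd//.
  by rewrite [j]ord1 (_ : row 0 b = b)//; apply/rowP => u; rewrite mxE.
have rA' : (\rank A' <= \rank A)%N by rewrite rA; apply: maxr; apply/asboolP; exists _, A'.
have sA : (A <= A')%MS by rewrite /A' -addsmxE addsmxSl.
have := mxrank_leqif_sup sA; rewrite /leqif => -[h1 h2].
have : (A' <= A)%MS by rewrite -h2 eqn_leq h1.
by rewrite /A' -addsmxE addsmx_sub => /andP[].
Qed.

(* A subspace is defined by linear equations, which can be integrated. *)
Lemma subspace_mean (nu : probability (measurableTypeR R) R) :
  (forall k, nu.-integrable [set: measurableTypeR R] (fun v : measurableTypeR R => (v ^+ k)%:E)) ->
  {ae nu, forall v : measurableTypeR R, U (\row_j v ^+ j)} -> U (\row_j (\int[nu]_v v ^+ j)).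
Proof.
move=> int aeU; have [k [A UA]] := subspace_matrix; apply/UA.
rewrite submxE; apply/eqP/rowP => j; rewrite [LHS]mxE [RHS]mxE.
have E : forall v : R, ((\row_j v ^+ j) *m cokermx A : 'rV[R]_n) 0 j = \sum_(i < n) v ^+ i * cokermx A i j.
  by move=> v; rewrite mxE; apply: eq_bigr => i _; congr (_ * _); rewrite mxE.
have intM (i : 'I_n) : nu.-integrable [set: measurableTypeR R]
    (fun v : measurableTypeR R => (cokermx A i j * v ^+ i)%:E).
  by under eq_fun do rewrite EFinM; apply: integrableZl.
transitivity (\int[nu]_v (\sum_(i < n) v ^+ i * cokermx A i j)).
  apply/esym; transitivity (\sum_(i < n) \int[nu]_v (cokermx A i j * v ^+ i)).
    rewrite /index_enum; elim: (Finite.enum _) => [|i r IH].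
      by rewrite big_nil; under eq_Rintegral do rewrite big_nil; rewrite Rintegral_cst// mul0r.
    rewrite big_cons; under eq_Rintegral do rewrite big_cons.
    rewrite RintegralD//; last 2 first.
    - by under eq_fun do rewrite mulrC; exact: intM.
    - rewrite (_ : _ \o _ = fun v : measurableTypeR R => (\sum_(i <- r) (cokermx A i j * v ^+ i)%:E)%E).
        exact: integrable_sum.
      apply/funext => v /=; rewrite sumEFin; congr EFin; apply: eq_bigr => i' _; exact: mulrC.
    by congr (_ + _); [apply: eq_Rintegral => v _; rewrite mulrC|exact: IH].
  apply: eq_bigr => i _; rewrite RintegralZl//; last exact: int.
  by rewrite mulrC; congr (_ * _); rewrite mxE.
transitivity (\int[nu]_v (0 : R)); last by rewrite Rintegral_cst// mul0r.
rewrite /Rintegral; congr fine; apply: ae_eq_integral => //.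
  rewrite (_ : (fun _ => _) = fun v : measurableTypeR R => (\sum_(i <- index_enum 'I_n) (cokermx A i j * v ^+ i)%:E)%E).
    by apply: emeasurable_sum => i; have /integrableP[] := intM i.
  apply/funext => v /=; rewrite sumEFin; congr EFin; apply: eq_bigr => i' _; exact: mulrC.
apply: filterS aeU => v /UA; rewrite submxE => /eqP/rowP/(_ j) h _.
by rewrite -E h mxE.
Qed.

End Subspace.

(** * Splitting a filter into irreducible cells *)

Section Cells.
Variables (R : realType) (d : measure_display) (T : measurableType d).
Implicit Types (F : set_system T) (h q : T -> R).

(* The part of Fubini's theorem that the filters of interest satisfy. *)
Definition fubini_filter F : Prop := forall (nu : probability (measurableTypeR R) R)
  (B : set (T * measurableTypeR R)), measurable B ->
  F [set s | {ae nu, forall v, B (s, v)}] -> {ae nu, forall v, F [set s | B (s, v)]}.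

Variables (V : set (T -> R)) (r : nat).

(** A cell is given by the filter of what holds almost surely on it. Splitting is [within], and no
    measure has to be conditioned on an event that may have probability 0. *)
Definition irreducible F : Prop := forall h, V h ->
  (exists cs : seq R, (size cs <= r)%N /\ F [set s | h s \in cs]) ->
  exists c, F [set s | h s = c].

(** Fubini is applied to the implication from [C] to [B], whose sections over the complement of [C]
    are the full space. *)
Lemma fubini_within F (C : set T) : Filter F -> measurable C -> fubini_filter F ->
  fubini_filter (within C F).
Proof.
move=> FF mC fF nu B mB FB.
have mB' : measurable ((~` C) `*` [set: measurableTypeR R] `|` B).
  by apply: measurableU => //; apply: measurableX => //; exact: measurableC.
have FB1 : F [set s | C s -> {ae nu, forall v, B (s, v)}] := FB.
have FB' : F [set s | {ae nu, forall v, ((~` C) `*` [set: measurableTypeR R] `|` B) (s, v)}].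
  apply: filterS FB1 => s hs; have [Cs|nCs] := pselect (C s).
    by apply: filterS (hs Cs) => v Bv; right.
  by apply: filterE => v; left; split.
apply: filterS (fF nu _ mB' FB') => v; apply: filterS => s hs Cs.
by case: hs => [[/(_ Cs)]|].
Qed.

Lemma irreducible_trivial F : Filter F ->
  (forall h, V h -> F [set s | h s = 0]) -> irreducible F.
Proof. by move=> FF h0 h Vh _; exists 0; exact: h0. Qed.

Variables (N0 : nat) (basis : 'I_N0 -> T -> R).
Hypothesis V_basis : forall h, V h -> exists c, forall s, h s = \sum_i c i * basis i s.
Hypothesis V_cst : forall c : R, V (fun=> c).
Hypothesis V_meas : forall h, V h -> measurable_fun [set: T] (h : T -> measurableTypeR R).
Hypothesis r0 : (0 < r)%N.

(* Indices of a spanning family that works for all functions which are in [V] on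
   each irreducible cell, after [n] rounds of splitting. *)
Fixpoint cell_index (n : nat) : finType :=
  if n is n'.+1 then ('I_r * cell_index n')%type else 'I_N0.

Lemma card_cell_index n : #|cell_index n| = (r ^ n * N0)%N.
Proof.
elim: n => [|n IH]; first by rewrite card_ord mul1n.
by rewrite card_prod card_ord IH expnS mulnA.
Qed.

Definition spans F (I : finType) (f : I -> T -> R) q : Prop :=
  exists c : I -> R, F [set s | q s = \sum_i c i * f i s].

(** Pads the basis with zeros, so that cells which need no further splitting use the same index
    type. *)
Lemma basis_cell_index n : exists e : cell_index n -> T -> R,
  forall h, V h -> exists c, forall s, h s = \sum_i c i * e i s.
Proof.
elim: n => [|n [e he]]; first by exists basis.
exists (fun i => if i.1 == Ordinal r0 then e i.2 else fun=> 0) => h /he[c hc].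
exists (fun i => c i.2) => s.
rewrite -(pair_bigA _ (fun k j => c j * (if k == Ordinal r0 then e j else fun=> 0) s))/=.
rewrite (bigD1 (Ordinal r0))//= ?eqxx [X in _ + X]big1 ?addr0// => k /negbTE ->.
by rewrite big1// => j _; rewrite mulr0.
Qed.

(** [e] is chosen before [q], so it serves for all iterates of the weakest precondition at once.
    Induction on the number [n] of generators of [V] on the filter: if it is reducible, some [h] in
    [V] has at most [r] values without being constant. On the part where [h] equals a value c, the
    different combinations of generators for [h] and for the constant c coincide, and this relation
    eliminates a generator. *)
Lemma cell_decomposition n F : Filter F -> fubini_filter F ->
  (exists f : 'I_n -> T -> R, forall h, V h -> spans F f h) ->
  exists e : cell_index n -> T -> R, forall q,
    (forall F', Filter F' -> fubini_filter F' -> irreducible F' -> F `<=` F' ->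
      exists h, V h /\ F' [set s | q s = h s]) ->
    spans F e q.
Proof.
have irr_case n' F' : Filter F' -> fubini_filter F' -> irreducible F' ->
    exists e : cell_index n' -> T -> R, forall q,
    (forall F2, Filter F2 -> fubini_filter F2 -> irreducible F2 -> F' `<=` F2 ->
      exists h, V h /\ F2 [set s | q s = h s]) -> spans F' e q.
  move=> FF fF iF; have [e he] := basis_cell_index n'; exists e => q hq.
  have [h [/he[c hc] qh]] := hq F' FF fF iF (fun _ => id).
  by exists c; apply: filterS qh => s /= ->.
elim: n F => [|n IH] F FF fF [f hf].
  (* Without generators, all of [V] vanishes on the filter. *)
  apply: irr_case => //; apply: irreducible_trivial => h /hf[c].
  by apply: filterS => s /= ->; rewrite big_ord0.
have [iF|niF] := pselect (irreducible F); first exact: irr_case.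
have [h [Vh [[cs [scs hcs]] nc]]] : exists h, V h /\
    ((exists cs : seq R, (size cs <= r)%N /\ F [set s | h s \in cs]) /\
     forall c, ~ F [set s | h s = c]).
  apply: contrapT => hn; apply: niF => h Vh hcs; apply: contrapT => nc; apply: hn.
  by exists h; split=> //; split=> // c Fc; apply: nc; exists c.
pose C (k : 'I_r) : set T := [set s | h s = nth 0 cs k].
have mC k : measurable (C k).
  have := V_meas Vh measurableT (measurable_set1 (nth 0 cs k)).
  by rewrite setTI; congr measurable; apply/seteqP; split.
have FC k : Filter (within (C k) F) by exact: within_filter.
have fC k : fubini_filter (within (C k) F) by exact: fubini_within.
have spanC k : exists f' : 'I_n -> T -> R, forall g, V g -> spans (within (C k) F) f' g.
  have [a ha] := hf h Vh; have [b hb] := hf _ (V_cst (nth 0 cs k)).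
  (* Equal coefficients would make [h] constant on the whole filter. *)
  have [i abi] : exists i, a i != b i.
    apply: contrapT => hn; apply: (nc (nth 0 cs k)).
    apply: filterS (filterI ha hb) => s [/= -> ->]; apply: eq_bigr => i _.
    by congr (_ * _); apply/eqP; apply: contrapT => /negP ne; apply: hn; exists i.
  exists (fun j => f (lift i j)) => g /hf[c hc].
  (* Generator [i] is expressed by the others through the relation with coefficients [a - b]. *)
  exists (fun j => c (lift i j) - c i / (a i - b i) * (a (lift i j) - b (lift i j))).
  apply: filterS (filterI (filterI ha hb) hc) => s [[/= ea eb] ->] Cs.
  have e0 : (a i - b i) * f i s + \sum_j (a (lift i j) - b (lift i j)) * f (lift i j) s = 0.
    have : \sum_j a j * f j s - \sum_j b j * f j s = 0.
      by rewrite -ea -eb; apply/eqP; rewrite subr_eq0; apply/eqP.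
    rewrite -sumrB (bigD1_ord i)//= -mulrBl => h0; rewrite -[RHS]h0; congr (_ + _).
    by apply: eq_bigr => j _; rewrite mulrBl.
  rewrite (bigD1_ord i)//= [RHS](eq_bigr (fun j => c (lift i j) * f (lift i j) s -
    c i / (a i - b i) * ((a (lift i j) - b (lift i j)) * f (lift i j) s))); last first.
    by move=> j _; rewrite mulrBl !mulrA.
  rewrite sumrB -mulr_sumr addrC; congr (_ + _).
  have ab0 : a i - b i != 0 by rewrite subr_eq0.
  move/eqP: e0; rewrite addrC addr_eq0 => /eqP ->.
  by rewrite mulrN opprK mulrA divfK.
have /choice[e he] : forall k : 'I_r, exists e : cell_index n -> T -> R, forall q,
    (forall F', Filter F' -> fubini_filter F' -> irreducible F' -> within (C k) F `<=` F' ->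
      exists h, V h /\ F' [set s | q s = h s]) -> spans (within (C k) F) e q.
  by move=> k; exact: IH.
(* The families of the parts are glued by the indicators of [h] taking its [i.1]-th value. *)
exists (fun (i : 'I_r * cell_index n) s => (i.1 == index (h s) cs :> nat)%:R * e i.1 i.2 s) => q hq.
have /choice[c hc] : forall k : 'I_r, spans (within (C k) F) (e k) q.
  move=> k; apply: he => F' FF' fF' iF' CF'; apply: hq => // A FA.
  by apply: CF'; apply: filterS FA => s As _.
exists (fun i : 'I_r * cell_index n => c i.1 i.2).
have : F [set s | forall k : 'I_r, C k s -> q s = \sum_j c k j * e k j s].
  exact: filter_forall.
apply: filterS2 hcs => s /= hcss hs.
have kr : (index (h s) cs < r)%N by rewrite (leq_trans _ scs)// index_mem.
rewrite (hs (Ordinal kr)); last by rewrite /C /= nth_index.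
rewrite -(pair_bigA _ (fun k j => c k j * ((k == index (h s) cs :> nat)%:R * e k j s)))/=.
rewrite (bigD1 (Ordinal kr))//= [X in _ = _ + X]big1 ?addr0; last first.
  move=> k kne; rewrite big1// => j _.
  have -> : (k == index (h s) cs :> nat) = false by apply: contraNF kne => /eqP e'; apply/eqP/val_inj.
  by rewrite mul0r mulr0.
by apply: eq_bigr => j _; rewrite eqxx mul1r.
Qed.

Lemma spans_dependent F (I : finType) (f : I -> T -> R) (w : nat -> T -> R) : Filter F ->
  (forall j, spans F f (w j)) -> exists g : 'I_#|I|.+1 -> R, (exists j, g j != 0) /\
    F [set s | \sum_j g j * w j s = 0].
Proof.
move=> FF /choice[c hc].
pose A : 'M[R]_(#|I|.+1, #|I|) := \matrix_(j, i) c j (enum_val i).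
have /rowV0Pn[g gA g0] : kermx A != 0.
  by rewrite -mxrank_eq0 mxrank_ker -lt0n subn_gt0 ltnS rank_leq_col.
exists (fun j => g 0 j); split; first by apply/rV0Pn.
have : F [set s | forall j : 'I_#|I|.+1, w j s = \sum_i c j i * f i s].
  by apply: filter_forall => j; exact: hc.
apply: filterS => s /= hs.
under eq_bigr do rewrite hs mulr_sumr.
rewrite exchange_big big1//= => i _.
move/sub_kermxP/rowP: gA => /(_ (enum_rank i)); rewrite !mxE => h0.
under eq_bigr do rewrite mulrA.
rewrite -mulr_suml (_ : \sum_j _ = 0) ?mul0r// -[RHS]h0.
by apply: eq_bigr => j _; rewrite mxE enum_rankK.
Qed.

End Cells.

(** * Weakest preconditions on irreducible cells *)

Section AeMeasurable.
Variables (R : realType) (D : distributions R) (m l : nat) (th : 'I_l -> R).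
Local Notation state := (state R m).

Lemma ae_measurableE d (T : measurableType d) (mu : {measure set T -> \bar R}) (B : set T) :
  measurable B -> {ae mu, forall s, B s} <-> mu (~` B) = 0%E.
Proof. by move=> mB; apply: negligibleP; exact: measurableC. Qed.

Lemma measurable_ae c (B : set state) : measurable B ->
  measurable [set s | {ae (exec D th c s : {measure set state -> \bar R}), forall s', B s'}].
Proof.
move=> mB; rewrite (_ : mkset _ = (fun s => exec D th c s (~` B)) @^-1` [set 0%E]).
  rewrite -[X in measurable X]setTI; apply: (measurable_kernel (exec D th c)) => //.
  exact: measurableC.
by apply/seteqP; split => s /= /ae_measurableE; exact.
Qed.

(** The probability of missing [B] has integral 0, and a nonnegative function with integral 0
    vanishes almost everywhere. *)
Lemma ae_seq c1 c2 s (B : set state) : measurable B ->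
  {ae (exec D th (SSeq c1 c2) s : {measure set state -> \bar R}), forall s', B s'} ->
  {ae (exec D th c1 s : {measure set state -> \bar R}), forall s1,
    {ae (exec D th c2 s1 : {measure set state -> \bar R}), forall s', B s'}}.
Proof.
move=> mB /(ae_measurableE _ mB) h.
have mk : measurable_fun [set: state] (fun y => exec D th c2 y (~` B)).
  by apply: measurable_kernel; exact: measurableC.
have : (\int[exec D th c1 s]_y `|exec D th c2 y (~` B)| = 0)%E.
  by rewrite -[RHS]h; apply: eq_integral => y _; rewrite gee0_abs.
move/(ae_eq_integral_abs _ measurableT mk); apply: filterS => y /(_ I) h0.
exact/ae_measurableE.
Qed.

Lemma measurable_branches F c : measurable [set s : state | branches_in_range D F th c s].
Proof.
elim: c => [|x e|c1 IH1 c2 IH2|b c1 IH1 c2 IH2] /=; first exact: measurableT.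
- exact: measurableT.
- by apply: measurableI => //; exact: measurable_ae.
- apply: (measurableI [set s : state | forall y, y \in cond_vars b -> in_range F th y (tnth s y)]
    [set s : state | if cond_holds th b s then branches_in_range D F th c1 s
                     else branches_in_range D F th c2 s]).
    elim: (cond_vars b) => [|y vs IH].
      by rewrite (_ : mkset _ = setT); [exact: measurableT|apply/seteqP; split].
    rewrite (_ : mkset _ = [set s | in_range F th y (tnth s y)] `&`
        [set s | forall y', y' \in vs -> in_range F th y' (tnth s y')]).
      apply: measurableI => //.
      rewrite (_ : mkset _ = (fun s : state => tnth s y) @^-1` [set` [seq const_eval th e | e <- tnth F y]]); last first.
        by apply/seteqP; split.
      rewrite -[X in measurable X]setTI; apply: (measurable_tnth y) => //.
      by apply: countable_measurable => [v|]; [exact: measurable_set1|exact: finite_set_countable (finite_seq _)].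
    apply/seteqP; split => s /=.
      by move=> h; split=> [|y' hy']; apply: h; rewrite inE ?eqxx ?hy' ?orbT.
    by move=> [h1 h2] y' /[!inE]/orP[/eqP->//|]; exact: h2.
  have mb : measurable [set s : state | cond_holds th b s].
    by rewrite -[X in measurable X]setTI; exact: (measurable_cond_holds th b measurableT (Y := [set true])).
  rewrite (_ : mkset _ = ([set s | cond_holds th b s] `&` [set s | branches_in_range D F th c1 s]) `|`
     (~` [set s | cond_holds th b s] `&` [set s | branches_in_range D F th c2 s])).
    by apply: measurableU; apply: measurableI => //; exact: measurableC.
  apply/seteqP; split => s /=.
    by case: ifP => h; [left|right].
  by move=> [[->]//|[/negP/negbTE ->]].
Qed.

End AeMeasurable.

(** * Polynomials of bounded weight *)

Section Weights.
Variables (R : realType) (m : nat) (t0 t : R) (wt : 'I_m -> nat) (Delta : nat).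
Local Notation O := (fun_ops t0).
Local Notation poly := (lpoly (R -> R) m).
Local Notation state := (state R m).
Implicit Types (q r : poly).
Hypotheses (wt_gt0 : forall y, (0 < wt y)%N) (wt_le : forall y, (wt y <= Delta)%N).

Definition weight (vs : seq 'I_m) : nat := \sum_(y <- vs) wt y.
Definition wle n q : bool := all (fun a => weight a.2 <= n)%N q.

Lemma wle_cat n q r : wle n (q ++ r) = wle n q && wle n r.
Proof. exact: all_cat. Qed.

Lemma wle_scale n c q : wle n q -> wle n (pscale O c q).
Proof. by rewrite /wle all_map. Qed.

Lemma wle_mul n k q r : wle n q -> wle k r -> wle (n + k) (pmul O q r).
Proof.
move=> hq hr; elim: q hq => //= a q IH /andP[ha hq]; rewrite /pmul/= wle_cat; apply/andP; split.
  rewrite /wle all_map; apply: sub_all hr => b hb /=.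
  by rewrite /weight big_cat/= leq_add.
exact: IH.
Qed.

(** Each occurrence of [x] is replaced by a polynomial whose weight does not exceed that of [x]. *)
Lemma wle_subst n x r q : wle (wt x) r -> wle n q -> wle n (psubst O x r q).
Proof.
move=> hr; elim: q => //= a q IH /andP[ha hq]; rewrite wle_cat IH// andbT.
apply: wle_scale; suff h : wle (weight a.2) (pprod O [seq (if y == x :> nat then r else pvar O y) | y : 'I_m <- a.2]).
  by apply: sub_all h => b hb; exact: leq_trans hb ha.
elim: (a.2) => [|y vs IHvs]; first by rewrite /= /weight !big_nil.
rewrite [X in wle X _]/weight big_cons -/(weight vs) /=; apply: wle_mul => //.
case: (altP (y =P x :> nat)) => [/ord_inj -> //|_].
by rewrite /= /weight big_seq1 leqnn.
Qed.

Definition wspace : set (state -> R) := [set h | exists q, wle Delta q /\ h = ev t q].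

Lemma wspace_cst (c : R) : wspace (fun=> c).
Proof.
exists (pcst m (fun=> c)); split; first by rewrite /= /weight big_nil.
by apply/funext => s; rewrite ev_cst.
Qed.

Lemma wspaceD (c : R) g h : wspace g -> wspace h -> wspace (fun s => c * g s + h s).
Proof.
move=> [q [hq ->]] [r [hr ->]]; exists (pscale O (fun=> c) q ++ r); split.
  by rewrite wle_cat hr wle_scale.
by apply/funext => s; rewrite ev_cat ev_scale.
Qed.

Lemma wspace_tnth y : wspace (fun s => tnth s y).
Proof.
exists (pvar O y); split; last by apply/funext => s; rewrite ev_var.
by rewrite /= /weight big_seq1 wt_le.
Qed.

Lemma wspace_update x r h : wle (wt x) r -> wspace h -> wspace (fun s => h (update s x (ev t r s))).
Proof.
move=> hr [q [hq ->]]; exists (psubst O x r q); split; first exact: wle_subst.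
by apply/funext => s; rewrite ev_subst.
Qed.

Lemma wspace_update_cst x (v : R) h : wspace h -> wspace (fun s => h (update s x v)).
Proof.
move=> hh; have := @wspace_update x (pcst m (fun=> v)) h; rewrite /= /weight big_nil => /(_ isT hh).
by under eq_fun do rewrite ev_cst.
Qed.

Lemma wspace_pb h : wspace h -> pb h.
Proof. by move=> [q [_ ->]]; exact: pb_ev. Qed.

Definition exponents : finType := {ffun 'I_m -> 'I_Delta.+1}.

Definition wbasis (i : 'I_#|exponents|) (s : state) : R :=
  \prod_y tnth s y ^+ (enum_val i y).

Lemma card_exponents : #|exponents| = (Delta.+1 ^ m)%N.
Proof. by rewrite card_ffun !card_ord. Qed.

Lemma wspace_basis h : wspace h -> exists c, forall s, h s = \sum_i c i * wbasis i s.
Proof.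
move=> [q [hq ->]]; elim: q hq => [|a q IH] /=.
  by move=> _; exists (fun=> 0) => s; rewrite /ev big_nil big1// => i _; rewrite mul0r.
move=> /andP[ha /IH[c hc]].
pose al : exponents := [ffun y => inord (count_mem y a.2)].
exists (fun i => (i == enum_rank al)%:R * a.1 t + c i) => s.
rewrite /ev big_cons -/(ev _ _ _) hc; under [RHS]eq_bigr do rewrite mulrDl.
rewrite big_split/=; congr (_ + _).
rewrite (bigD1 (enum_rank al))//= eqxx mul1r [X in _ = _ + X]big1 ?addr0; last first.
  by move=> i /negbTE ->; rewrite !mul0r.
congr (_ * _); rewrite /wbasis enum_rankK.
(* Each occurrence of [y] contributes a positive weight. *)
have cle y : (count_mem y a.2 <= Delta)%N.
  apply: leq_trans ha; rewrite /weight -sum1_count [X in (_ <= X)%N](bigID (pred1 y))/=.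
  by apply: leq_trans (leq_addr _ _); apply: leq_sum.
rewrite [RHS](eq_bigr (fun y => tnth s y ^+ count_mem y a.2)) => [|y _]; last first.
  by rewrite ffunE inordK// ltnS.
elim: (a.2) => [|y vs IHvs]; first by rewrite big_nil big1.
rewrite big_cons IHvs [RHS](bigD1 y)//= [in LHS](bigD1 y)//= eqxx add1n exprS -mulrA.
congr (_ * (_ * _)); apply: eq_bigr => z /negbTE zy.
by rewrite eq_sym zy.
Qed.

End Weights.

Lemma all_lt_bound (T : Type) (f : T -> nat) (q : seq T) :
  exists n, all (fun a => f a < n)%N q.
Proof.
elim: q => [|a q [n hn]]; first by exists 0%N.
exists (maxn (f a).+1 n) => /=; rewrite leq_maxl; apply: sub_all hn => b hb.
by rewrite (leq_trans hb)// leq_maxr.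
Qed.

(** * Low-weight representatives of weakest preconditions *)

Section PhiWp.
Variables (R : realType) (D : distributions R) (m l : nat) (theta : 'I_l -> R) (p : 'I_l) (t : R).
Variables (G : seq (seq (R -> R))) (F : m.-tuple (seq (const 'I_l)))
  (tr : cond m l -> seq (R -> R) -> R -> R).
Variables (wt : 'I_m -> nat) (Delta r : nat).
Local Notation t0 := (theta p).
Local Notation O := (fun_ops t0).
Local Notation th := (set_param theta p t).
Local Notation state := (state R m).
Local Notation poly := (lpoly (R -> R) m).
Local Notation wp := (wp O (fun_sym theta p) (dist_moment D) tr G).
Local Notation V := (@wspace R m t wt Delta).
Hypotheses (wt_gt0 : forall y, (0 < wt y)%N) (wt_le : forall y, (wt y <= Delta)%N).
Hypothesis F_le : forall y, (size (tnth F y) <= r)%N.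

Fixpoint wt_ok (c : stmt m l) : bool :=
  match c with
  | SSkip | SAssign _ (RDraw _ _) => true
  | SAssign x (RChoice alts) => all (fun a => all (fun b => weight wt b.2 <= wt x)%N a.1) alts
  | SSeq c1 c2 | SIf _ c1 c2 => wt_ok c1 && wt_ok c2
  end.

Definition good_filter (F' : set_system state) : Prop :=
  [/\ Filter F', fubini_filter R F' & irreducible V r F'].

(** A function of [V] with few values on the image filter pulls back to such a function on [F'],
    where irreducibility makes it constant. *)
Lemma good_push (g : state -> state) F' : measurable_fun [set: state] g ->
  (forall h, V h -> V (h \o g)) -> good_filter F' -> good_filter (g @ F').
Proof.
move=> mg Vg [FF fF iF]; split; first exact: fmap_filter.
- move=> nu B mB FB; pose B' := (fun sv : state * measurableTypeR R => (g sv.1, sv.2)) @^-1` B.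
  apply: (fF nu B') => //.
  rewrite -[X in measurable X]setTI; apply: measurable_fun_pair => //.
    exact: (measurableT_comp mg).
- move=> h Vh [cs [scs hcs]]; apply: (iF (h \o g)); first exact: Vg.
  by exists cs.
Qed.

Lemma measurable_update_cst x (v : R) : measurable_fun [set: state] (fun s => update s x v).
Proof.
exact: (measurableT_comp (measurable_update x) (pair2_measurable (v : measurableTypeR R))).
Qed.

(** The degree of [q] is not bounded; only its behaviour on good filters that contain [B] is
    controlled. [B] is a safety condition that is transported backwards along with [q]. *)
Definition determined (B : set state) (q : state -> R) : Prop :=
  forall F', good_filter F' -> F' B -> exists h, V h /\ F' [set s | q s = h s].

(** Fixing [x] to almost any drawn v gives a good filter again, on which [q] agrees with an element
    of [V]; its dependence on v is arbitrary and cannot be integrated. Instead, [U] collects the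
    vectors b for which replacing each v^j by b_j yields an element of [V]. This is a linear
    subspace, so with almost all vectors of powers it contains the vector of moments. *)
Lemma determined_draw x d args (B : set state) (q : poly) :
  all (const_defined theta) args -> dist_dom D d (map (const_eval theta) args) ->
  dist_dom D d (map (const_eval th) args) ->
  measurable B -> determined B (ev t q) ->
  determined [set s | {ae (exec D th (SAssign x (RDraw m d args)) s : {measure set state -> \bar R}), forall s', B s'}]
    (ev t (pdraw O x (draw_moment O (fun_sym theta p) (dist_moment D) d args) q)).
Proof.
move=> ha dom dom' mB hB F' gF; have [FF fF iF] := gF => FB.
set nu := dist_law D d (map (const_eval th) args).
have intX j : nu.-integrable [set: measurableTypeR R] (fun v => (v ^+ j)%:E).
  by have [h _ _] := dist_momentP j dom'.
pose B' : set (state * measurableTypeR R) := (fun sv => update sv.1 x sv.2) @^-1` B.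
have mB' : measurable B'.
  by rewrite -[X in measurable X]setTI; exact: measurable_update.
have aev : {ae nu, forall v, F' [set s | B' (s, v)]}.
  apply: (fF nu _ mB'); apply: filterS FB => s /= /(ae_measurableE _ mB) h.
  apply/ae_measurableE => //.
  by rewrite -[X in measurable X]setTI; apply: (measurableT_comp (measurable_update x) (pair1_measurable s)).
have [n hn] := all_lt_bound (deg_in x) q.
pose U (b : 'rV[R]_n.+1) := exists h, V h /\
  F' [set s | \sum_(a <- q) cofactor_of t x a s * b 0 (inord (deg_in x a)) = h s].
have U0 : U 0.
  exists (fun=> 0); split; first exact: wspace_cst.
  by apply: filterE => s /=; rewrite big1// => a _; rewrite mxE mulr0.
have UD (c : R) a b : U a -> U b -> U (c *: a + b).
  move=> [h1 [V1 F1]] [h2 [V2 F2]]; exists (fun s => c * h1 s + h2 s); split; first exact: wspaceD.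
  apply: filterS2 F1 F2 => s /= <- <-; rewrite mulr_sumr -big_split/=.
  by apply: eq_bigr => i _; rewrite !mxE mulrDr mulrCA.
have Uv : {ae nu, forall v : measurableTypeR R, U (\row_j v ^+ j)}.
  apply: filterS aev => v Bv.
  have gv : good_filter ((fun s => update s x v) @ F').
    apply: good_push => //; first exact: measurable_update_cst.
    by move=> h; exact: wspace_update_cst.
  have [h [Vh qh]] := hB _ gv Bv.
  exists (fun s => h (update s x v)); split; first exact: wspace_update_cst.
  have {}qh : F' [set s | ev t q (update s x v) = h (update s x v)] := qh.
  apply: filterS qh => s /= <-; rewrite ev_update; apply: (eq_sum_all hn) => a da.
  by rewrite mxE inordK// ltnS ltnW.
have [h [Vh hF]] := subspace_mean U0 UD intX Uv.
exists h; split=> //; apply: filterS hF => s /= <-.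
rewrite ev_draw; apply: (eq_sum_all hn) => a da; congr (_ * _).
rewrite mxE inordK ?ltnS ?(ltnW da)// draw_momentE//.
by have [_ _ ->] := dist_momentP (deg_in x a) dom'.
Qed.

Lemma in_wspace_sum F' n (f : nat -> state -> R) : Filter F' ->
  (forall i, (i < n)%N -> exists h, V h /\ F' [set s | f i s = h s]) ->
  exists h, V h /\ F' [set s | \sum_(i < n) f i s = h s].
Proof.
move=> FF; elim: n => [|n IH] hf.
  exists (fun=> 0); split; first exact: wspace_cst.
  by apply: filterE => s /=; rewrite big_ord0.
have [i|h1 [V1 F1]] := IH _; first by move=> ni; apply: hf; exact: leqW.
have [h2 [V2 F2]] := hf n (leqnn _).
exists (fun s => 1 * h1 s + h2 s); split; first exact: wspaceD.
by apply: filterS2 F1 F2 => s /= <- <-; rewrite mul1r big_ord_recr.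
Qed.

Lemma determined_choice x alts (B : set state) (q : poly) :
  all (fun a => poly_defined theta a.1 && const_defined theta a.2) alts ->
  is_distr [seq const_eval th a.2 | a <- alts] ->
  all (fun a => all (fun b => weight wt b.2 <= wt x)%N a.1) alts ->
  measurable B -> determined B (ev t q) ->
  determined [set s | {ae (exec D th (SAssign x (RChoice alts)) s : {measure set state -> \bar R}), forall s', B s'}]
    (ev t (wp_choice O (fun_sym theta p) x alts q)).
Proof.
move=> ha hd hw mB hB F' gF; have [FF fF iF] := gF => FB.
set ps := [seq const_eval th a.2 | a <- alts] in hd.
(* A finite sum of point masses is concentrated on [B] only if every alternative of nonzero
   probability ends in [B]. *)
have FBi i : (i < size alts)%N -> nth 0 ps i != 0 -> F' [set s | B (alternative th x alts i s)].
  move=> hi w0; apply: filterS FB => s /= /(ae_measurableE _ mB).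
  rewrite /kchoice /choice_measure /= /msum /=.
  under eq_bigr do rewrite /mscale /= diracE -EFinM.
  rewrite sumEFin => -[/eqP]; rewrite psumr_eq0 => [/allP h|j _]; last first.
    by rewrite mulr_ge0// choice_weight_ge0.
  have hi' : (i < (size ps).+1)%N by rewrite size_map ltnS ltnW.
  have := h (Ordinal hi') (mem_index_enum _); rewrite /= mulf_eq0 /choice_weight hd.
  rewrite (negbTE w0)/= pnatr_eq0 eqb0 => hB'; apply: contrapT => nB.
  by move: hB'; rewrite mem_set.
have [h [Vh hF]] : exists h, V h /\ F' [set s | \sum_(i < size alts)
    nth 0 ps i * ev t q (alternative th x alts i s) = h s].
  apply: (@in_wspace_sum F' (size alts) (fun i s => nth 0 ps i * ev t q (alternative th x alts i s))) => i hi.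
  (* An alternative of probability 0 may leave [B], but it contributes nothing to the sum. *)
  have [w0|w0] := eqVneq (nth 0 ps i) 0.
    exists (fun=> 0); split; first exact: wspace_cst.
    by apply: filterE => s /=; rewrite w0 mul0r.
  have /andP[hpd _] : poly_defined theta (nth ([::], KNum 0) alts i).1 &&
      const_defined theta (nth ([::], KNum 0) alts i).2.
    by move/(all_nthP ([::], KNum 0)): ha; exact.
  have altE s : alternative th x alts i s =
      update s x (ev t (kpoly O (fun_sym theta p) (nth ([::], KNum 0) alts i).1) s).
    by rewrite ev_kpoly// /alternative (nth_map ([::], KNum 0)).
  have Valt h : V h -> V (fun s => h (alternative th x alts i s)).
    move=> Vh; under eq_fun do rewrite altE.
    apply: wspace_update => //; rewrite /wle /kpoly all_map.
    by move/(all_nthP ([::], KNum 0)): hw; exact.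
  have gF' : good_filter (alternative th x alts i @ F').
    by apply: good_push => //; exact: measurable_alternative.
  have [h [Vh qh]] := hB _ gF' (FBi i hi w0).
  have {}qh : F' [set s | ev t q (alternative th x alts i s) = h (alternative th x alts i s)] := qh.
  exists (fun s => nth 0 ps i * h (alternative th x alts i s) + 0); split.
    by apply: (wspaceD t0); [exact: Valt|exact: wspace_cst].
  by apply: filterS qh => s /= ->; rewrite addr0.
exists h; split=> //; apply: filterS hF => s /= <-.
rewrite ev_wp_choice// (big_nth ([::], KNum 0)) big_mkord; apply: eq_bigr => i _.
by rewrite (nth_map ([::], KNum 0))// /alternative (nth_map ([::], KNum 0)).
Qed.

Lemma determined_wp c (B : set state) (q : poly) : stmt_valid D theta c -> stmt_valid D th c ->
  (forall b, List.In b (stmt_conds c) -> indicator_exact theta p t G F tr b) -> wt_ok c ->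
  measurable B -> determined B (ev t q) ->
  determined ([set s | branches_in_range D F th c s] `&`
    [set s | {ae (exec D th c s : {measure set state -> \bar R}), forall s', B s'}])
    (ev t (wp c q)).
Proof.
elim: c B q => [|x [d args|alts]|c1 IH1 c2 IH2|b c1 IH1 c2 IH2] B q /=.
- move=> _ _ _ _ mB hB F' gF FB; have [FF _ _] := gF; apply: hB => //.
  apply: filterS FB => s /= [_ /(ae_measurableE _ mB)].
  rewrite -[X in X = _]/((\d_s (~` B))%E : \bar R) diracE => /eqP; rewrite eqe pnatr_eq0 eqb0 => h.
  by apply: contrapT => nB; move: h; rewrite mem_set.
- move=> [ha dom] [_ dom'] _ _ mB hB F' gF FB; have [FF _ _] := gF.
  apply: (determined_draw ha dom dom' mB hB gF).
  by apply: filterS FB => s [].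
- move=> [ha _] [_ hd] _ hw mB hB F' gF FB; have [FF _ _] := gF.
  apply: (determined_choice ha hd hw mB hB gF).
  by apply: filterS FB => s [].
- move=> [v1 v2] [v1' v2'] hc /andP[w1 w2] mB hB F' gF FB; have [FF _ _] := gF.
  have hc1 b : List.In b (stmt_conds c1) -> indicator_exact theta p t G F tr b.
    by move=> hb; apply: hc; apply/List.in_app_iff; left.
  have hc2 b : List.In b (stmt_conds c2) -> indicator_exact theta p t G F tr b.
    by move=> hb; apply: hc; apply/List.in_app_iff; right.
  have h2 := IH2 B q v2 v2' hc2 w2 mB hB.
  (* The condition needed before the second part becomes the almost sure postcondition of the
     first. *)
  set B1 := _ `&` _ in h2; have mB1 : measurable B1.
    by apply: measurableI; [exact: measurable_branches|exact: measurable_ae].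
  apply: (IH1 B1 _ v1 v1' hc1 w1 mB1 h2 F' gF).
  apply: filterS FB => s [[b1 b2] /(@ae_seq _ _ _ _ _ c1 c2 _ _ mB) h]; split=> //.
  by apply: filterS2 b2 h => s' h1 h2'; split.
- move=> [_ v1 v2] [_ v1' v2'] hc /andP[w1 w2] mB hB F' gF FB; have [FF fF iF] := gF.
  have hc1 b' : List.In b' (stmt_conds c1) -> indicator_exact theta p t G F tr b'.
    by move=> hb; apply: hc; right; apply/List.in_app_iff; left.
  have hc2 b' : List.In b' (stmt_conds c2) -> indicator_exact theta p t G F tr b'.
    by move=> hb; apply: hc; right; apply/List.in_app_iff; right.
  have Frange : F' [set s | forall y, y \in cond_vars b -> in_range F th y (tnth s y)].
    by apply: filterS FB => s [[]].
  (* A branching variable is an element of [V] and takes at most [r] values on the filter, so it is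
     constant there and the condition is decided. *)
  have /choice[v hv] : forall y : 'I_m, exists v : R, y \in cond_vars b -> F' [set s | tnth s y = v].
    move=> y; have [yb|_] := boolP (y \in cond_vars b); last by exists 0.
    have Vy : V (fun s => tnth s y) by exact: (wspace_tnth t0).
    have [|v hv] := iF _ Vy; last by exists v.
    exists [seq const_eval th e | e <- tnth F y]; split; first by rewrite size_map.
    by apply: filterS Frange => s /(_ y yb).
  pose s0 : state := [tuple v y | y < m].
  have Fcond : F' [set s | cond_holds th b s = cond_holds th b s0].
    have : F' [set s | forall y : 'I_m, y \in cond_vars b -> tnth s y = v y].
      by apply: filter_forall => y; have [yb|nyb] := boolP (y \in cond_vars b);
        [apply: filterS (hv y yb) => s|apply: filterE => s].
    apply: filterS => s hs; apply: cond_holds_vars => y yb.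
    by rewrite tnth_mktuple; exact: hs.
  have hb : indicator_exact theta p t G F tr b by apply: hc; left.
  have [h [Vh hF]] : exists h, V h /\ F' [set s | ev t (if cond_holds th b s0 then wp c1 q else wp c2 q) s = h s].
    case: ifP => hs0.
      apply: (IH1 B q v1 v1' hc1 w1 mB hB F' gF).
      apply: filterS2 FB Fcond => s [[_ br] hae]; rewrite /mkset hs0 => hs.
      by move: br hae; rewrite /= /kif hs => br hae; split.
    apply: (IH2 B q v2 v2' hc2 w2 mB hB F' gF).
    apply: filterS2 FB Fcond => s [[_ br] hae]; rewrite /mkset hs0 => hs.
    by move: br hae; rewrite /= /kif hs => br hae; split.
  exists h; split=> //; apply: filterS3 Frange Fcond hF => s hr; rewrite /mkset => hs <-.
  by rewrite (ev_wp_if _ _ hb)// hs; case: ifP.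
Qed.

End PhiWp.

(** * A linear recurrence for the moments *)

Section AeFubini.
Variables (R : realType) (d : measure_display) (T : measurableType d).

(** The indicator of the complement of [B] has integral 0 in one order of integration, hence in the
    other. *)
Lemma ae_fubini (mu : probability T R) (nu : probability (measurableTypeR R) R)
    (B : set (T * measurableTypeR R)) : measurable B ->
  {ae mu, forall s, {ae nu, forall v, B (s, v)}} -> {ae nu, forall v, {ae mu, forall s, B (s, v)}}.
Proof.
move=> mB h; have mB' : measurable (~` B) by exact: measurableC.
have mx s : measurable [set v | B (s, v)].
  by have := measurable_xsection s mB; rewrite xsectionE.
have my v : measurable [set s | B (s, v)].
  by have := measurable_ysection v mB; rewrite ysectionE.
have mG := indic_measurable_fun_fubini_tonelli_G mu mB'.
have e := indic_fubini_tonelli mu nu mB'.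
have F0 : (\int[mu]_x fubini_F nu (EFin \o \1_(~` B)) x = 0)%E.
  rewrite indic_fubini_tonelli_FE//; rewrite (ae_eq_integral (cst 0%E))//.
  - by rewrite integral0.
  - exact: measurable_fun_xsection.
  - apply: filterS h => s /(ae_measurableE nu (mx s)) h0 _ /=.
    by rewrite xsectionE.
rewrite F0 in e.
have : (\int[nu]_y `|fubini_G mu (EFin \o \1_(~` B)) y| = 0)%E.
  rewrite [RHS]e; apply: eq_integral => y _; rewrite gee0_abs//.
  exact: indic_fubini_tonelli_G_ge0.
move/(ae_eq_integral_abs _ measurableT mG); apply: filterS => v /(_ I).
rewrite indic_fubini_tonelli_GE//= ysectionE => h0.
exact/(ae_measurableE mu (my v)).
Qed.

End AeFubini.

Section KernelAt.
Variables (R : realType) (d : measure_display) (T : measurableType d) (k : R.-pker T ~> T) (s : T).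

(** [k s] comes as a measure only; this copy carries the structure of a probability that [ae_fubini]
    expects. *)
Definition kernel_at : set T -> \bar R := k s.

HB.instance Definition _ := isMeasure.Build _ _ _ kernel_at
  (measure0 (k s)) (measure_ge0 (k s)) (@measure_semi_sigma_additive _ _ _ (k s)).

Let kernel_at_setT : kernel_at [set: T] = 1%E. Proof. exact: prob_kernel. Qed.

HB.instance Definition _ := Measure_isProbability.Build _ _ _ kernel_at kernel_at_setT.

End KernelAt.

Section Recurrence.
Variables (R : realType) (D : distributions R) (m l : nat) (theta : 'I_l -> R) (p : 'I_l) (t : R).
Variables (G : seq (seq (R -> R))) (F : m.-tuple (seq (const 'I_l)))
  (tr : cond m l -> seq (R -> R) -> R -> R).
Variables (wt : 'I_m -> nat) (Delta r : nat) (P : loop m l).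
Local Notation t0 := (theta p).
Local Notation O := (fun_ops t0).
Local Notation th := (set_param theta p t).
Local Notation state := (state R m).
Local Notation poly := (lpoly (R -> R) m).
Local Notation wp := (wp O (fun_sym theta p) (dist_moment D) tr G).
Local Notation V := (@wspace R m t wt Delta).
Local Notation init := (loop_init P).
Local Notation body := (loop_body P).
Hypotheses (wt_gt0 : forall y, (0 < wt y)%N) (wt_le : forall y, (wt y <= Delta)%N).
Hypothesis F_le : forall y, (size (tnth F y) <= r)%N.
Hypothesis r_gt0 : (0 < r)%N.
Hypotheses (valid0 : loop_valid D theta P) (valid : loop_valid D th P).
Hypothesis exact_ind : forall b, List.In b (loop_conds P) -> indicator_exact theta p t G F tr b.
Hypothesis body_ok : wt_ok wt body.
Hypothesis br_init : branches_in_range D F th init (initial_state : state).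
Hypothesis br_body : forall n, {ae state_law D th P n, forall s, branches_in_range D F th body s}.

Let s0 : state := initial_state.

(** A single statement for [n] iterations, to which the results on [exec] apply. *)
Fixpoint unrolled (n : nat) : stmt m l := if n is n'.+1 then SSeq (unrolled n') body else init.

Let unrolled_valid n : stmt_valid D th (unrolled n).
Proof. by elim: n => [|n IH] /=; [exact: valid.1|split=> //; exact: valid.2]. Qed.

Let runE n : run D th P n = exec D th (unrolled n).
Proof. by elim: n => //= n ->. Qed.

Let exact_body b : List.In b (stmt_conds body) -> indicator_exact theta p t G F tr b.
Proof. by move=> h; apply: exact_ind; apply/List.in_app_iff; right. Qed.

Lemma momentE x k n : moment D P x k n th = Ex D th (unrolled n) (fun s => tnth s x ^+ k) s0.
Proof. by rewrite /moment /Ex /state_law runE. Qed.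

Let step i (q : poly) : Ex D th (unrolled i) (ev t (wp body q)) s0 = Ex D th (unrolled i.+1) (ev t q) s0.
Proof.
rewrite Ex_seq//; [|exact: valid.2|exact: pb_ev].
apply: Ex_ae => //; [exact: pb_ev|apply: pb_Ex; [exact: valid.2|exact: pb_ev]|].
have := br_body i; rewrite /state_law runE; apply: filterS => s hs.
by rewrite (@Ex_wp _ _ _ _ theta p t G F tr)//; [exact: valid0.2|exact: valid.2].
Qed.

Definition start_poly x k : poly := [:: (onum O 1, nseq k x)].

Let ev_start x k s : ev t (start_poly x k) s = tnth s x ^+ k.
Proof.
rewrite /ev big_seq1 /= rmorph1 mul1r; elim: k => [|k IH]; first by rewrite big_nil.
by rewrite big_cons exprS IH.
Qed.

(** The first [i] iterations are run forwards and [j] more are taken backwards, so relations between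
    the iterates of [wp] become relations between shifted moments. *)
Let iterate x k i j : Ex D th (unrolled i) (ev t (wp_iter O (fun_sym theta p) (dist_moment D) tr G body x k j)) s0 =
  moment D P x k (i + j) th.
Proof.
elim: j i => [|j IH] i.
  by rewrite addn0 momentE; congr Ex; apply/funext => s; exact: ev_start.
by rewrite [wp_iter _ _ _ _ _ _ _ _ _]/= step IH addSnnS.
Qed.

Let ev0E (q : poly) : ev0 O q t = ev t q s0.
Proof.
rewrite /ev0 /ev; elim: q => [|a q IH]; first by rewrite big_nil /= rmorph0.
rewrite big_cons /= IH; congr (_ + _); case: (a.2) => [|y vs] /=; first by rewrite big_nil mulr1.
by rewrite big_cons /s0 /initial_state tnth_mktuple mul0r mulr0 rmorph0.
Qed.

Lemma wp_momentE x k n :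
  wp_moment O (fun_sym theta p) (dist_moment D) tr G init body x k n t = moment D P x k n th.
Proof.
rewrite /wp_moment ev0E -[n in RHS]add0n -iterate /=.
by rewrite (@Ex_wp _ _ _ _ theta p t G F tr)//; [exact: valid0.1|exact: valid.1|
  move=> b hb; apply: exact_ind; apply/List.in_app_iff; left].
Qed.

(** Almost sureness at all times at once: a relation modulo this filter has coefficients independent
    of [i]. *)
Definition all_laws : set_system state := [set A | forall i, {ae state_law D th P i, forall s, A s}].

Let all_laws_filter : Filter all_laws.
Proof.
split.
- by move=> i; exact: filterT.
- by move=> A B hA hB i; exact: (filterI (hA i) (hB i)).
- by move=> A B AB hA i; apply: filterS (hA i).
Qed.

Let all_laws_fubini : fubini_filter R all_laws.
Proof.
move=> nu B mB h; apply/ae_foralln => i.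
by have := h i; rewrite /state_law runE; exact: (@ae_fubini _ _ _ (kernel_at (exec D th (unrolled i)) s0)).
Qed.

(* The almost sure condition under which [wp_iter j] is determined. *)
Fixpoint safe (j : nat) : set state :=
  if j is j'.+1 then [set s | branches_in_range D F th body s] `&`
    [set s | {ae (exec D th body s : {measure set state -> \bar R}), forall s', safe j' s'}]
  else setT.

Let measurable_safe j : measurable (safe j).
Proof.
elim: j => [|j IH]; first exact: measurableT.
by apply: measurableI; [exact: measurable_branches|exact: measurable_ae].
Qed.

Let all_laws_safe j : all_laws (safe j).
Proof.
elim: j => [|j IH]; first by move=> i; exact: filterT.
move=> i; apply: filterI; first exact: br_body.
have := IH i.+1; rewrite /state_law !runE.
exact: ae_seq (measurable_safe j).
Qed.

Let determined_iter x k j : (weight wt (nseq k x) <= Delta)%N ->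
  determined t wt Delta r (safe j)
    (ev t (wp_iter O (fun_sym theta p) (dist_moment D) tr G body x k j)).
Proof.
move=> hk; elim: j => [|j IH].
  move=> F' [FF _ _] _; exists (ev t (start_poly x k)); split; last exact: filterE.
  by exists (start_poly x k); split=> //=; rewrite hk.
exact: (determined_wp wt_le F_le valid0.2 valid.2 exact_body body_ok (measurable_safe j) IH).
Qed.

Definition recurrence_order : nat := (r ^ (Delta.+1 ^ m) * Delta.+1 ^ m)%N.

(** There are more iterates of [wp] than generators on the cells, so a linear relation between them
    holds almost surely at every time; its expectation at time [i] is the recurrence. *)
Lemma moments_recurrence x k : (weight wt (nseq k x) <= Delta)%N ->
  exists g : 'I_recurrence_order.+1 -> R, (exists j, g j != 0) /\
  forall i, \sum_j g j * moment D P x k (i + j) th = 0.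
Proof.
move=> hk; rewrite /recurrence_order -(card_exponents m Delta) -card_cell_index.
have VB h : V h -> exists c, forall s, h s = \sum_i c i * @wbasis R m Delta i s by exact: wspace_basis.
have Vc (c : R) : V (fun=> c) by exact: wspace_cst.
have Vm h : V h -> measurable_fun [set: state] (h : state -> measurableTypeR R).
  by move=> /wspace_pb[].
have sp : exists f : 'I_#|exponents m Delta| -> state -> R, forall h, V h -> spans all_laws f h.
  by exists (@wbasis R m Delta) => h /VB[c hc]; exists c; exact: filterE.
have [e he] := cell_decomposition VB Vc Vm r_gt0 all_laws_filter all_laws_fubini sp.
pose w j := ev t (wp_iter O (fun_sym theta p) (dist_moment D) tr G body x k j).
have [j|g [g0 hg]] := spans_dependent (w := w) all_laws_filter (f := e).
  apply: he => F' FF' fF' iF' sub.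
  by apply: (@determined_iter x k j hk F'); [split|exact: sub (all_laws_safe j)].
exists g; split=> // i; under eq_bigr do rewrite -iterate -/(w _).
transitivity (Ex D th (unrolled i) (fun s => \sum_j g j * w j s) s0).
  rewrite Ex_sum//; last by move=> j; apply: pbM; [exact: pb_cst|exact: pb_ev].
  by apply: eq_bigr => j _; rewrite ExZ//; exact: pb_ev.
transitivity (Ex D th (unrolled i) (fun=> 0 * 0) s0); last first.
  by rewrite ExZ ?mul0r//; exact: pb_cst.
apply: Ex_ae => //.
- by apply: pb_sum => j; apply: pbM; [exact: pb_cst|exact: pb_ev].
- exact: pb_cst.
- by have := hg i; rewrite /state_law runE; apply: filterS => s /= ->; rewrite mul0r.
Qed.

End Recurrence.

(** * Dual numbers represent functions of the parameter *)

Section Forall2.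
Implicit Types A B : Type.

Lemma forall2_map A A' B B' (P : A -> B -> Prop) (Q : A' -> B' -> Prop) (f : A -> A') (g : B -> B') s t :
  (forall a b, P a b -> Q (f a) (g b)) -> List.Forall2 P s t ->
  List.Forall2 Q (map f s) (map g t).
Proof. by move=> h; elim=> /= [|a b s' t' ab _ IH]; constructor => //; exact: h. Qed.

Lemma forall2_cat A B (P : A -> B -> Prop) s s' t t' :
  List.Forall2 P s t -> List.Forall2 P s' t' -> List.Forall2 P (s ++ s') (t ++ t').
Proof. exact: List.Forall2_app. Qed.

Lemma forall2_flatten A B (P : A -> B -> Prop) ss tt :
  List.Forall2 (List.Forall2 P) ss tt -> List.Forall2 P (flatten ss) (flatten tt).
Proof. by elim=> /= [|a b s t ab _ IH]; [constructor|exact: forall2_cat]. Qed.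

Lemma forall2_nth A B (P : A -> B -> Prop) d e s t n : P d e -> List.Forall2 P s t ->
  P (nth d s n) (nth e t n).
Proof. by move=> de h; elim: h n => [|a b s' t' ab _ IH] [|n] //=. Qed.

End Forall2.

Section Represents.
Variables (R : realType) (D : distributions R) (m l : nat) (theta : 'I_l -> R) (p : 'I_l).
Local Notation eval := (aexp_eval theta).
Local Notation t0 := (theta p).
Local Notation O := (fun_ops t0).
Local Notation dO := (dual_ops l).

(** Formulas take complex values in view of [ARoot]; the ones considered here are real. *)
Definition represents (d : dual l) (u : R -> R) : Prop :=
  eval d.1 = (u t0)%:C%C /\ exists du : R, is_derive t0 1 u du /\ eval d.2 = du%:C%C.

Definition prepr (a : dual l * seq 'I_m) (b : (R -> R) * seq 'I_m) : Prop :=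
  represents a.1 b.1 /\ a.2 = b.2.

Local Notation rpoly := (List.Forall2 prepr).
Local Notation rtab := (List.Forall2 represents).

Lemma ratrC (q : rat) : (ratr q : R[i]) = (ratr q : R)%:C%C.
Proof. by rewrite -[LHS](fmorph_rat (real_complex R)). Qed.

Lemma repr_num q : represents (onum dO q) (onum O q).
Proof.
split; first exact: ratrC.
by exists 0; split=> /=; [exact: is_derive_cst|rewrite !rmorph0].
Qed.

Lemma repr_add a b u v : represents a u -> represents b v -> represents (oadd dO a b) (oadd O u v).
Proof.
move=> [a1 [du [hu a2]]] [b1 [dv [hv b2]]]; split=> /=; first by rewrite a1 b1 rmorphD.
by exists (du + dv); split; [exact: is_deriveD|rewrite a2 b2 rmorphD].
Qed.

Lemma repr_mul a b u v : represents a u -> represents b v -> represents (omul dO a b) (omul O u v).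
Proof.
move=> [a1 [du [hu a2]]] [b1 [dv [hv b2]]]; split=> /=; first by rewrite a1 b1 rmorphM.
exists (u t0 *: dv + v t0 *: du); split; first exact: is_deriveM.
by rewrite a1 b1 a2 b2 /GRing.scale/= rmorphD !rmorphM addrC; congr (_ + _); rewrite mulrC.
Qed.

Lemma repr_inv a u : represents a u -> represents (oinv dO a) (oinv O u).
Proof.
move=> [a1 [du [hu a2]]]; split=> /=; rewrite a1.
  by case: eqP => [->|_]; rewrite ?rmorph0 ?invr0// fmorphV.
case: eqP => [->|/eqP u0].
  exists 0; split; first exact: is_derive_cst.
  by rewrite rmorph0 invr0 !mulr0 oppr0.
exists (- (u t0) ^- 2 *: du); split; first exact: is_deriveV.
by rewrite a2 /GRing.scale/= rmorphM rmorphN fmorphV rmorphXn/= mulNr mulrC expr2 invfM.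
Qed.

Lemma repr_sym q : represents (dual_sym p q) (fun_sym theta p q).
Proof.
split=> /=; first by rewrite /fun_sym /set_param; case: eqP => [->|].
have -> : fun_sym theta p q = if q == p then id else cst (theta q).
  by apply/funext => u; rewrite /fun_sym /set_param; case: ifP.
rewrite /dual_sym val_eqE; case: ifP => qp.
  by exists 1; split; [exact: is_derive_id|rewrite /= rmorph1].
by exists 0; split; [exact: is_derive_cst|rewrite /= rmorph0].
Qed.

Lemma repr_const_val V (sy : V -> dual l) (sy' : V -> R -> R) c :
  (forall v, represents (sy v) (sy' v)) -> represents (const_val dO sy c) (const_val O sy' c).
Proof.
move=> h; rewrite /const_val; elim: c => [q|v|a IHa b IHb|a IHa|a IHa b IHb|a IHa].
- exact: repr_num.
- exact: h.
- exact: repr_add.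
- by apply: repr_mul => //; exact: repr_num.
- exact: repr_mul.
- exact: repr_inv.
Qed.

Lemma repr_kval c : represents (const_val dO (dual_sym p) c) (const_val O (fun_sym theta p) c).
Proof. by apply: repr_const_val => v; exact: repr_sym. Qed.

Lemma repr_scale a u q r : represents a u -> rpoly q r -> rpoly (pscale dO a q) (pscale O u r).
Proof. by move=> h; apply: forall2_map => x y [h1 h2]; split=> //=; exact: repr_mul. Qed.

Lemma repr_pmul q q' r r' : rpoly q q' -> rpoly r r' -> rpoly (pmul dO q r) (pmul O q' r').
Proof.
move=> hq hr; apply: forall2_flatten; apply: forall2_map hq => a a' [a1 a2].
apply: forall2_map hr => b b' [b1 b2]; split=> /=; first exact: repr_mul.
by rewrite a2 b2.
Qed.

Lemma repr_cst a u : represents a u -> rpoly (pcst m a) (pcst m u).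
Proof. by move=> h; constructor. Qed.

Lemma repr_one : rpoly (pone dO m) (pone O m).
Proof. by apply: repr_cst; exact: repr_num. Qed.

Lemma repr_var y : rpoly (pvar dO y) (pvar O y).
Proof. by constructor => //; split=> //; exact: repr_num. Qed.

Lemma repr_compl q r : rpoly q r -> rpoly (pcompl dO q) (pcompl O r).
Proof.
move=> h; apply: forall2_cat; first exact: repr_one.
by apply: repr_scale => //; exact: repr_num.
Qed.

Lemma repr_prod qs rs : List.Forall2 rpoly qs rs -> rpoly (pprod dO qs) (pprod O rs).
Proof. by elim=> [|q r qs' rs' h _ IH]; [exact: repr_one|exact: repr_pmul]. Qed.

Lemma repr_subst x q q' r r' : rpoly q q' -> rpoly r r' -> rpoly (psubst dO x r q) (psubst O x r' q').
Proof.
move=> hq hr; apply: forall2_flatten; apply: forall2_map hq => a a' [a1 ->].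
apply: repr_scale => //; apply: repr_prod; elim: (a'.2) => /= [|y vs IH]; constructor => //.
by case: ifP => // _; exact: repr_var.
Qed.

Lemma repr_draw x mu mu' q q' : (forall j, represents (mu j) (mu' j)) -> rpoly q q' ->
  rpoly (pdraw dO x mu q) (pdraw O x mu' q').
Proof.
move=> hm; apply: forall2_map => a a' [a1 a2]; split=> /=; last by rewrite a2.
by rewrite a2; exact: repr_mul.
Qed.

Lemma repr_kpoly q : rpoly (kpoly dO (dual_sym p) q) (kpoly O (fun_sym theta p) q).
Proof. by elim: q => [|a q IH] /=; constructor => //; split=> //; exact: repr_kval. Qed.

Lemma repr_draw_moment mom d args j :
  represents (draw_moment dO (dual_sym p) mom d args j) (draw_moment O (fun_sym theta p) mom d args j).
Proof.
apply: repr_const_val => i; apply: forall2_nth; first exact: repr_num.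
by elim: args => [|c args IH] /=; constructor => //; exact: repr_kval.
Qed.

Lemma repr_grid G G' : List.Forall2 rtab G G' -> List.Forall2 rtab (grid G) (grid G').
Proof.
elim=> [|vs vs' H H' h _ IH] /=; first by do 2 constructor.
apply: forall2_flatten; apply: forall2_map h => a a' ha.
by apply: forall2_map IH => tb tb' htb; constructor.
Qed.

Lemma repr_lagrange y a a' b b' : represents a a' -> represents b b' ->
  rpoly (lagrange dO y a b) (lagrange O y a' b').
Proof.
move=> ha hb; have hi : represents (oinv dO (oadd dO a (omul dO (onum dO (-1)) b)))
    (oinv O (oadd O a' (omul O (onum O (-1)) b'))).
  by apply: repr_inv; apply: repr_add => //; apply: repr_mul => //; exact: repr_num.
constructor; first by split.
constructor=> //; split=> //; apply: repr_add; first exact: repr_num.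
by apply: repr_mul; [exact: repr_num|exact: repr_mul].
Qed.

Lemma repr_cell G G' vs u u' tb tb' : List.Forall2 rtab G G' -> represents u u' -> rtab tb tb' ->
  rpoly (cell_indicator dO G vs u tb) (cell_indicator O G' vs u' tb').
Proof.
move=> hG hu ht; apply: repr_pmul; first exact: repr_cst.
apply: repr_prod; elim: vs => /= [|y vs IH]; constructor => //.
have hGy : rtab (nth [::] G y) (nth [::] G' y) by apply: forall2_nth.
apply: repr_prod; apply: forall2_map hGy => b b' hb; apply: repr_lagrange => //.
by apply: forall2_nth => //; exact: repr_num.
Qed.

Lemma repr_ranges (F : seq (seq (const 'I_l))) :
  List.Forall2 rtab (range_values dO (dual_sym p) F) (range_values O (fun_sym theta p) F).
Proof.
elim: F => [|es F IH] /=; constructor => //; constructor; first exact: repr_num.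
by elim: es => [|c es IHe] /=; constructor => //; exact: repr_kval.
Qed.

Section Truth.
Variables (tb : seq (dual l)) (tb' : seq (R -> R)).
Hypothesis htb : rtab tb tb'.

Lemma eval_apoly (q : Defs.polynomial m l) : poly_defined theta q ->
  eval (apoly (dual_sym p) tb q) = (poly_eval theta q (table_state m theta p tb'))%:C%C.
Proof.
rewrite /apoly /poly_eval; elim: q => [|a q IH] /=.
  by move=> _; rewrite big_nil !rmorph0.
move=> /andP[ha /IH hq]; rewrite big_cons hq rmorphD rmorphM; congr (_ * _ + _).
  have [-> _] := repr_kval a.1; rewrite const_valE ?fun_sym0//.
elim: (a.2) => /= [|y vs IHv]; first by rewrite big_nil !rmorph1.
rewrite big_cons rmorphM IHv; congr (_ * _); rewrite tnth_mktuple.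
have e : onum O 0 = fun=> 0 by apply/funext => u; exact: rmorph0.
by have [h _] := forall2_nth y (repr_num 0) htb; rewrite e in h.
Qed.

Lemma eval_atruth (b : cond m l) : cond_defined theta b ->
  eval (atruth (dual_sym p) tb b) = ((cond_holds theta b (table_state m theta p tb'))%:R : R)%:C%C.
Proof.
elim: b => /= [|q r|q r|q r|b IH|b1 IH1 b2 IH2|b1 IH1 b2 IH2].
- by rewrite !rmorph1.
- move=> /andP[hq hr]; rewrite !eval_apoly// !lecR eq_le.
  by case: (poly_eval _ q _ <= _); case: (poly_eval _ r _ <= _) => /=; rewrite ?rmorph1 ?rmorph0.
- move=> /andP[hq hr]; rewrite !eval_apoly// !lecR.
  by case: ifP => //=; rewrite ?rmorph1 ?rmorph0.
- move=> /andP[hq hr]; rewrite !eval_apoly// !lecR ltNge.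
  by case: ifP => //=; rewrite ?rmorph1 ?rmorph0.
- move=> /IH ->; rewrite rmorph1; case: cond_holds => /=; rewrite ?rmorph1 ?rmorph0 ?subrr ?subr0//.
- by move=> /andP[/IH1 -> /IH2 ->]; do 2 case: cond_holds => /=; rewrite ?rmorph1 ?rmorph0 ?mulr0 ?mul0r ?mulr1.
- move=> /andP[/IH1 -> /IH2 ->]; rewrite rmorph1.
  by do 2 case: cond_holds => /=; rewrite ?rmorph1 ?rmorph0 ?subrr ?subr0 ?mul0r ?mul1r ?addr0 ?add0r.
Qed.

Lemma repr_truth (b : cond m l) : cond_defined theta b ->
  represents (dual_truth (dual_sym p) b tb) (fun_truth theta p b tb').
Proof.
move=> hb; split; first exact: eval_atruth.
by exists 0; split; [exact: is_derive_cst|rewrite /= !rmorph0].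
Qed.
End Truth.

Section Wp.
Variables (F : m.-tuple (seq (const 'I_l))).
Let dG := range_values dO (dual_sym p) F.
Let fG := fun_ranges theta p F.

Lemma repr_indicator b : cond_defined theta b ->
  rpoly (indicator dO (dual_truth (dual_sym p)) dG b) (indicator O (fun_truth theta p) fG b).
Proof.
move=> hb; apply: repr_compl; apply: repr_prod.
apply: forall2_map (repr_grid (repr_ranges F)) => tb tb' htb; apply: repr_compl.
by apply: repr_cell => //; [exact: repr_ranges|exact: repr_truth].
Qed.

Lemma repr_wp c q q' : stmt_valid D theta c -> rpoly q q' ->
  rpoly (wp dO (dual_sym p) (dist_moment D) (dual_truth (dual_sym p)) dG c q)
        (wp O (fun_sym theta p) (dist_moment D) (fun_truth theta p) fG c q').
Proof.
elim: c q q' => [|x [d args|alts]|c1 IH1 c2 IH2|b c1 IH1 c2 IH2] q q' //=.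
- by move=> _ hq; apply: repr_draw => // j; exact: repr_draw_moment.
- move=> _ hq; apply: forall2_flatten; elim: alts => /= [|a alts IH]; constructor => //.
  by apply: repr_scale; [exact: repr_kval|apply: repr_subst => //; exact: repr_kpoly].
- by move=> [v1 v2] hq; apply: IH1 => //; exact: IH2.
- move=> [hb v1 v2] hq; apply: forall2_cat; apply: repr_pmul; try exact: repr_indicator.
  + exact: IH1.
  + by apply: repr_compl; exact: repr_indicator.
  + exact: IH2.
Qed.

Lemma repr_ev0 (q : lpoly (dual l) m) q' : rpoly q q' -> represents (ev0 dO q) (ev0 O q').
Proof.
elim=> [|a a' r r' [h e] _ IH]; first exact: repr_num.
by apply: repr_add => //; rewrite e; case: ifP => _ //; exact: repr_num.
Qed.

Lemma repr_wp_moment (P : loop m l) x k n : loop_valid D theta P ->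
  represents
    (wp_moment dO (dual_sym p) (dist_moment D) (dual_truth (dual_sym p)) dG (loop_init P) (loop_body P) x k n)
    (wp_moment O (fun_sym theta p) (dist_moment D) (fun_truth theta p) fG (loop_init P) (loop_body P) x k n).
Proof.
move=> [vi vb]; apply: repr_ev0; apply: repr_wp => //.
elim: n => [|n IH] /=; last exact: repr_wp.
by constructor => //; split=> //; exact: repr_num.
Qed.
End Wp.

End Represents.

(** * Recurrences pass to the derivative *)

Section LimitRecurrence.
Variable R : realType.
Implicit Types (q : {poly R}) (w : nat -> R).

(** Dividing by the largest coefficient prevents the relation from degenerating in a limit. *)
Lemma kills_normalized q w n : q != 0 -> (size q <= n.+1)%N -> kills q w ->
  exists g : 'rV[R]_n.+1, [/\ forall j, `|g 0 j| <= 1, exists j, `|g 0 j| = 1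
    & forall i, \sum_j g 0 j * w (i + j)%N = 0].
Proof.
move=> q0 qn qw; pose a (j : 'I_n.+1) := `|q`_j|.
have [j0 max] : exists j0, forall j, a j <= a j0.
  by have [j0 _ maxj0] := arg_maxP (I := 'I_n.+1) a (P := xpredT) (i0 := ord0) isT; exists j0 => j; exact: maxj0.
have a0 : a j0 != 0.
  apply: contraNneq q0 => aj0; apply/eqP/polyP => j; rewrite coef0.
  have [jn|jn] := ltnP j n.+1; last by rewrite nth_default// (leq_trans qn).
  by have := max (Ordinal jn); rewrite aj0 normr_le0 => /eqP.
have ap : 0 < a j0 by rewrite lt_neqAle eq_sym a0 normr_ge0.
exists (\row_j (q`_j / a j0)); split.
- by move=> j; rewrite mxE normrM normfV (ger0_norm (ltW ap)) ler_pdivrMr// mul1r; exact: max.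
- by exists j0; rewrite mxE normrM normfV (ger0_norm (ltW ap)) divff.
- move=> i; have /(congr1 ( *%R^~ (a j0)^-1)) := qw i.
  rewrite (@pactE _ n.+1)// mul0r mulr_suml; apply: etrans.
  by apply: eq_bigr => j _; rewrite mxE mulrAC.
Qed.

(** The sequences at [t] and at [t0] have annihilators q and q0, so their difference quotient has q
    q0, of degree at most [N + N]. No continuity in [t] is known for q, but normalized coefficient
    vectors lie in a compact cube, and a cluster point of them annihilates the limit of the
    quotients. *)
Lemma limit_recurrence N (U : R -> nat -> R) (v : nat -> R) t0 :
  (forall n, is_derive t0 (1 : R) (fun t => U t n) (v n)) ->
  (\forall t \near t0, exists q, [/\ q != 0, (size q <= N.+1)%N & kills q (U t)]) ->
  exists q, [/\ q != 0, (size q <= (N + N).+1)%N & kills q v].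
Proof.
move=> dU nearU; pose M := (N + N)%N.
pose y h n := h^-1 * (U (h + t0) n - U t0 n).
have ycvg n : y h n @[h --> 0^'] --> v n.
  have [dn vn] := dU n; rewrite -vn.
  have : h^-1 *: (U (h *: (1 : R) + t0) n - U t0 n) @[h --> 0^'] --> 'D_1 (fun t => U t n) t0 by exact: dn.
  by under eq_fun do rewrite /GRing.scale/= mulr1.
have [q0 [q00 sq0 kq0]] := nbhs_singleton nearU.
have near_y : \forall h \near 0^', exists g : 'rV[R]_M.+1, [/\ forall j, `|g 0 j| <= 1,
    exists j, `|g 0 j| = 1 & forall i, \sum_j g 0 j * y h (i + j)%N = 0].
  have : \forall h \near (0 : R), exists q, [/\ q != 0, (size q <= N.+1)%N & kills q (U (h + t0))].
    have /(_ 0) : continuous (fun h : R => h + t0).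
      by move=> h; apply: cvgD; [exact: cvg_id|exact: cvg_cst].
    by rewrite /continuous_at add0r => /(_ _ nearU).
  move=> /nbhs_dnbhs; apply: filterS => h [q [q1 sq kq]].
  apply: (@kills_normalized (q * q0)).
  - by rewrite mulf_neq0.
  - rewrite (leq_trans (size_polyMleq _ _))//; move: sq sq0.
    by rewrite /M; case: (size q) (size q0) => [|a] [|b] //=; lia.
  - move=> i; rewrite (@pact_ext _ _ _ (fun n => h^-1 * U (h + t0) n + (- h^-1) * U t0 n)); last first.
      by move=> n; rewrite /y mulrBr mulNr.
    rewrite pact_lin (kills_mull _ kq0) mulr0 addr0.
    have z i' : pact (q * q0) (fun n => 0 + h^-1 * U (h + t0) n) i' = 0.
      by rewrite pact_lin (kills_mulr _ kq) mulr0 addr0 /pact big1// => j _; rewrite mulr0.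
    by rewrite -[RHS](z i); apply: pact_ext => n; rewrite add0r.
(* The normalized relations have a cluster point, which is again normalized. *)
pose good h (g : 'rV[R]_M.+1) := [/\ forall j, `|g 0 j| <= 1,
    exists j, `|g 0 j| = 1 & forall i, \sum_j g 0 j * y h (i + j)%N = 0].
have /choice[g hg] : forall h, exists g : 'rV[R]_M.+1, (exists g', good h g') -> good h g.
  move=> h; have [[g' hg']|hn] := pselect (exists g', good h g'); first by exists g'.
  by exists 0.
have near_g : \forall h \near 0^', good h (g h) by apply: filterS near_y => h /hg.
have cK : compact [set x : 'rV[R]_M.+1 | forall i, x ord0 i \in `[(- 1 : R), 1]].
  by apply: (@rV_compact _ _ (fun=> `[(- 1 : R), 1]%classic)) => i; exact: segment_compact.
have [|x [xK clx]] := cK (g @ 0^') _.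
  apply: filterS near_g => h [h1 _ _] j /=; rewrite in_itv/=.
  by rewrite -ler_norml; exact: h1.
(* What [g h] satisfies for all small [h] is satisfied by vectors arbitrarily close to the cluster
   point. *)
have clP (A : set 'rV[R]_M.+1) (e : R) : 0 < e -> (\forall h \near 0^', A (g h)) ->
    exists2 z, A z & forall j, `|x 0 j - z 0 j| < e.
  move=> e0 hA; have [z [Az [_ zB]]] := clx A (ball x e) hA (nbhsx_ballx x e e0).
  by exists z => // j; exact: (zB 0 j).
exists (\poly_(j < M.+1) x 0 (inord j)).
have coefx (j : 'I_M.+1) : (\poly_(j < M.+1) x 0 (inord j))`_j = x 0 j.
  by rewrite coef_poly ltn_ord inord_val.
split; last 2 first.
- exact: size_poly.
- move=> i; rewrite (@pactE _ M.+1) ?size_poly//; under eq_bigr do rewrite coefx.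
  set c := \sum_j _; apply: contrapT => /eqP c0.
  (* Half of |c| pays for replacing [v] by [y h], the other half for replacing [x] by a nearby [z];
     K bounds the sum of the |v|, and the summand 1 makes it positive. *)
  pose K := 1 + \sum_(j < M.+1) `|v (i + j)%N|.
  have K0 : 0 < K by rewrite ltr_pwDl// sumr_ge0.
  have c2 : 0 < `|c| / 2 by rewrite divr_gt0// normr_gt0.
  have [] := clP [set w : 'rV[R]_M.+1 | `|\sum_j w 0 j * v (i + j)%N| < `|c| / 2] (`|c| / 2 / K) (divr_gt0 c2 K0).
    have : \forall h \near 0^', forall j : 'I_M.+1, `|v (i + j)%N - y h (i + j)%N| < `|c| / 2 / M.+1%:R.
      apply: filter_forall => j; have := ycvg (i + j)%N => /cvgrPdist_lt; apply.
      by rewrite divr_gt0.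
    move=> hy; apply: filterS2 hy near_g => h hv [g1 _ gy] /=.
    have -> : \sum_j g h 0 j * v (i + j)%N = \sum_j g h 0 j * (v (i + j)%N - y h (i + j)%N).
      by under [RHS]eq_bigr do rewrite mulrBr; rewrite sumrB gy subr0.
    rewrite (le_lt_trans (ler_norm_sum _ _ _))//.
    apply: (@lt_le_trans _ _ (\sum_(j < M.+1) `|c| / 2 / M.+1%:R)); last first.
      by rewrite sumr_const card_ord -[X in X <= _]mulr_natr divfK// pnatr_eq0.
    apply: ltr_sum => [|j _]; first by apply/hasP; exists ord0 => //; rewrite mem_index_enum.
    by rewrite normrM (le_lt_trans _ (hv j))// ler_piMl.
  move=> z Az zB; have : `|c| < `|c| / 2 + `|c| / 2.
    have : c = c - \sum_j z 0 j * v (i + j)%N + \sum_j z 0 j * v (i + j)%N by rewrite subrK.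
    move=> /(congr1 Num.norm) => {1}->; apply: le_lt_trans (ler_normD _ _) _.
    apply: ler_ltD => //.
    have -> : c - \sum_j z 0 j * v (i + j)%N = \sum_j (x 0 j - z 0 j) * v (i + j)%N.
      by under [RHS]eq_bigr do rewrite mulrBl; rewrite sumrB.
    rewrite (le_trans (ler_norm_sum _ _ _))//.
    apply: (@le_trans _ _ (\sum_(j < M.+1) `|c| / 2 / K * `|v (i + j)%N|)).
      by apply: ler_sum => j _; rewrite normrM ler_wpM2r// ltW.
    rewrite -mulr_sumr mulrAC ler_pdivrMr// ler_wpM2l ?(ltW c2)// /K lerDr//.
  by rewrite -splitr ltxx.
(* A vector at distance less than 1 has a coordinate of absolute value 1, so [x] is not 0. *)
apply/negP => /eqP q0'.
have [|z [j zj] zB] := clP [set w : 'rV[R]_M.+1 | exists j, `|w 0 j| = 1] 1 ltr01.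
  by apply: filterS near_g => h [].
have := zB j; have -> : x 0 j = 0 by rewrite -coefx q0' coef0.
by rewrite sub0r normrN zj ltxx.
Qed.

End LimitRecurrence.

(** * Variable weights from the dependency graph *)

Lemma in_has (T : Type) (a : pred T) (s : seq T) x : List.In x s -> a x -> has a s.
Proof. by move=> + ax; elim: s => //= y s IH [->|/IH ->]; rewrite ?ax ?orbT. Qed.

Lemma all_in (T : Type) (a : pred T) (s : seq T) : (forall x, List.In x s -> a x) -> all a s.
Proof.
elim: s => //= y s IH h; rewrite h; last by left.
by apply: IH => x hx; apply: h; right.
Qed.

Section Weights.
Variables (m l : nat) (P : loop m l) (s : nat).

Definition dep_rank (x : 'I_m) : nat :=
  #|[pred u | connect (depends P) x u && [exists v, depends_nonlinear P u v]]|.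

Definition dep_weight (x : 'I_m) : nat := (s ^ dep_rank x)%N.

Lemma depends_nonlinearW x y : depends_nonlinear P x y -> depends P x y.
Proof.
apply: sub_has => a /andP[-> h] /=; apply/orP; left; move: h; apply: sub_has => q.
elim: q => //= b q IH; rewrite /poly_nonlinear_vars /poly_vars /= mem_cat.
case: ifP => _ /=; last by move=> /IH ->; rewrite orbT.
by rewrite mem_cat => /orP[->|/IH ->]; rewrite ?orbT.
Qed.

Lemma dep_rank_le x y : depends P x y -> (dep_rank y <= dep_rank x)%N.
Proof.
move=> xy; apply/subset_leq_card/fintype.subsetP => u; rewrite !inE => /andP[yu ->].
by rewrite andbT (connect_trans (connect1 xy)).
Qed.

Hypothesis acyclic : forall x, ~ depends_nonlinear_trans P x x.

(** [x] itself is counted for [x] but not for [y]: reaching [x] from [y] would close a non-linear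
    cycle. *)
Lemma dep_rank_lt x y : depends_nonlinear P x y -> (dep_rank y < dep_rank x)%N.
Proof.
move=> xy; apply/proper_card/properP; split.
  apply/fintype.subsetP => u; rewrite !inE => /andP[yu ->].
  by rewrite andbT (connect_trans (connect1 (depends_nonlinearW xy))).
exists x; first by rewrite inE connect0; apply/existsP; exists y.
rewrite inE negb_and; apply/orP; left; apply/negP => yx.
by apply: (acyclic (x := x)); exists x, y; split.
Qed.

Hypothesis s_gt0 : (0 < s)%N.

Lemma dep_weight_gt0 x : (0 < dep_weight x)%N.
Proof. by rewrite expn_gt0 s_gt0. Qed.

Hypothesis monomial_size : forall a, List.In a (loop_assigns P) ->
  forall q, List.In q (rhs_polys a.1.2) -> forall b, List.In b q -> (size b.2 <= s)%N.

(** A linear monomial has a variable of no larger rank. In a non-linear one, at most [s] variables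
    have weight at most s^(r-1) each, where r is the rank of the assigned variable; this adds up to
    at most s^r. *)
Lemma weight_monomial a q b : List.In a (loop_assigns P) -> List.In q (rhs_polys a.1.2) ->
  List.In b q -> (weight dep_weight b.2 <= dep_weight a.1.1)%N.
Proof.
move=> ha hq hb; have szb := monomial_size ha hq hb.
have [b1|b1] := leqP (size b.2) 1.
  have dy y : y \in b.2 -> depends P a.1.1 y.
    move=> yb; apply: (in_has ha); rewrite eqxx /=; apply/orP; left; apply: (in_has hq).
    elim: (q) hb => //= c q' IH; rewrite /poly_vars /= mem_cat => -[->|/IH->]; rewrite ?yb ?orbT//.
  rewrite /weight; case: (b.2) b1 dy => [|y [|? ?]] //; first by rewrite big_nil.
  by move=> _ dy; rewrite big_seq1 leq_pexp2l// dep_rank_le// dy// inE.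
have dy y : y \in b.2 -> depends_nonlinear P a.1.1 y.
  move=> yb; apply: (in_has ha); rewrite eqxx /=; apply: (in_has hq).
  elim: (q) hb => //= c q' IH; rewrite /poly_nonlinear_vars /= => -[->|/IH h].
    by rewrite b1 /= mem_cat yb.
  by case: ifP => _ //=; rewrite mem_cat h orbT.
have r0 : (0 < dep_rank a.1.1)%N.
  case: (b.2) b1 dy => // y vs _ dy.
  by rewrite (leq_ltn_trans _ (dep_rank_lt (dy y _)))// inE eqxx.
apply: (@leq_trans (\sum_(y <- b.2) s ^ (dep_rank a.1.1).-1)%N).
  rewrite /weight big_seq [X in (_ <= X)%N]big_seq; apply: leq_sum => y /dy/dep_rank_lt h.
  by rewrite leq_pexp2l// -ltnS prednK.
rewrite big_const_seq count_predT iter_addn_0 -[X in (_ <= X)%N]/(s ^ _)%N.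
by rewrite -(prednK r0) expnSr /= leq_mul2l szb orbT.
Qed.

Lemma wt_ok_assigns g c :
  (forall a, List.In a (stmt_assigns g c) -> List.In a (loop_assigns P)) -> wt_ok dep_weight c.
Proof.
elim: c g => //= [x [//|alts]|c1 IH1 c2 IH2|b c1 IH1 c2 IH2] g h.
- apply: all_in => a ha; apply: all_in => b hb.
  apply: (@weight_monomial (x, RChoice alts, g) a.1); [by apply: h; left| |exact: hb].
  exact: List.in_map.
- by apply/andP; split; [apply: (IH1 g)|apply: (IH2 g)] => a ha; apply: h; apply/List.in_app_iff; [left|right].
- by apply/andP; split; [apply: (IH1 (g ++ cond_vars b))|apply: (IH2 (g ++ cond_vars b))] => a ha;
    apply: h; apply/List.in_app_iff; [left|right].
Qed.

Lemma wt_ok_body : wt_ok dep_weight (loop_body P).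
Proof. by apply: (@wt_ok_assigns [::]) => a ha; apply/List.in_app_iff; right. Qed.

Hypothesis m_le : (m <= s)%N.

Lemma dep_weight_le x : (dep_weight x <= s ^ s)%N.
Proof.
rewrite leq_pexp2l// (leq_trans _ m_le)//.
by rewrite (leq_trans (max_card _))// card_ord.
Qed.

Lemma dep_weight_bound x : (dep_weight x <= weight_bound s)%N.
Proof. by rewrite (leq_trans (dep_weight_le x))// leq_pmull. Qed.

Lemma weight_nseq x k : (k <= s)%N -> (weight dep_weight (nseq k x) <= weight_bound s)%N.
Proof.
move=> ks; rewrite /weight big_nseq iter_addn_0 mulnC.
by rewrite leq_mul// dep_weight_le.
Qed.

End Weights.

(** * Bounds by the size of the encoded input *)

Section InputSize.
Variables (m l : nat).

Lemma tree_size_nat n : tree_size (enc_nat n) = n.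
Proof. by elim: n => //= n ->. Qed.

Lemma size_enc_list ts : (size ts <= tree_size (enc_list ts))%N.
Proof. by elim: ts => //= t ts IH; rewrite ltnS (leq_trans IH)// leq_addl. Qed.

Lemma in_enc_list t ts : List.In t ts -> (tree_size t <= tree_size (enc_list ts))%N.
Proof. by elim: ts => //= u ts IH [->|/IH h]; lia. Qed.

Lemma in_enc_tag n t ts : List.In t ts -> (tree_size t <= tree_size (enc_tag n ts))%N.
Proof. by move=> /in_enc_list h; rewrite (leq_trans h)//= leqW// leq_addl. Qed.

Lemma in_stmt_assigns g (c : stmt m l) a : List.In a (stmt_assigns g c) ->
  (tree_size (enc_rhs a.1.2) <= tree_size (enc_stmt c))%N.
Proof.
elim: c g => //= [x e|c1 IH1 c2 IH2|b c1 IH1 c2 IH2] g.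
- by move=> [<-|//]; apply: (in_enc_tag 1 (ts := [:: enc_ord x; enc_rhs e])); right; left.
- by move=> /List.in_app_iff[/IH1|/IH2] h; apply: (leq_trans h);
    apply: (in_enc_tag 2 (ts := [:: enc_stmt c1; enc_stmt c2])); [left|right; left].
- by move=> /List.in_app_iff[/IH1|/IH2] h; apply: (leq_trans h);
    apply: (in_enc_tag 3 (ts := [:: enc_cond b; enc_stmt c1; enc_stmt c2])); [right; left|right; right; left].
Qed.

Lemma monomial_size_rhs (e : rhs m l) q b : List.In q (rhs_polys e) -> List.In b q ->
  (size b.2 <= tree_size (enc_rhs e))%N.
Proof.
case: e => // alts /List.in_map_iff[a [<- ha]] hb.
apply: (leq_trans _ (in_enc_tag 1 (ts := [:: enc_list [seq Node (enc_poly b.1) (enc_k b.2) | b <- alts]]) (or_introl erefl))).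
apply: (leq_trans _ (in_enc_list (List.in_map _ _ _ ha))) => /=.
apply: (leq_trans _ (leqW (leq_addr _ _))).
apply: (leq_trans _ (in_enc_list (List.in_map _ _ _ hb))) => /=.
by apply: (leq_trans _ (leqW (leq_addl _ _))); rewrite (leq_trans _ (size_enc_list _))// size_map.
Qed.

Variables (P : loop m l) (F : m.-tuple (seq (const 'I_l))) (x : 'I_m) (p : 'I_l) (k : nat).
Local Notation s := (tree_size (enc_input P F x p k)).

Let component t (h : List.In t [:: enc_nat m; enc_nat l; enc_stmt (loop_init P);
  enc_stmt (loop_body P); enc_list [seq enc_list (map (@enc_k l) es) | es <- F];
    enc_ord x; enc_ord p; enc_nat k]) : (tree_size t <= s)%N := in_enc_list h.

Lemma input_vars : (m <= s)%N.
Proof. by rewrite -[X in (X <= _)%N]tree_size_nat; apply: component; left. Qed.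

Lemma input_power : (k <= s)%N.
Proof. by rewrite -[X in (X <= _)%N]tree_size_nat; apply: component; do 7 right; left. Qed.

Lemma input_range y : (size (tnth F y) <= s)%N.
Proof.
apply: (leq_trans _ (component (t := enc_list [seq enc_list (map (@enc_k l) es) | es <- F]) _)); last by do 4 right; left.
apply: (leq_trans _ (in_enc_list (List.in_map _ _ (tnth F y) _))).
  by rewrite (leq_trans _ (size_enc_list _))// size_map.
by rewrite (tnth_nth [::]); apply: in_nth; rewrite size_tuple.
Qed.

Lemma input_monomial a : List.In a (loop_assigns P) ->
  forall q, List.In q (rhs_polys a.1.2) -> forall b, List.In b q -> (size b.2 <= s)%N.
Proof.
move=> ha q hq b hb; apply: leq_trans (monomial_size_rhs hq hb) _.
by move: ha => /List.in_app_iff[/in_stmt_assigns h|/in_stmt_assigns h];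
  apply: (leq_trans h); apply: component; [do 2 right; left|do 3 right; left].
Qed.

End InputSize.

(** * Regular parameter values *)

Lemma forall2_in (A B : Type) (Q : A -> B -> Prop) s t b :
  List.Forall2 Q s t -> List.In b t -> exists a, Q a b.
Proof.
elim=> //= a b' s' t' ab _ IH [<-|/IH//]; by exists a.
Qed.

Lemma near_list (T U : Type) (F : set_system U) {FF : Filter F} (s : seq T) (Q : T -> U -> Prop) :
  (forall a, List.In a s -> \forall t \near F, Q a t) ->
  \forall t \near F, forall a, List.In a s -> Q a t.
Proof.
elim: s => [|a s IH] h; first exact: filterE.
have h1 : \forall t \near F, Q a t by apply: h; left.
have h2 : \forall t \near F, forall b, List.In b s -> Q b t by apply: IH => b hb; apply: h; right.
by apply: filterS2 h1 h2 => t h1 h2 b /= [<-|/h2].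
Qed.

Lemma in_flatten_nth (T : Type) (ss : seq (seq T)) n a :
  List.In a (nth [::] ss n) -> List.In a (flatten ss).
Proof.
elim: ss n => [|s ss IH] [|n] //= h; apply/List.in_app_iff; first by left.
by right; exact: IH h.
Qed.

Section Regular.
Variables (R : realType) (D : distributions R) (m l : nat) (P : loop m l).
Variables (F : m.-tuple (seq (const 'I_l))) (p : 'I_l) (theta : 'I_l -> R).
Hypotheses (adm : admissible D F P) (reg : regular D F P p theta).
Variables (x : 'I_m) (k : nat).
Local Notation t0 := (theta p).
Local Notation O := (fun_ops t0).
Local Notation th t := (set_param theta p t).
Local Notation ranges := (fun_ranges theta p F).
Local Notation s := (tree_size (enc_input P F x p k)).

Lemma regular_valid : loop_valid D theta P.
Proof.
by have [+ _] := nbhs_singleton reg; congr (loop_valid D _ P); exact: (fun_sym0 theta p).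
Qed.

(* The denominators of the Lagrange factors do not vanish near [theta p]. *)
Lemma near_separated : \forall t \near t0, forall y c c', List.In c (nth [::] ranges y) ->
  List.In c' (nth [::] ranges y) -> c t0 != c' t0 -> c t != c' t.
Proof.
(* Range values are represented by dual numbers, hence differentiable at [t0]. *)
have cont c : List.In c (flatten ranges) -> {for t0, continuous c}.
  move=> /(forall2_in (forall2_flatten (repr_ranges theta p F)))[d [_ [du [cd _]]]].
  by apply: differentiable_continuous; apply/derivable1_diffP.
have : \forall t \near t0, forall c, List.In c (flatten ranges) ->
    forall c', List.In c' (flatten ranges) -> c t0 != c' t0 -> c t != c' t.
  apply: (@near_list _ _ (nbhs t0)) => c /cont hc; apply: (@near_list _ _ (nbhs t0)) => c' /cont hc'.
  have [e|ne] := eqVneq (c t0) (c' t0); first exact: filterE.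
  have h : (fun t => c t - c' t) @ t0 --> c t0 - c' t0 by apply: cvgB.
  have ne' : c t0 - c' t0 != 0 by rewrite subr_eq0.
  have /(_ _) := cvgr_neq0 _ h ne'.
  by apply: filterS => t + _; rewrite subr_eq0.
by apply: filterS => t h y c c' hc hc'; apply: h; apply: in_flatten_nth; eassumption.
Qed.

Let fun_moment n : R -> R := wp_moment O (fun_sym theta p) (dist_moment D) (fun_truth theta p)
  ranges (loop_init P) (loop_body P) x k n.

Lemma recurrence_order_le : (recurrence_order m (weight_bound s) s <= order_bound s)%N.
Proof.
have s0 : (0 < s)%N by [].
have h : ((weight_bound s).+1 ^ m <= dim_bound s)%N by rewrite leq_pexp2l// input_vars.
by rewrite leq_mul// leq_pexp2l.
Qed.

(** The polynomial [q] is found for each [t] separately; only the bound on its degree is common to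
    all of them. *)
Lemma near_moments : \forall t \near t0,
  (forall n, fun_moment n t = moment D P x k n (th t)) /\
  exists q : {poly R}, [/\ q != 0, (size q <= (order_bound s).+1)%N &
    kills q (fun n => fun_moment n t)].
Proof.
have [fin acyclic] := adm.
have [Fdef _ _] := fin _ regular_valid.
apply: filterS2 reg near_separated => t [valid same] sep.
have [_ br_init br_body] := fin _ valid.
have exact_ind b : List.In b (loop_conds P) ->
    indicator_exact theta p t ranges F (fun_truth theta p) b.
  move=> /(List.In_nth _ _ CTrue)[i [_ nthb]].
  have e : nth CTrue (loop_conds P) i = b.
    by rewrite -nthb; elim: (loop_conds P) i {nthb} => [|a r IH] [|i] //=.
  by apply: (indicator_exactP Fdef sep) => idx; have := same i idx; rewrite e.
have s0 : (0 < s)%N by [].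
have mono := @input_monomial m l P F x p k.
have U_moment n : fun_moment n t = moment D P x k n (th t).
  exact: (wp_momentE regular_valid valid exact_ind).
split=> //.
have [|g [[j gj] hg]] := moments_recurrence (dep_weight_gt0 P s0)
  (dep_weight_bound P s0 (input_vars P F x p k)) (input_range P F x p k) s0 regular_valid valid exact_ind
  (wt_ok_body acyclic s0 mono) br_body (x := x) (k := k).
  exact: (weight_nseq P s0 (input_vars P F x p k) x (input_power P F x p k)).
have coefg (j' : 'I__) : (\poly_(j < (recurrence_order m (weight_bound s) s).+1) g (inord j))`_j' = g j'.
  by rewrite coef_poly ltn_ord inord_val.
exists (\poly_(j < (recurrence_order m (weight_bound s) s).+1) g (inord j)); split.
- by apply: contraNneq gj => q0; rewrite -coefg q0 coef0.
- by rewrite (leq_trans (size_poly _ _))// ltnS recurrence_order_le.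
- move=> i; rewrite (pactE _ _ (size_poly _ _)) -[RHS](hg i).
  by apply: eq_bigr => j' _; rewrite coefg U_moment.
Qed.

Definition sensitivity (n : nat) : R := derive1 (fun t => moment D P x k n (th t)) t0.

(** The moment and the value of the algorithm agree near [theta p], so they have the same derivative
    there. *)
Lemma sensitivity_represented n :
  derivable (fun t => moment D P x k n (th t)) t0 1 /\
  aexp_eval theta (sensitivity_term (dist_moment D) F (loop_init P) (loop_body P) x p k n) =
    (sensitivity n)%:C%C /\ is_derive t0 (1 : R) (fun_moment n) (sensitivity n).
Proof.
have [_ [du [hdu evdu]]] := repr_wp_moment p F x k n regular_valid.
have e : {near t0, fun_moment n =1 (fun t => moment D P x k n (th t))}.
  by apply: filterS near_moments => t [].
have dm : is_derive t0 (1 : R) (fun t => moment D P x k n (th t)) du.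
  exact: near_eq_is_derive e hdu.
have -> : sensitivity n = du by rewrite /sensitivity derive1E derive_val.
by split; [exact: ex_derive|].
Qed.

(** The real recurrence for the derivative is carried over to the complex numbers, where
    characteristic polynomials split. *)
Lemma sensitivity_closed_form n :
  cf_eval theta (main_alg (dist_moment D) s F (loop_init P) (loop_body P) x p k) n =
    (sensitivity n)%:C%C.
Proof.
have [|q [q0 sq kq]] := @limit_recurrence _ (order_bound s) (fun t n => fun_moment n t) sensitivity t0
  (fun n => (sensitivity_represented n).2.2).
  by apply: filterS near_moments => t [].
apply: (@closed_form_ofP _ _ _ _ (fun n => (sensitivity n)%:C%C) _ (map_poly (real_complex R) q)).
- by rewrite addn_gt0 !muln_gt0 !expn_gt0.
- move=> n' hn'; rewrite /entry (nth_map 0%N) ?size_iota// nth_iota//.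
  exact: (sensitivity_represented n').2.1.
- by rewrite map_poly_eq0.
- by rewrite size_map_poly.
- move=> i; rewrite /pact size_map_poly -[RHS](rmorph0 (real_complex R)) -(kq i) rmorph_sum.
  by apply: eq_bigr => j _; rewrite coef_map rmorphM.
Qed.

End Regular.

Theorem theorem1 (R : realType) (D : distributions R) :
  exists A : lprog,
  forall (m l : nat) (P : loop m l) (F : m.-tuple (seq (const 'I_l))),
  admissible D F P ->
  forall (x : 'I_m) (p : 'I_l) (k : nat),
  exists c : closed_form l,
    computes A (enc_input P F x p k) (enc_closed_form c) /\
    forall theta : 'I_l -> R, regular D F P p theta ->
    forall n : nat,
      let E := fun t : R => moment D P x k n (set_param theta p t) in
      derivable E (theta p) 1 /\ (derive1 E (theta p))%:C%C = cf_eval theta c n.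
Proof.
have [B hB] := dist_moment_computable D.
have [|A hA] := @main_alg_computable (dist_moment D).
  by apply: (c_prog (A := B)) => _ [d k]; exact: hB.
exists A => m l P F adm x p k; eexists; split; first exact: hA.
move=> theta reg n /=; rewrite (sensitivity_closed_form adm reg).
by split=> //; exact: (sensitivity_represented adm reg x k n).1.
Qed.
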